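(* Let $N$ be the Hawkes process with exciting functions $(\gamma_{n})_{n\ge0}$ (defined in the context), and assume: (i) $\overline{\gamma}_{0}:=\lim_{t\to\infty}\frac{1}{t}\int_{0}^{t}\gamma_{0}(s)\,ds$ exists and is finite; (ii) $\rho:=\sup_{n\in\mathbb{N}}\int_{0}^{\infty}\gamma_{n}(t)\,dt<1$; (iii) $\lim_{t\to\infty}\sqrt{t}\left[\frac{1}{t}\int_{0}^{t}\gamma_{0}(s)ds-\overline{\gamma}_{0}\right]=0$ and $\lim_{t\to\infty}\sqrt{t}\int_{t}^{\infty}\sum_{p=1}^{\infty}(\gamma_{p}\ast\cdots\ast\gamma_{1})(s)\,ds=0$. Let $a(t)$ be a positive function with $a(t)/\sqrt{t}\to\infty$ and $a(t)/t\to0$ as $t\to\infty$. Then for every Borel set $A\subseteq\mathbb{R}$, $$-\inf_{x\in A^{o}}J(x)\le\liminf_{t\to\infty}\frac{t}{a(t)^{2}}\log\mathbb{P}\left(\frac{N_{t}-mt}{a(t)}\in A\right)\le\limsup_{t\to\infty}\frac{t}{a(t)^{2}}\log\mathbb{P}\left(\frac{N_{t}-mt}{a(t)}\in A\right)\le-\inf_{x\in\overline{A}}J(x),$$ where $J(x)=\frac{x^{2}}{2\sigma^{2}}$, $m:=\sum_{n\ge0}m_{n}$ with $m_{0}:=\overline{\gamma}_{0}$, $m_{n}:=\overline{\gamma}_{0}\prod_{i=1}^{n}\int_{0}^{\infty}\gamma_{i}(u)du$ for $n\ge1$, and $$\sigma^{2}=\sum_{j=0}^{\infty}\left(1+\s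um_{p=1}^{\infty}\prod_{i=j+1}^{p+j}\int_{0}^{\infty}\gamma_{i}(u)du\right)^{2}m_{j}.$$
   Context: Hawkes process with different exciting functions: given nonnegative locally integrable functions $(\gamma_{n})_{n\ge0}$ on $[0,\infty)$, let $(N^{n})_{n\ge0}$ be simple point processes on $(0,\infty)$ without common jumps such that $N^{0}$ is an inhomogeneous Poisson process with intensity $\gamma_{0}(t)$, and for each $n\ge0$, conditional on $N^{0},\dots,N^{n}$, $N^{n+1}$ is an inhomogeneous Poisson process with intensity $\lambda^{n+1}_{t}=\sum_{\tau\in N^{n},\,0<\tau<t}\gamma_{n+1}(t-\tau)$. Set $N:=\sum_{n\ge0}N^{n}$, $N_{t}:=N(0,t]$. $\ast$ denotes convolution on $[0,\infty)$. *)

(* Defs.v *)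
From HB Require Import structures.
From mathcomp Require Import all_boot all_order all_algebra.
From mathcomp Require Import finmap.
From mathcomp Require Import all_classical all_reals all_analysis.
Set Implicit Arguments. Unset Strict Implicit. Unset Printing Implicit Defensive.
Import Order.TTheory GRing.Theory Num.Def Num.Theory.
Import numFieldNormedType.Exports.
Local Open Scope classical_set_scope.
Local Open Scope ring_scope.

Section hawkes_defs.
Context {R : realType}.
Local Notation mu := (@lebesgue_measure R).

Definition cnt (S : set R) (a b : R) : nat := #|` fset_set (S `&` `]a, b]) |%fset.

Definition poisson_prob (r : R) (k : nat) : R := r ^+ k / k`!%:R * expR (- r).

Definition hintensity (g : R -> R) (S : set R) (t : R) : R :=
  \sum_(tau <- fset_set (S `&` `]0, t[)) g (t - tau).

Definition compens (lam : R -> R) (a b : R) : R :=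
  fine (\int[mu]_(t in `]a, b]) (lam t)%:E)%E.

(* a list of interval constraints (a, b, k) : "k points in (a, b]" *)
Definition intervals_ok (cs : seq (R * R * nat)) : bool :=
  all (fun c => 0 <= c.1.1) cs &&
  pairwise (fun c c' => (c.1.2 <= c'.1.1) || (c'.1.2 <= c.1.1)) cs.

(* the (locally finite) point processes, sets of jump times of N^n *)
Definition count_event {T : Type} (S : T -> set R) (cs : seq (R * R * nat)) : set T :=
  [set w | all (fun c => cnt (S w) c.1.1 c.1.2 == c.2) cs].

(* cylinder events generated by N^0, ..., N^n : constraints (i, a, b, k) *)
Definition past_event {T : Type} (N : nat -> T -> set R) (cs : seq (nat * R * R * nat)) : set T :=
  [set w | all (fun c => cnt (N c.1.1.1 w) c.1.1.2 c.1.2 == c.2) cs].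

Definition is_hawkes {d : measure_display} {T : measurableType d}
  (P : probability T R) (gam : nat -> R -> R) (N : nat -> T -> set R) : Prop :=
  [/\ (forall n w, N n w `<=` `]0, +oo[),
      (forall n w b, finite_set (N n w `&` `]-oo, b])),
      (forall n k w, n != k -> N n w `&` N k w = set0) /\
      (forall n a b, measurable_fun setT (fun w => (cnt (N n w) a b)%:R : R)),
      (* N^0 is an inhomogeneous Poisson process with intensity gamma_0 *)
      (forall cs, intervals_ok cs ->
        P (count_event (N 0%N) cs) =
        (\prod_(c <- cs) poisson_prob (compens (gam 0%N) c.1.1 c.1.2) c.2)%:E) &
      (* conditionally on N^0..N^n, N^(n+1) is an inhomogeneous Poisson process
         with intensity sum_{tau in N^n, tau < t} gamma_(n+1)(t - tau) *)
      (forall n (es : seq (nat * R * R * nat)) cs,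
        all (fun e => (e.1.1.1 <= n)%N) es -> intervals_ok cs ->
        P (past_event N es `&` count_event (N n.+1) cs) =
        (\int[P]_(w in past_event N es)
          (\prod_(c <- cs) poisson_prob
             (compens (hintensity (gam n.+1) (N n w)) c.1.1 c.1.2) c.2)%:E)%E)].

Definition Ntot {T : Type} (N : nat -> T -> set R) (w : T) (t : R) : \bar R :=
  (\sum_(0 <= n <oo) ((cnt (N n w) 0 t)%:R)%:E)%E.

(* iconv gam p = gamma_(p+1) * gamma_p * ... * gamma_1, convolution on [0, oo):
   (f * g)(t) = int_0^t f(t - s) g(s) ds *)
Fixpoint iconv (gam : nat -> R -> R) (p : nat) : R -> \bar R :=
  match p with
  | 0%N => fun t => (gam 1%N t)%:E
  | p'.+1 => fun t => (\int[mu]_(s in `[0%R, t]) ((gam p'.+2 (t - s))%:E * iconv gam p' s))%E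
  end.

Definition intg (gam : nat -> R -> R) (i : nat) : R :=
  fine (\int[mu]_(t in `[0%R, +oo[) (gam i t)%:E)%E.

Definition mn (g0 : R) (gam : nat -> R -> R) (n : nat) : R :=
  g0 * \prod_(1 <= i < n.+1) intg gam i.

Definition mtot (g0 : R) (gam : nat -> R -> R) : R :=
  limn (fun N => \sum_(0 <= n < N) mn g0 gam n).

Definition sigma2 (g0 : R) (gam : nat -> R -> R) : R :=
  limn (fun M => \sum_(0 <= j < M)
    ((1 + limn (fun Q => \sum_(1 <= p < Q) \prod_(j.+1 <= i < (p + j).+1) intg gam i)) ^+ 2
      * mn g0 gam j)).

(* rate function J(x) = x^2 / (2 sigma^2), with the convention x^2/0 = +oo (x != 0) *)
Definition Jrate (s2 : R) (x : R) : \bar R :=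
  if s2 == 0 then (if x == 0 then 0%E else +oo%E) else (x ^+ 2 / (2 * s2))%:E.

Definition elog (x : \bar R) : \bar R := if x == 0%E then -oo%E else (ln (fine x))%:E.

End hawkes_defs.

(* Main.v *)
Require Import Defs.
From HB Require Import structures.
From mathcomp Require Import all_boot all_order all_algebra.
From mathcomp Require Import finmap.
From mathcomp Require Import all_classical all_reals all_analysis.
From mathcomp Require Import measurable_realfun.
From mathcomp Require Import ring lra.
Import Order.TTheory GRing.Theory Num.Def Num.Theory.
Import numFieldNormedType.Exports.
Local Open Scope classical_set_scope.
Local Open Scope ring_scope.

(** Let F_{m,j}(u) be the log-Laplace transform, at theta, of the size of the cluster, over m
further generations and up to age u, of a point of generation j. Conditioning on the
successive generations and using the Laplace functional of a Poisson process gives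
F_{m,j} = theta + (exp F_{m-1,j+1} - 1) * gamma_{j+1}, and the log-Laplace transform of
(N^0 + ... + N^m)(0, t] is ((exp F_{m,0} - 1) * gamma_0)(t). Let A and Q be the first two
moments of the full cluster of an immigrant, so that N has mean rate g0 A and
sigma^2 = g0 Q. For small theta, explicit barriers for the recursion show, uniformly in
m and u, that exp F_{m,0} - 1 is at most theta A + theta^2 / 2 Q + O(theta^3) if
theta >= 0, and at least that if theta <= 0; the two opposite bounds come from the
finite-horizon moments of the cluster. Hypothesis (iii) makes the defect of the
finite-horizon mean O(sqrt t), which is negligible in front of a(t). Letting m tend to
infinity and taking theta = c a(t) / t shows that t / a(t)^2 times the log-Laplace
transform of the centred N_t at theta tends to sigma^2 c^2 / 2, and the Gartner-Ellis
argument for a Gaussian limit concludes. *)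

(** [is_hawkes] only prescribes probabilities of cylinder events: counts on finitely many disjoint
    intervals, intersected with a [past_event]. The Laplace functional is therefore extracted from
    counts, through step functions on a grid and dominated convergence, and conditioning on the past
    is carried by restricting integrals to past events. The bounds come in two kinds because
    dropping the finite horizon has a sign. Replacing the mass of a kernel over [0, u] by its total
    mass raises a convolution with a nonnegative function and lowers one with a nonpositive
    function, so barriers free of m and u work upwards for theta >= 0 and downwards for theta <= 0
    only. In the other directions expR x is compared with 1 + x + x^2 / 2 on the side that the sign
    of x dictates, and the mean keeps its exact horizon: an error r in it contributes theta r, to be
    compared with a(t)^2 / t. The second-order term theta^2 t has the order of the exponent itself,
    so a small relative error is harmless there, and a fixed depth and a fixed age cutoff
    suffice. *)

(** * Moderate deviations from exponential moments *)

(** Testing real levels below [I] treats an infinite infimum of the rate, where [L] must be -oo,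
    together with a finite one. *)
Lemma lee_real_lt (R : realType) (L I : \bar R) :
  (forall l : R, (l%:E < I)%E -> (L <= - l%:E)%E) -> (L <= - I)%E.
Proof.
move=> h; case: I h => [r h|h|h] /=.
- apply/lee_addgt0Pr => e e0; rewrite -leeBlDr //.
  have := h (r - e); rewrite lte_fin ltrBlDr ltrDl => /(_ e0).
  by rewrite leeBlDr// => /le_trans; apply; rewrite -EFinN opprB addrC.
- case: L h => [l h|h|h] //.
    by have := h (- l + 1) (ltry _); rewrite -EFinN lee_fin; clear h; move=> h; exfalso; lra.
  by have := h 0 (ltry _).
- exact: leey.
Qed.

Lemma limf_esup_le_near (R : realType) (f : R -> \bar R) (x : \bar R) :
  (\forall t \near +oo, (f t <= x)%E) -> (limf_esup f (pinfty_nbhs R) <= x)%E.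
Proof.
move=> h; apply: ge_ereal_inf; exists (ereal_sup (f @` [set t | (f t <= x)%E])).
  by exists [set t | (f t <= x)%E].
by apply/ereal_supP => _ [t /= ? <-].
Qed.

Lemma limf_einf_ge_near (R : realType) (f : R -> \bar R) (x : \bar R) :
  (\forall t \near +oo, (x <= f t)%E) -> (x <= limf_einf f (pinfty_nbhs R))%E.
Proof.
move=> h; rewrite /limf_einf leeNr; apply: limf_esup_le_near.
by apply: filterS h => t ht; rewrite leeN2.
Qed.

Lemma limf_einf_le_esup (R : realType) (f : R -> \bar R) :
  (limf_einf f (pinfty_nbhs R) <= limf_esup f (pinfty_nbhs R))%E.
Proof.
rewrite limf_einfE; apply/ereal_supP => _ [V FV <-].
apply/ereal_infP => _ [W FW <-].
have [t [Vt Wt]] := filter_ex (filterI FV FW).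
apply: (@le_trans _ _ (f t)).
  by apply: ge_ereal_inf; exists (f t) => //; exists t.
by apply: le_ereal_sup_tmp; exists (f t) => //; exists t.
Qed.

Lemma elog_le (R : realType) (p : \bar R) (y : R) :
  (0 <= p)%E -> (p <= (expR y)%:E)%E -> (elog p <= y%:E)%E.
Proof.
rewrite /elog; case: eqVneq => [_ _ _|p0 pge0]; first exact: leNye.
case: p pge0 p0 => [r| |] //; rewrite lee_fin => r0 rn.
rewrite lee_fin => ry; rewrite lee_fin -[y]expRK ler_ln ?posrE ?expR_gt0//.
by move: rn; rewrite eqe /= lt_neqAle eq_sym r0 andbT.
Qed.

Lemma elog_ge (R : realType) (p : \bar R) (y : R) :
  (p < +oo)%E -> ((expR y)%:E <= p)%E -> (y%:E <= elog p)%E.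
Proof.
rewrite /elog; case: p => [r| |] // _; rewrite lee_fin => yr.
have r0 : 0 < r by exact: lt_le_trans (expR_gt0 y) yr.
rewrite eqe gt_eqF//= lee_fin -[y]expRK ler_ln ?posrE ?expR_gt0//.
Qed.

(** Markov's inequality in product form; with an exponential [f] it is the Chernoff bound. *)
Lemma ge_cst_integral d (T : measurableType d) (R : realType)
  (P : {measure set T -> \bar R}) (D : set T) (k : R) (f : T -> R) :
  0 <= k -> measurable D -> measurable_fun setT f -> (forall w, 0 <= f w) ->
  (forall w, D w -> k <= f w) ->
  (k%:E * P D <= \int[P]_w (f w)%:E)%E.
Proof.
move=> k0 mD mf f0 kf.
rewrite -(setTI D) setIC -integral_cst//.
apply: (@le_trans _ _ (\int[P]_(w in D) (f w)%:E)%E).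
  rewrite setIT; apply: ge0_le_integral => //.
  - by apply/measurable_EFinP; exact: measurable_funTS.
apply: ge0_subset_integral => //.
- exact/measurable_EFinP.
- by move=> x _; rewrite lee_fin.
- by rewrite setIT.
Qed.

Section moderate_deviations.
Context {d : measure_display} {T : measurableType d} {R : realType}.
Variables (P : probability T R) (Z : R -> T -> R) (b : R -> R) (s2 : R).
Hypothesis s2_ge0 : 0 <= s2.
Hypothesis mZ : forall t, measurable_fun setT (Z t).
Hypothesis b_pinfty : b t @[t --> +oo] --> +oo.

Let K t c := (\int[P]_w (expR (c * b t * Z t w))%:E)%E.

(** The convergence of log [K t c] / [b t] to s2 c^2 / 2, written multiplicatively so that no
    logarithm of an extended real occurs. *)
Hypothesis K_near : forall c e, 0 < e -> \forall t \near +oo,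
  ((expR (b t * (s2 * c ^+ 2 / 2 - e)))%:E <= K t c)%E /\
  (K t c <= (expR (b t * (s2 * c ^+ 2 / 2 + e)))%:E)%E.

Let b_near (M : R) : \forall t \near +oo, M <= b t.
Proof. by move/cvgryPge : b_pinfty; exact. Qed.

Let measurable_expZ (c : R) t : measurable_fun setT (fun w => expR (c * Z t w)).
Proof. by apply: measurableT_comp => //; exact: measurable_funM. Qed.

(** The sign of [c] is free: positive slopes control the upper tail, negative slopes the lower
    one. *)
Let chernoff c t (y : R) (D : set T) : measurable D ->
  (forall w, D w -> y <= c * b t * Z t w) ->
  (P D <= (expR (- y))%:E * K t c)%E.
Proof.
move=> mD hD.
have h : ((expR y)%:E * P D <= K t c)%E.
  by apply: ge_cst_integral => // w Dw; rewrite ler_expR; exact: hD.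
rewrite -(@lee_pmul2l _ (expR y)%:E)//; last by rewrite lte_fin expR_gt0.
by rewrite muleA -EFinM -expRD addrN expR0 mul1e.
Qed.

Let measurable_preimageZ t (B : set R) : measurable B -> measurable (Z t @^-1` B).
Proof. by move=> mB; rewrite -[X in measurable X]setTI; exact: mZ. Qed.

Let tail_bound (c r e : R) : 0 <= c -> 0 < e -> \forall t \near +oo,
  (P [set w | (r <= `|Z t w|)%R] <=
    (2 * expR (- (b t * (c * r - s2 * c ^+ 2 / 2 - e))))%:E)%E.
Proof.
move=> c0 e0; near=> t.
have bt0 : 0 <= b t by near: t; exact: b_near.
have [_ K1] : ((expR (b t * (s2 * c ^+ 2 / 2 - e)))%:E <= K t c)%E /\
  (K t c <= (expR (b t * (s2 * c ^+ 2 / 2 + e)))%:E)%E by near: t; exact: K_near.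
have [_ K2] : ((expR (b t * (s2 * (- c) ^+ 2 / 2 - e)))%:E <= K t (- c))%E /\
  (K t (- c) <= (expR (b t * (s2 * (- c) ^+ 2 / 2 + e)))%:E)%E
  by near: t; exact: K_near.
have m1 : measurable [set w | r <= Z t w].
  rewrite (_ : mkset _ = Z t @^-1` `[r, +oo[); last first.
    by apply/seteqP; split=> w /=; rewrite in_itv/= andbT.
  exact: measurable_preimageZ.
have m2 : measurable [set w | Z t w <= - r].
  rewrite (_ : mkset _ = Z t @^-1` `]-oo, - r]); last first.
    by apply/seteqP; split=> w /=; rewrite in_itv/=.
  exact: measurable_preimageZ.
have m3 : measurable [set w | r <= `|Z t w|].
  rewrite (_ : mkset _ = (normr \o Z t) @^-1` `[r, +oo[); last first.
    by apply/seteqP; split=> w /=; rewrite in_itv/= andbT.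
  by rewrite -[X in measurable X]setTI; apply: measurableT_comp.
apply: (@le_trans _ _ (P ([set w | r <= Z t w]%R `|` [set w | Z t w <= - r]%R))).
  apply: le_measure; rewrite ?inE//; first exact: measurableU.
  move=> w /=; rewrite ler_normr => /orP[|]; first by left.
  by rewrite lerNr; right.
apply: (le_trans (measureU2 _ m1 m2)).
rewrite mulr_natl mulr2n EFinD; apply: leeD.
  apply: (le_trans (@chernoff c t (c * b t * r) _ m1 _)) => [w /= rw|].
    by apply: ler_wpM2l => //; exact: mulr_ge0.
  apply: (le_trans (lee_pmul _ _ (lexx _) K1)); rewrite ?lee_fin ?expR_ge0//.
    by apply: integral_ge0 => w _; rewrite lee_fin expR_ge0.
  by rewrite -expRD ler_expR; lra.
apply: (le_trans (@chernoff (- c) t (c * b t * r) _ m2 _)) => [w /= rw|].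
  rewrite !mulNr -mulrN; apply: ler_wpM2l; first exact: mulr_ge0.
  by rewrite lerNr.
apply: (le_trans (lee_pmul _ _ (lexx _) K2)); rewrite ?lee_fin ?expR_ge0//.
  by apply: integral_ge0 => w _; rewrite lee_fin expR_ge0.
by rewrite sqrrN -expRD ler_expR; lra.
Unshelve. all: by end_near. Qed.

(* No change of measure is needed: away from [s2 * c], [expR (c * b t * Z)] is dominated
   by its analogues with slopes [c + lam] and [c - lam], whose integrals are negligible. *)
Let point_bound (c del e : R) : 0 < del -> 0 < e -> \forall t \near +oo,
  ((expR (- (b t * (s2 * c ^+ 2 / 2 + `|c| * del + e))))%:E <=
    P [set w | (`|Z t w - s2 * c| < del)%R])%E.
Proof.
move=> del0 e0.
(* Moving the slope by [lam] gains [lam * del - s2 * lam ^+ 2 / 2] in the exponent, for which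
   [del / s2] would be optimal. The added 1 covers [s2 = 0]. *)
pose lam := del / (s2 + 1).
have s21 : 0 < s2 + 1 by rewrite ltr_wpDl.
have lam0 : 0 < lam by rewrite divr_gt0.
have lamE : s2 * lam + lam = del.
  by rewrite /lam; field; rewrite gt_eqF.
(* The gain is at least [lam * del / 2], hence at least [4 * e1]: two [e1] pay for the uses of
   [K_near], and two more give the factor expR (- 2) below. *)
pose e1 := Num.min (e / 2) (lam * del / 8).
have e10 : 0 < e1 by rewrite lt_min !divr_gt0// mulr_gt0.
have e1e : e1 <= e / 2 by rewrite ge_min lexx.
have e1l : e1 <= lam * del / 8 by rewrite ge_min lexx orbT.
have gap : 4 * e1 <= lam * del - s2 * lam ^+ 2 / 2.
  have -> : s2 * lam ^+ 2 = lam * (del - lam) by rewrite -lamE; ring.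
  have : 0 <= lam * lam by rewrite mulr_ge0 ?ltW.
  nra.
near=> t.
have b1 : 1 <= b t * e1.
  rewrite -ler_pdivrMr//; near: t; exact: b_near.
have bt0 : 0 < b t by near: t; move: (b_near 1); apply: filterS => t; exact: lt_le_trans.
have [Kc _] : ((expR (b t * (s2 * c ^+ 2 / 2 - e1)))%:E <= K t c)%E /\
  (K t c <= (expR (b t * (s2 * c ^+ 2 / 2 + e1)))%:E)%E by near: t; exact: K_near.
have [_ K1] : ((expR (b t * (s2 * (c + lam) ^+ 2 / 2 - e1)))%:E <= K t (c + lam))%E /\
  (K t (c + lam) <= (expR (b t * (s2 * (c + lam) ^+ 2 / 2 + e1)))%:E)%E
  by near: t; exact: K_near.
have [_ K2] : ((expR (b t * (s2 * (c - lam) ^+ 2 / 2 - e1)))%:E <= K t (c - lam))%E /\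
  (K t (c - lam) <= (expR (b t * (s2 * (c - lam) ^+ 2 / 2 + e1)))%:E)%E
  by near: t; exact: K_near.
set D := [set w | _].
have mD : measurable D.
  rewrite (_ : D = Z t @^-1` `]s2 * c - del, s2 * c + del[); last first.
    by apply/seteqP; split=> w; rewrite /D /= in_itv/= ltr_distl.
  exact: measurable_preimageZ.
pose C1 := expR (b t * (s2 * c ^+ 2 + `|c| * del)).
pose C2 := expR (- (lam * b t * (s2 * c + del))).
pose C3 := expR (lam * b t * (s2 * c - del)).
(* On [D] the deviation costs at most [|c| * del] in the exponent; off [D], either Z - s2 c - del or
   its mirror image is nonnegative, and [lam * b t] times it may be added to the exponent. *)
have pw w : expR (c * b t * Z t w) <= C1 * \1_D w +
    (C2 * expR ((c + lam) * b t * Z t w) + C3 * expR ((c - lam) * b t * Z t w)).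
  rewrite indicE -!expRD; have [wD|wD] := boolP (w \in D).
    rewrite mulr1; apply: ler_wpDr; first by rewrite addr_ge0 ?expR_ge0.
    rewrite ler_expR -mulrA mulrCA; apply: ler_wpM2l; first exact: ltW.
    move: wD; rewrite inE /D /= => wD.
    have : `|c * (Z t w - s2 * c)| <= `|c| * del by rewrite normrM ler_wpM2l// ltW.
    by rewrite ler_norml => /andP[_]; lra.
  rewrite mulr0 add0r; move: wD; rewrite notin_setE /D /= => /negP; rewrite -leNgt.
  rewrite ler_normr => /orP[h|h].
    apply: ler_wpDr; first exact: expR_ge0.
    rewrite ler_expR.
    have := ler_wpM2l (ltW (mulr_gt0 lam0 bt0)) h; lra.
  apply: ler_wpDl; first exact: expR_ge0.
  rewrite ler_expR.
  have := ler_wpM2l (ltW (mulr_gt0 lam0 bt0)) h; lra.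
have KE (C c' : R) : (\int[P]_w (C * expR (c' * b t * Z t w))%:E = C%:E * K t c')%E \/ C < 0.
  have [C0|] := leP 0 C; last by right.
  left; under eq_integral do rewrite EFinM.
  by rewrite ge0_integralZl_EFin//; apply/measurable_EFinP; exact: measurable_expZ.
have {KE} : (K t c <= C1%:E * P D + (C2%:E * K t (c + lam) + C3%:E * K t (c - lam)))%E.
  case: (KE C2 (c + lam)) => [<-|]; last by rewrite ltNge expR_ge0.
  case: (KE C3 (c - lam)) => [<-|]; last by rewrite ltNge expR_ge0.
  have m2 (C c' : R) : measurable_fun setT (fun w => (C * expR (c' * b t * Z t w))%:E).
    by apply/measurable_EFinP; apply: measurable_funM => //; exact: measurable_expZ.
  have -> : (C1%:E * P D = \int[P]_w (C1 * \1_D w)%:E)%E.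
    under eq_integral do rewrite EFinM.
    rewrite ge0_integralZl_EFin ?expR_ge0//; last exact/measurable_EFinP.
    by rewrite integral_indic// setIT.
  rewrite -!ge0_integralD//=.
  - apply: ge0_le_integral => //=.
    + apply/measurable_EFinP; exact: measurable_expZ.
    + apply: emeasurable_funD; last exact: emeasurable_funD.
      by apply/measurable_EFinP; apply: measurable_funM.
    + by move=> w _; rewrite -!EFinD lee_fin.
  - by move=> w _; rewrite lee_fin mulr_ge0 ?expR_ge0.
  - by apply/measurable_EFinP; apply: measurable_funM.
  - by move=> w _; rewrite -EFinD lee_fin addr_ge0 ?mulr_ge0 ?expR_ge0.
  - exact: emeasurable_funD.
  - by move=> w _; rewrite lee_fin mulr_ge0 ?expR_ge0.
  - by move=> w _; rewrite lee_fin mulr_ge0 ?expR_ge0.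
have K0 c' : (0 <= K t c')%E by apply: integral_ge0 => w _; rewrite lee_fin expR_ge0.
move=> /(le_trans Kc) h.
have C20 : (0 <= C2%:E)%E by rewrite lee_fin expR_ge0.
have C30 : (0 <= C3%:E)%E by rewrite lee_fin expR_ge0.
have {}h := le_trans h (leeD2l _ (leeD (lee_pmul C20 (K0 _) (lexx _) K1)
   (lee_pmul C30 (K0 _) (lexx _) K2))).
have PDf : P D = (fine (P D))%:E by rewrite fineK// fin_num_measure.
move: h; rewrite PDf; set p := fine (P D).
rewrite -!EFinM -!EFinD !lee_fin -!expRD => h.
set E := expR (b t * (s2 * c ^+ 2 / 2 - e1)) in h.
have expm2 : expR (- 2) <= 4^-1 :> R.
  rewrite expRN lef_pV2 ?posrE ?expR_gt0//.
  have -> : (2 : R) = 1 + 1 by ring.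
  rewrite expRD; have := expR_ge1Dx (1 : R); nra.
(* Each tail term is at most a quarter of the lower bound [E] of [K t c], so at least half of [E]
   sits on [D]. *)
have tailE (z : R) : z <= b t * (s2 * c ^+ 2 / 2 - e1) - 2 -> expR z <= E / 4.
  move=> zE; apply: (@le_trans _ _ (E * expR (- 2))).
    by rewrite -expRD ler_expR.
  by rewrite ler_wpM2l// expR_ge0.
have hgap := ler_wpM2l (ltW bt0) gap.
have {}h : E / 2 <= C1 * p.
  have := tailE _ _; move/(_ (- (lam * b t * (s2 * c + del)) + b t * (s2 * (c + lam) ^+ 2 / 2 + e1))) => h1.
  have {}h1 := h1 ltac:(nra).
  have := tailE (lam * b t * (s2 * c - del) + b t * (s2 * (c - lam) ^+ 2 / 2 + e1)) ltac:(nra).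
  lra.
have expm1 : expR (- 1) <= 2^-1 :> R.
  rewrite expRN lef_pV2 ?posrE ?expR_gt0//; have := expR_ge1Dx (1 : R); lra.
have {}h : E * expR (- 1) <= C1 * p.
  by apply: le_trans h; rewrite ler_wpM2l// expR_ge0.
rewrite -(@ler_pM2l _ C1) ?expR_gt0//; apply: le_trans h.
rewrite -!expRD ler_expR.
have := ler_wpM2l (ltW bt0) e1e; lra.
Unshelve. all: by end_near. Qed.

Let scaled_le (t : R) (p : \bar R) (y : R) : 0 < b t ->
  (p <= (b t * y)%:E)%E -> (((b t)^-1)%:E * p <= y%:E)%E.
Proof.
move=> b0 py; rewrite -[y](mulKf (lt0r_neq0 b0)) EFinM.
by apply: lee_wpmul2l => //; rewrite lee_fin invr_ge0 ltW.
Qed.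

Let scaled_ge (t : R) (p : \bar R) (y : R) : 0 < b t ->
  ((b t * y)%:E <= p)%E -> (y%:E <= ((b t)^-1)%:E * p)%E.
Proof.
move=> b0 py; rewrite -[y](mulKf (lt0r_neq0 b0)) EFinM.
by apply: lee_wpmul2l => //; rewrite lee_fin invr_ge0 ltW.
Qed.

(** The rate is even and nondecreasing in |x|, so a positive level below its infimum keeps [A]
    outside a symmetric interval: one two-sided tail bound replaces a covering argument. *)
Lemma mdp_upper_bound (A : set R) : measurable A ->
  (limf_esup (fun t => ((b t)^-1)%:E * elog (P (Z t @^-1` A))) (pinfty_nbhs R)
    <= - ereal_inf (Jrate s2 @` closure A))%E.
Proof.
move=> mA; apply: lee_real_lt => l lI.
have lJ x : closure A x -> (l%:E < Jrate s2 x)%E.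
  by move=> Ax; apply: (lt_le_trans lI); apply: ereal_inf_lbound; exists x.
have [l0|l0] := ltP l 0.
  apply: limf_esup_le_near; near=> t.
  have b0 : 0 < b t by near: t; move: (b_near 1); apply: filterS => t; exact: lt_le_trans.
  apply: scaled_le => //; apply: (@le_trans _ _ 0%:E).
    by apply: elog_le => //; rewrite expR0; apply: probability_le1; exact: measurable_preimageZ.
  by rewrite lee_fin mulr_ge0// ?oppr_ge0 ltW.
(* For [s2 > 0], [r] solves r^2 / (2 s2) = l and [r / s2] is the optimal slope. For [s2 = 0] the
   closure of [A] misses 0 and, the quadratic cost being zero, the slope [l / r] reaches the
   level. *)
have [r [c [c0 Ar lrc]]] : exists r c : R,
    [/\ 0 <= c, A `<=` [set x | r <= `|x|] & l <= c * r - s2 * c ^+ 2 / 2].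
  move: lJ; rewrite /Jrate; case: eqVneq => [s20 lJ|s2n lJ].
    have nA : ~ closure A 0.
      by move=> /lJ; rewrite eqxx lte_fin ltNge l0.
    have [r r0 Ar] : exists2 r, 0 < r & A `<=` [set x | r <= `|x|].
      move: nA => /existsNP[B] /not_implyP[/nbhs_ballP[r /= r0 rB] /set0P/negP/negPn/eqP AB].
      exists r => // x Ax /=; rewrite leNgt; apply/negP => xr.
      have : (A `&` B) x by split=> //; apply: rB; rewrite /ball/= sub0r normrN.
      by rewrite AB.
    exists r, (l / r); split => //; first by rewrite divr_ge0// ltW.
    by rewrite s20 mul0r mul0r subr0 divfK// gt_eqF.
  have s20 : 0 < s2 by rewrite lt_neqAle eq_sym s2n.
  pose r := Num.sqrt (2 * s2 * l).
  have r2 : r ^+ 2 = 2 * s2 * l by rewrite sqr_sqrtr// !mulr_ge0// ltW.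
  exists r, (r / s2); split => //.
  - by rewrite divr_ge0// sqrtr_ge0.
  - move=> x Ax /=; rewrite -sqrtr_sqr ler_wsqrtr//.
    have := lJ x (subset_closure Ax); rewrite lte_fin ltr_pdivlMr ?mulr_gt0//; lra.
  - have -> : r / s2 * r - s2 * (r / s2) ^+ 2 / 2 = r ^+ 2 / (2 * s2) by field.
    by rewrite r2 mulrAC divff ?mul1r// mulf_neq0.
apply/lee_addgt0Pr => e e0; rewrite -EFinN -EFinD.
apply: limf_esup_le_near; near=> t.
(* Half of [e] pays for the factor 2 of the two tails, as 2 <= expR 1. *)
have b1 : 1 <= b t * (e / 2).
  by rewrite -ler_pdivrMr ?divr_gt0//; near: t; exact: b_near.
have b0 : 0 < b t by near: t; move: (b_near 1); apply: filterS => t; exact: lt_le_trans.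
apply: scaled_le => //; apply: elog_le => //.
have : (P [set w | (r <= `|Z t w|)%R] <=
    (2 * expR (- (b t * (c * r - s2 * c ^+ 2 / 2 - e / 2))))%:E)%E.
  by near: t; apply: tail_bound => //; rewrite divr_gt0.
have mr : measurable [set w | (r <= `|Z t w|)%R].
  rewrite (_ : mkset _ = (normr \o Z t) @^-1` `[r, +oo[); last first.
    by apply/seteqP; split=> w /=; rewrite in_itv/= andbT.
  by rewrite -[X in measurable X]setTI; apply: measurableT_comp.
move=> h; apply: (le_trans (le_trans _ h)).
  apply: le_measure; rewrite ?inE//; first exact: measurable_preimageZ.
  by move=> w /= /Ar.
rewrite lee_fin; apply: (@le_trans _ _ (expR 1 * expR (- (b t * (c * r - s2 * c ^+ 2 / 2 - e / 2))))).
  by apply: ler_wpM2r; [exact: expR_ge0|have := expR_ge1Dx (1 : R); lra].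
rewrite -expRD ler_expR.
have := ler_wpM2l (ltW b0) lrc; lra.
Unshelve. all: by end_near. Qed.

Lemma mdp_lower_bound (A : set R) : measurable A ->
  (- ereal_inf (Jrate s2 @` interior A) <=
    limf_einf (fun t => ((b t)^-1)%:E * elog (P (Z t @^-1` A))) (pinfty_nbhs R))%E.
Proof.
move=> mA; rewrite leeNl; apply/ereal_infP => _ [x Ax <-]; rewrite leeNl.
(* A point of finite rate is the derivative [s2 * c] of the limiting exponent at some slope [c]; for
   [s2 = 0] only the point 0 qualifies. *)
have [Jx|[c [xE JxE]]] : Jrate s2 x = +oo%E \/
    exists c, x = s2 * c /\ Jrate s2 x = (s2 * c ^+ 2 / 2)%:E.
  rewrite /Jrate; case: eqVneq => [s20|s2n].
    case: eqVneq => x0; last by left.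
    by right; exists 0; rewrite x0 mulr0 expr0n/= mulr0 mul0r.
  right; exists (x / s2); split; first by field.
  by congr EFin; field.
  by rewrite Jx /= leNye.
rewrite JxE; apply/lee_addgt0Pr => e e0; rewrite -leeBlDr// -EFinN -EFinB.
have /nbhs_ballP[r /= r0 rA] := Ax.
pose del := Num.min r (e / (2 * (`|c| + 1))).
have c1 : 0 < `|c| + 1 by rewrite ltr_wpDl.
have del0 : 0 < del by rewrite lt_min r0 divr_gt0// mulr_gt0.
have cdel : `|c| * del <= e / 2.
  have : del <= e / (2 * (`|c| + 1)) by rewrite ge_min lexx orbT.
  rewrite ler_pdivlMr ?mulr_gt0//; nra.
apply: limf_einf_ge_near; near=> t.
have b0 : 0 < b t by near: t; move: (b_near 1); apply: filterS => t; exact: lt_le_trans.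
apply: scaled_ge => //; apply: elog_ge.
  by rewrite (le_lt_trans (probability_le1 _ _)) ?ltry//; exact: measurable_preimageZ.
have h : ((expR (- (b t * (s2 * c ^+ 2 / 2 + `|c| * del + e / 2))))%:E <=
    P [set w | (`|Z t w - s2 * c| < del)%R])%E.
  by near: t; apply: point_bound => //; rewrite divr_gt0.
apply: (le_trans (le_trans _ h)).
  rewrite lee_fin ler_expR.
  have := ler_wpM2l (ltW b0) cdel; lra.
apply: le_measure; rewrite ?inE//; last 2 first.
- exact: measurable_preimageZ.
- move=> w /= wd; apply: rA; rewrite /ball/= xE distrC.
  by apply: lt_le_trans wd _; rewrite ge_min lexx.
rewrite (_ : mkset _ = Z t @^-1` `]s2 * c - del, s2 * c + del[); last first.
  by apply/seteqP; split=> w; rewrite /= in_itv/= ltr_distl.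
exact: measurable_preimageZ.
Unshelve. all: by end_near. Qed.

End moderate_deviations.

Set Implicit Arguments.
Unset Strict Implicit.
Unset Printing Implicit Defensive.

(** * Convolution with a kernel on the half-line *)

Lemma dominated_integrable_cvg d (T : measurableType d) (R : realType)
  (mu : {measure set T -> \bar R}) (D : set T) (f_ : nat -> T -> R) (f g : T -> R) :
  measurable D -> (forall n, measurable_fun D (f_ n)) -> measurable_fun D f ->
  {ae mu, forall x, D x -> f_ ^~ x @ \oo --> f x} ->
  mu.-integrable D (EFin \o g) -> (forall n x, D x -> `|f_ n x| <= g x) ->
  mu.-integrable D (EFin \o f) /\
  (\int[mu]_(x in D) (f_ n x)%:E @[n --> \oo] --> \int[mu]_(x in D) (f x)%:E)%E.
Proof.
move=> mD mf_ mf cf ig fg.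
have m1 n : measurable_fun D (EFin \o f_ n) by exact/measurable_EFinP.
have m2 : measurable_fun D (EFin \o f) by exact/measurable_EFinP.
have c1 : {ae mu, forall x, D x -> (EFin \o f_ n) x @[n --> \oo] --> (EFin \o f) x}.
  apply: filterS cf => x cfx Dx; apply: cvg_EFin; first exact: nearW.
  exact: cfx.
have b1 : {ae mu, forall x n, D x -> (`|(EFin \o f_ n) x| <= (EFin \o g) x)%E}.
  by apply: aeW => x n Dx; rewrite lee_fin fg.
by have [intf _ cvf] := dominated_convergence mD m1 m2 c1 ig b1.
Qed.

Lemma dominated_cvg_EFin d (T : measurableType d) (R : realType)
  (mu : {measure set T -> \bar R}) (D : set T) (f_ : nat -> T -> R) (f g : T -> R) :
  measurable D -> (forall n, measurable_fun D (f_ n)) -> measurable_fun D f ->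
  {ae mu, forall x, D x -> f_ ^~ x @ \oo --> f x} ->
  mu.-integrable D (EFin \o g) -> (forall n x, D x -> `|f_ n x| <= g x) ->
  (\int[mu]_(x in D) (f_ n x)%:E @[n --> \oo] --> \int[mu]_(x in D) (f x)%:E)%E.
Proof.
by move=> mD mf_ mf cf ig fg; have [] := dominated_integrable_cvg mD mf_ mf cf ig fg.
Qed.

Lemma dominated_cvg_Rintegral d (T : measurableType d) (R : realType)
  (mu : {measure set T -> \bar R}) (D : set T) (f_ : nat -> T -> R) (f g : T -> R) :
  measurable D -> (forall n, measurable_fun D (f_ n)) -> measurable_fun D f ->
  {ae mu, forall x, D x -> f_ ^~ x @ \oo --> f x} ->
  mu.-integrable D (EFin \o g) -> (forall n x, D x -> `|f_ n x| <= g x) ->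
  \int[mu]_(x in D) f_ n x @[n --> \oo] --> \int[mu]_(x in D) f x.
Proof.
move=> mD mf_ mf cf ig fg.
have [intf cvf] := dominated_integrable_cvg mD mf_ mf cf ig fg.
by apply: fine_cvg; rewrite fineK//; exact: integrable_fin_num.
Qed.

(** Reduces continuity to sequences, to which dominated convergence applies. *)
Lemma seq_continuous (R : realType) (f : R -> R) :
  (forall (p : R) (u : nat -> R), u n @[n --> \oo] --> p -> f (u n) @[n --> \oo] --> f p) ->
  continuous f.
Proof.
move=> h p; apply/continuous_withinNx; apply/cvgr_dnbhsP => u [_].
exact: h.
Qed.

Section convolution.
Context {R : realType}.
Local Notation mu := (@lebesgue_measure R).
Implicit Types (f g : R -> R) (u t : R).

(** Integrability is local, so that the immigration rate [gam 0] is covered as well. *)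
Definition kernel_on g := [/\ measurable_fun (`[0, +oo[ : set R) g,
  forall s, 0 <= s -> 0 <= g s & forall t, mu.-integrable `[0, t] (EFin \o g)].

(** A class stable under the cumulant recursion: boundedness supplies dominating functions,
    continuity the convergence of step approximations. *)
Definition cbnd f := continuous f /\ exists C : R, forall u, `|f u| <= C.

Definition conv f g u : R := \int[mu]_(s in `[0, u]) (f (u - s) * g s).

Lemma cbnd_cst (c : R) : cbnd (fun=> c).
Proof. by split; [exact: cst_continuous|exists `|c|]. Qed.

Lemma cbndD f1 f2 : cbnd f1 -> cbnd f2 -> cbnd (fun u => f1 u + f2 u).
Proof.
move=> [c1 [C1 h1]] [c2 [C2 h2]]; split.
  by move=> x; apply: cvgD; [exact: c1|exact: c2].
by exists (C1 + C2) => u; apply: (le_trans (ler_normD _ _)); exact: lerD.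
Qed.

Lemma cbndM f1 f2 : cbnd f1 -> cbnd f2 -> cbnd (fun u => f1 u * f2 u).
Proof.
move=> [c1 [C1 h1]] [c2 [C2 h2]]; split.
  by move=> x; apply: cvgM; [exact: c1|exact: c2].
by exists (C1 * C2) => u; rewrite normrM ler_pM.
Qed.

Lemma cbnd_expR1 f : cbnd f -> cbnd (fun u => expR (f u) - 1).
Proof.
move=> [c1 [C h]]; split.
  move=> x; apply: cvgB; last exact: cvg_cst.
  by apply: (continuous_comp (c1 x)); exact: continuous_expR.
exists (expR C + 1) => u; apply: (le_trans (ler_normB _ _)).
rewrite normr1 lerD2r ger0_norm ?expR_ge0// ler_expR.
exact: (le_trans (ler_norm _) (h u)).
Qed.

Lemma cbnd_measurable f : cbnd f -> measurable_fun setT f.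
Proof. by move=> [? _]; exact: continuous_measurable_fun. Qed.

Lemma kernel_measurable g (D : set R) : kernel_on g -> measurable D ->
  D `<=` `[0, +oo[ -> measurable_fun D g.
Proof. by move=> [mg _ _] mD DS; exact: measurable_funS mg. Qed.

Lemma measurable_conv_body f g u (D : set R) : cbnd f -> kernel_on g ->
  measurable D -> D `<=` `[0, +oo[ ->
  measurable_fun D (fun s => f (u - s) * g s).
Proof.
move=> cf kg mD DS; apply: measurable_funM; last exact: kernel_measurable.
apply: measurable_funTS; apply: measurableT_comp; first exact: cbnd_measurable.
exact: measurable_funB.
Qed.

Lemma itv0c_sub (t : R) : `[0, t]%classic `<=` `[0, +oo[%classic.
Proof. by move=> x /=; rewrite !in_itv/= => /andP[-> _]. Qed.

Lemma kernel_integrableZ (C : R) g t : kernel_on g ->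
  mu.-integrable `[0, t] (EFin \o (fun s => C * g s)).
Proof. by move=> [_ _ ig]; have := integrableZl _ C (ig t); exact. Qed.

Lemma conv_integrable f g u : cbnd f -> kernel_on g ->
  mu.-integrable `[0, u] (EFin \o (fun s => f (u - s) * g s)).
Proof.
move=> cf kg; have [_ [C hC]] := cf; have [_ g0 _] := kg.
apply: le_integrable (kernel_integrableZ C u kg) => //.
  by apply/measurable_EFinP; apply: measurable_conv_body => //; exact: itv0c_sub.
move=> s /=; rewrite in_itv/= => /andP[s0 _].
rewrite lee_fin normrM normrM; apply: ler_wpM2r => //.
exact: le_trans (hC _) (ler_norm _).
Qed.

Lemma conv_le0 f g u : u <= 0 -> conv f g u = 0.
Proof.
rewrite le_eqVlt => /predU1P[->|u0]; rewrite /conv.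
  by rewrite set_itv1 Rintegral_set1.
by rewrite set_itv_ge ?Rintegral_set0// bnd_simp -ltNge.
Qed.

Lemma le_conv f1 f2 g u : cbnd f1 -> cbnd f2 -> kernel_on g ->
  (forall v, f1 v <= f2 v) -> conv f1 g u <= conv f2 g u.
Proof.
move=> c1 c2 kg f12; apply: le_Rintegral => //; try exact: conv_integrable.
move=> s /=; rewrite in_itv/= => /andP[s0 _]; apply: ler_wpM2r => //.
by have [_ ->] := kg.
Qed.

Lemma convD f1 f2 g u : cbnd f1 -> cbnd f2 -> kernel_on g ->
  conv (fun v => f1 v + f2 v) g u = conv f1 g u + conv f2 g u.
Proof.
move=> c1 c2 kg; rewrite /conv -RintegralD//; try exact: conv_integrable.
by apply: eq_Rintegral => s _; rewrite mulrDl.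
Qed.

Lemma convZ (c : R) f g u : cbnd f -> kernel_on g ->
  conv (fun v => c * f v) g u = c * conv f g u.
Proof.
move=> cf kg; rewrite /conv -RintegralZl//; last exact: conv_integrable.
by apply: eq_Rintegral => s _; rewrite mulrA.
Qed.

Lemma conv_cst (c : R) g u : kernel_on g ->
  conv (fun=> c) g u = c * \int[mu]_(s in `[0, u]) g s.
Proof. by move=> [_ _ ig]; rewrite /conv RintegralZl. Qed.

Lemma Rintegral_kernel_ge0 g u : kernel_on g -> 0 <= \int[mu]_(s in `[0, u]) g s.
Proof.
move=> [_ g0 _]; apply: Rintegral_ge0 => s /=; rewrite in_itv/= => /andP[s0 _].
exact: g0.
Qed.

(** The moving endpoint becomes an indicator, so that integrals for different [u] share one
    domain. *)
Lemma conv_mkcond f g u b : u <= b ->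
  conv f g u = \int[mu]_(s in `[0, b]) (f (u - s) * g s * (s <= u)%R%:R).
Proof.
move=> ub; rewrite /conv.
have -> : `[0, u]%classic = `[0, b]%classic `&` [set s | s <= u].
  apply/seteqP; split=> s /=; rewrite !in_itv/=.
    by move=> /andP[-> su]; rewrite (le_trans su ub).
  by move=> [/andP[-> _] ->].
rewrite Rintegral_mkcondr; apply: eq_Rintegral => s _.
rewrite /patch; case: ifPn; rewrite ?inE ?notin_setE /=.
  by move=> ->; rewrite mulr1.
by move=> /negP/negbTE ->; rewrite mulr0.
Qed.

Lemma measurable_le_indic (c : R) (D : set R) : measurable D ->
  measurable_fun D (fun s : R => (s <= c)%R%:R : R).
Proof.
move=> mD; rewrite (_ : (fun s => _) = \1_(`]-oo, c]%classic : set R)); last first.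
  apply/funext => s; rewrite indicE; congr (_%:R).
  by rewrite mem_setE in_itv.
exact: measurable_indic.
Qed.

Lemma normr_conv_body_le f g (C u s : R) (b : bool) : kernel_on g ->
  (forall v, `|f v| <= C) -> 0 <= s ->
  `|f (u - s) * g s * b%:R| <= C * g s.
Proof.
move=> [_ g0 _] hC s0; rewrite !normrM normr_nat.
apply: (@le_trans _ _ (`|f (u - s)| * `|g s|)).
  by rewrite ler_piMr// ?mulr_ge0// ?normr_ge0// lern1 leq_b1.
by rewrite (ger0_norm (g0 _ s0)); apply: ler_wpM2r => //; exact: g0.
Qed.

Lemma continuous_conv f g : cbnd f -> kernel_on g -> continuous (conv f g).
Proof.
move=> cf kg; apply: seq_continuous => p u up.
have [contf [C hC]] := cf; have [_ g0 ig] := kg.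
pose b := p + 1.
have ub : \forall n \near \oo, u n <= b.
  by have /cvgr_le := up; apply; rewrite ltrDl.
(* Capping changes finitely many terms and puts all the integrals on [0, b]. *)
pose v n := Num.min (u n) b.
have vp : v n @[n --> \oo] --> p.
  apply: cvg_trans up; apply: near_eq_cvg.
  by apply: filterS ub => n; rewrite /v => /min_idPl.
suff : conv f g (v n) @[n --> \oo] --> conv f g p.
  apply: cvg_trans; apply: near_eq_cvg.
  by apply: filterS ub => n; rewrite /v => /min_idPl ->.
have vb n : v n <= b by rewrite ge_min lexx orbT.
have pb : p <= b by rewrite lerDl.
rewrite (_ : (fun n => _) = fun n =>
    \int[mu]_(s in `[0, b]) (f (v n - s) * g s * (s <= v n)%R%:R)); last first.
  by apply/funext => n; exact: conv_mkcond.
rewrite (conv_mkcond _ _ pb).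
have mb (c : R) : measurable_fun (`[0, b] : set R) (fun s => f (c - s) * g s).
  by apply: measurable_conv_body => //; exact: itv0c_sub.
apply: (@dominated_cvg_Rintegral _ _ _ mu _ _ _ (fun s => C * g s)) => //.
- by move=> n; apply: measurable_funM; [exact: mb|exact: measurable_le_indic].
- by apply: measurable_funM; [exact: mb|exact: measurable_le_indic].
(* The indicator of s <= v n can fail to converge only at s = p. *)
- exists [set p]; split => //; first exact: lebesgue_measure_set1.
  move=> s /=; apply: contra_notP => sp _.
  apply: cvgM; first apply: cvgM; last 2 first.
  + exact: cvg_cst.
  + apply: cvg_near_cst.
    have [sltp|plts] := ltP s p.
      have : \forall n \near \oo, s < v n by have /cvgr_gt := vp; apply.
      by apply: filterS => n sv; rewrite (ltW sv) (ltW sltp).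
    have {}plts : p < s by rewrite lt_neqAle plts andbT eq_sym; exact/eqP.
    have : \forall n \near \oo, v n < s by have /cvgr_lt := vp; apply.
    by apply: filterS => n sv; rewrite !leNgt sv plts.
  + have : v n - s @[n --> \oo] --> p - s by apply: cvgB => //; exact: cvg_cst.
    by apply: continuous_cvg; exact: contf.
- exact: kernel_integrableZ.
- by move=> n s /=; rewrite in_itv/= => /andP[s0 _]; exact: normr_conv_body_le.
Qed.

Lemma conv_mkcondy f g u :
  conv f g u = \int[mu]_(s in `[0, +oo[) (f (u - s) * g s * (s <= u)%R%:R).
Proof.
rewrite /conv.
have -> : `[0, u]%classic = `[0, +oo[%classic `&` [set s | s <= u].
  apply/seteqP; split=> s /=; rewrite !in_itv/= ?andbT.
    by move=> /andP[-> ->].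
  by move=> [-> ->].
rewrite Rintegral_mkcondr; apply: eq_Rintegral => s _.
rewrite /patch; case: ifPn; rewrite ?inE ?notin_setE /=.
  by move=> ->; rewrite mulr1.
by move=> /negP/negbTE ->; rewrite mulr0.
Qed.

(** Dominated convergence: for each fixed s the age u - s tends to infinity. *)
Lemma conv_cvg_pinfty f g (l : R) : cbnd f -> kernel_on g ->
  mu.-integrable `[0, +oo[ (EFin \o g) ->
  f u @[u --> +oo] --> l ->
  conv f g u @[u --> +oo] --> l * \int[mu]_(s in `[0, +oo[) g s.
Proof.
move=> cf kg ig fl; apply/cvg_pinftyP => u uoo.
have [contf [C hC]] := cf; have [mg g0 _] := kg.
rewrite -RintegralZl//.
rewrite (_ : (fun n => _) = fun n =>
    \int[mu]_(s in `[0, +oo[) (f (u n - s) * g s * (s <= u n)%R%:R)); last first.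
  by apply/funext => n; exact: conv_mkcondy.
apply: (@dominated_cvg_Rintegral _ _ _ mu _ _ _ (fun s => C * g s)) => //.
- move=> n; apply: measurable_funM; first exact: measurable_conv_body.
  exact: measurable_le_indic.
- by apply: measurable_funM.
- apply: aeW => s _.
  have h1 : \forall n \near \oo, s <= u n by have /cvgryPge := uoo; apply.
  have h2 : f (u n - s) * g s @[n --> \oo] --> l * g s.
    apply: cvgM; last exact: cvg_cst.
    have : u n - s @[n --> \oo] --> +oo.
      apply/cvgryPge => A; have /cvgryPge/(_ (A + s)) := uoo.
      by apply: filterS => n; rewrite lerBrDr.
    by move/cvg_comp; apply.
  apply: cvg_trans h2; apply: near_eq_cvg; apply: filterS h1 => n ->.
  by rewrite mulr1.
- by have := integrableZl _ C ig; exact.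
- by move=> n s /=; rewrite in_itv/= andbT => s0; exact: normr_conv_body_le.
Qed.

Lemma Rintegral_kernel_le g u : kernel_on g ->
  mu.-integrable `[0, +oo[ (EFin \o g) ->
  \int[mu]_(s in `[0, u]) g s <= \int[mu]_(s in `[0, +oo[) g s.
Proof.
move=> kg ig; have [mg g0 ilg] := kg.
rewrite /Rintegral; apply: fine_le; try exact: integrable_fin_num.
apply: ge0_subset_integral => //.
- exact/measurable_EFinP.
- by move=> s /=; rewrite in_itv/= andbT lee_fin; exact: g0.
- exact: itv0c_sub.
Qed.

(** Since [0 <= c], the mass over [0, u] may be enlarged to the total mass. This is the source of
    all uniformity in the age. *)
Lemma conv_le_mass f g (c u : R) : cbnd f -> kernel_on g ->
  mu.-integrable `[0, +oo[ (EFin \o g) -> 0 <= c -> (forall v, f v <= c) ->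
  conv f g u <= c * \int[mu]_(s in `[0, +oo[) g s.
Proof.
move=> cf kg ig c0 fc.
apply: (le_trans (le_conv u cf (cbnd_cst c) kg fc)).
by rewrite conv_cst// ler_wpM2l//; exact: Rintegral_kernel_le.
Qed.

Lemma conv_ge_mass f g (c u : R) : cbnd f -> kernel_on g ->
  mu.-integrable `[0, +oo[ (EFin \o g) -> c <= 0 -> (forall v, c <= f v) ->
  c * \int[mu]_(s in `[0, +oo[) g s <= conv f g u.
Proof.
move=> cf kg ig c0 fc.
apply: (le_trans _ (le_conv u (cbnd_cst c) cf kg fc)).
by rewrite conv_cst// ler_wnM2l//; exact: Rintegral_kernel_le.
Qed.

Lemma cbnd_conv f g : cbnd f -> kernel_on g ->
  mu.-integrable `[0, +oo[ (EFin \o g) -> cbnd (conv f g).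
Proof.
move=> cf kg ig; split; first exact: continuous_conv.
have [_ [C hC]] := cf.
exists (`|C| * \int[mu]_(s in `[0, +oo[) g s) => u.
have C1 v : f v <= `|C|.
  exact: (le_trans (ler_norm _) (le_trans (hC v) (ler_norm _))).
have C2 v : - `|C| <= f v.
  have := le_trans (hC v) (ler_norm C).
  by rewrite ler_norml => /andP[].
rewrite ler_norml conv_le_mass// andbT -mulNr.
by apply: conv_ge_mass => //; rewrite oppr_le0.
Qed.

(** For s up to [t - U] the age t - s is at least [U]; the other s contribute nonnegatively. *)
Lemma conv_ge_tail f g (l U t : R) : cbnd f -> kernel_on g -> 0 <= l -> 0 <= U ->
  (forall v, 0 <= f v) -> (forall v, U <= v -> l <= f v) ->
  l * \int[mu]_(s in `[0, t - U]) g s <= conv f g t.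
Proof.
move=> cf kg l0 U0 f0 fl; have [_ g0 _] := kg.
rewrite -conv_cst// (@conv_mkcond _ _ (t - U) t); last by rewrite gerBl.
have ih : mu.-integrable `[0, t]
    (EFin \o (fun s => l * g s * (s <= t - U)%R%:R)).
  apply: le_integrable (kernel_integrableZ l t kg) => //.
    apply/measurable_EFinP; apply: measurable_funM.
      by apply: measurable_funM => //; apply: kernel_measurable => //; exact: itv0c_sub.
    exact: measurable_le_indic.
  move=> s /=; rewrite in_itv/= => /andP[s0 _].
  rewrite lee_fin [leLHS]normrM normr_nat ler_piMr// ?normr_ge0//.
  by rewrite lern1 leq_b1.
apply: le_Rintegral => //; first exact: conv_integrable.
move=> s /=; rewrite in_itv/= => /andP[s0 st].
have [h|h] := leP s (t - U); last by rewrite mulr0 mulr_ge0// g0.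
by rewrite mulr1; apply: ler_wpM2r; [exact: g0|apply: fl; lra].
Qed.

(** The translated measure gives half-open intervals their length, so uniqueness of Lebesgue measure
    applies. *)
Lemma lebesgue_measure_translate (r : R) (A : set R) : measurable A ->
  pushforward mu ((fun x => x - r) : _ -> measurableTypeR R) A = mu A.
Proof.
have mshift : measurable_fun setT ((fun x => x - r) : R -> measurableTypeR R).
  exact: measurable_funB.
move=> mA; apply/esym/lebesgue_measure_unique => //= _ [[a b]] _ <-.
rewrite /pushforward.
have -> : (fun x : R => x - r) @^-1` `]a, b] = `](a + r), (b + r)]%classic.
  by apply/seteqP; split=> x /=; rewrite !in_itv/= ltrBrDr lerBlDr.
by rewrite !lebesgue_measure_itv/= !lte_fin ltrD2r -!EFinD opprD addrACA subrr addr0.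
Qed.

Lemma ge0_integral_translate (r : R) (h : R -> \bar R) :
  measurable_fun setT h -> (forall s, (0 <= h s)%E) ->
  (\int[mu]_s h (s - r)%R = \int[mu]_s h s)%E.
Proof.
move=> mh h0.
have mshift : measurable_fun setT ((fun x : R => x - r) : measurableTypeR R -> measurableTypeR R).
  exact: measurable_funB.
have := @ge0_integral_pushforward _ _ _ _ R _ mshift mu setT h measurableT mh (fun s _ => h0 s).
rewrite preimage_setT => <-.
by apply: eq_measure_integral => //= A mA _; exact: lebesgue_measure_translate.
Qed.

Lemma Rintegral_translate (r : R) (h : R -> R) :
  mu.-integrable setT (EFin \o h) ->
  \int[mu]_s h (s - r) = \int[mu]_s h s.
Proof.
move=> ih.
have mh : measurable_fun setT (EFin \o h) by exact: measurable_int ih.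
have mshift : measurable_fun setT ((fun x : R => x - r) : measurableTypeR R -> measurableTypeR R).
  exact: measurable_funB.
have ish : mu.-integrable (((fun x : R => x - r) : measurableTypeR R -> measurableTypeR R) @^-1` setT)
    ((EFin \o h) \o ((fun x : R => x - r) : measurableTypeR R -> measurableTypeR R)).
  rewrite preimage_setT; apply/integrableP; split.
    exact: measurableT_comp.
  rewrite (@ge0_integral_translate r (fun s => `|(h s)%:E|)%E)//.
    by case/integrableP : ih.
  exact: measurableT_comp.
have := @integral_pushforward _ _ _ _ R _ mshift mu setT _ mh ish measurableT.
rewrite preimage_setT /Rintegral => H; congr fine.
apply: (etrans (esym H)).
by apply: eq_measure_integral => //= A mA _; exact: lebesgue_measure_translate.
Qed.

(* The support excludes 0 to encode the strict inequality [tau < t] in [hintensity]. *)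
Definition posker g : R -> R := g \_ `]0, +oo[.

Lemma measurable_posker g : kernel_on g -> measurable_fun setT (posker g).
Proof.
move=> kg; apply/(measurable_restrictT _ _).1 => //.
by apply: kernel_measurable => // x /=; rewrite !in_itv/= !andbT => /ltW.
Qed.

Lemma poskerE g (s : R) : posker g s = if 0 < s then g s else 0.
Proof.
rewrite /posker /patch; case: ifPn; rewrite ?inE ?notin_setE /= in_itv/= andbT.
  by move=> ->.
by move=> /negP/negbTE ->.
Qed.

Lemma posker_ge0 g (s : R) : kernel_on g -> 0 <= posker g s.
Proof. by move=> [_ g0 _]; rewrite poskerE; case: ifPn => // /ltW; exact: g0. Qed.

(** Contribution of one parent born at [tau] to an integral against the intensity: after a shift it
    depends on the age [t - tau] only. *)
Lemma conv_translate f g (t tau : R) : cbnd f -> kernel_on g -> 0 < tau ->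
  \int[mu]_(s in `]0, t]) (f (t - s) * posker g (s - tau)) = conv f g (t - tau).
Proof.
move=> cf kg tau0; have [mg g0 ig] := kg.
pose h (v : R) := (fun v => f (t - tau - v) * g v) \_ `]0, t - tau] v.
have ocsub : `]0, t - tau]%classic `<=` (`[0, t - tau] : set R).
  by move=> s /=; rewrite !in_itv/= => /andP[/ltW -> ->].
have ih0 : mu.-integrable `]0, t - tau] (EFin \o (fun v => f (t - tau - v) * g v)).
  by apply: integrableS (conv_integrable (t - tau) cf kg) => //.
have ih : mu.-integrable setT (EFin \o h).
  have /integrable_mkcond := ih0; move=> /(_ (measurable_itv _)).
  by congr (mu.-integrable _ _); rewrite restrict_EFin.
rewrite /conv -(@Rintegral_itv_obnd_cbnd _ 0 (BRight (t - tau)))//.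
rewrite [RHS]Rintegral_mkcond [LHS]Rintegral_mkcond.
apply: etrans (@Rintegral_translate tau h ih).
apply: eq_Rintegral => s _.
rewrite /h /patch !mem_setE !in_itv/= poskerE subr_gt0 lerD2r.
have [ts|st] := ltP tau s; last by rewrite mulr0 if_same.
rewrite (lt_trans tau0 ts)/=; case: ifPn => // _.
by congr (f _ * _); ring.
Qed.

(** The step of [iconv]. Values stay extended because a convolution of integrable kernels can be
    infinite at individual points. *)
Definition econv g (k : R -> \bar R) (s : R) : \bar R :=
  (\int[mu]_(r in `[0%R, s]) ((g (s - r))%:E * k r))%E.

(** Extension by zero lets Tonelli be applied on the whole plane. *)
Let gz g : R -> R := g \_ `[0, +oo[.
Let kz (k : R -> \bar R) : R -> \bar R := k \_ `[0%R, +oo[.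

Let gz_ge0 g (s : R) : kernel_on g -> 0 <= gz g s.
Proof.
move=> [_ g0 _]; rewrite /gz /patch; case: ifPn => //.
by rewrite inE /= in_itv/= andbT; exact: g0.
Qed.

Let kz_ge0 k (s : R) : (forall s, 0 <= s -> (0 <= k s)%E) -> (0 <= kz k s)%E.
Proof.
move=> k0; rewrite /kz /patch; case: ifPn => //.
by rewrite inE /= in_itv/= andbT; exact: k0.
Qed.

Let mgz g : kernel_on g -> measurable_fun setT (gz g).
Proof. by move=> [mg _ _]; apply/(measurable_restrictT _ _).1. Qed.

Let mkz k : measurable_fun (`[0, +oo[ : set R) k -> measurable_fun setT (kz k).
Proof. by move=> mk; apply/(measurable_restrictT _ _).1. Qed.

Let body_measurable (f : R -> R) g k : measurable_fun setT f -> kernel_on g ->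
  measurable_fun (`[0, +oo[ : set R) k ->
  measurable_fun setT (fun z : R * R => ((f z.1 * gz g (z.1 - z.2))%:E * kz k z.2)%E).
Proof.
move=> mf kg mk; apply: emeasurable_funM.
  apply/measurable_EFinP; apply: measurable_funM.
    by apply: measurableT_comp => //; exact: measurable_fst.
  apply: measurableT_comp; first exact: mgz.
  exact: measurable_funB.
by apply: measurableT_comp => //; exact: mkz.
Qed.

Let econvE g k s : kernel_on g -> 0 <= s ->
  econv g k s = (\int[mu]_r ((gz g (s - r))%:E * kz k r))%E.
Proof.
move=> kg s0; rewrite /econv integral_mkcond; apply: eq_integral => r _.
rewrite /patch /gz /kz /patch !mem_setE !in_itv/= !andbT subr_ge0.
have [r0|r0] := leP 0 r; last by rewrite mule0.
by have [rs|rs] := leP r s; rewrite //= mul0e.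
Qed.

Lemma measurable_econv g k : kernel_on g ->
  measurable_fun (`[0, +oo[ : set R) k -> (forall s, 0 <= s -> (0 <= k s)%E) ->
  measurable_fun (`[0, +oo[ : set R) (econv g k).
Proof.
move=> kg mk k0.
have m1 : measurable_fun (setT : set R) (cst 1 : R -> R) by exact: measurable_cst.
have h : measurable_fun setT (fun s : R =>
    (\int[mu]_r ((cst 1 s * gz g (s - r))%:E * kz k r))%E).
  apply: (@measurable_fun_fubini_tonelli_F _ _ _ _ R mu
    (fun z : R * R => ((cst 1 z.1 * gz g (z.1 - z.2))%:E * kz k z.2)%E)
    (body_measurable m1 kg mk)) => z.
  by rewrite mule_ge0 ?kz_ge0// lee_fin mul1r gz_ge0.
apply: (eq_measurable_fun (fun s : R => (\int[mu]_r ((cst 1 s * gz g (s - r))%:E * kz k r))%E)).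
  move=> s; rewrite inE /= in_itv/= andbT => s0; rewrite econvE//.
  by apply: eq_integral => r _; rewrite /= mul1r.
exact: measurable_funTS.
Qed.

Lemma econv_ge0 g k s : kernel_on g -> (forall s, 0 <= s -> (0 <= k s)%E) ->
  (0 <= econv g k s)%E.
Proof.
move=> [_ g0 _] k0; apply: integral_ge0 => r /=; rewrite in_itv/= => /andP[r0 rs].
by rewrite mule_ge0 ?k0// lee_fin g0// subr_ge0.
Qed.

(** Associativity of convolution, by Tonelli. It moves one kernel from the remaining generations
    onto [iconv]. *)
Lemma conv_econv f g k u : cbnd f -> (forall v, 0 <= f v) -> kernel_on g ->
  measurable_fun (`[0, +oo[ : set R) k -> (forall s, 0 <= s -> (0 <= k s)%E) ->
  (\int[mu]_(s in `[0%R, u]) ((conv f g (u - s))%:E * k s) =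
   \int[mu]_(s in `[0%R, u]) ((f (u - s))%:E * econv g k s))%E.
Proof.
move=> cf f0 kg mk k0.
(* The cutoff s <= u is attached to [f], so that both iterated integrals run over the whole line. *)
pose F (s : R) : R := f (u - s) * (s <= u)%R%:R.
have mF : measurable_fun setT F.
  apply: measurable_funM; last exact: measurable_le_indic.
  apply: measurableT_comp; first exact: cbnd_measurable.
  exact: measurable_funB.
have F0 s : 0 <= F s by rewrite mulr_ge0.
have convE r : (conv f g (u - r))%:E = (\int[mu]_s (F s * gz g (s - r))%:E)%E.
  rewrite (_ : (fun s => _) = fun s => (F (s - r + r) * gz g (s - r))%:E); last first.
    by apply/funext => s; rewrite subrK.
  rewrite (@ge0_integral_translate r (fun v => (F (v + r) * gz g v)%:E)); last 2 first.
  - apply/measurable_EFinP; apply: measurable_funM; last exact: mgz.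
    apply: measurableT_comp => //; exact: measurable_funD.
  - by move=> s; rewrite lee_fin mulr_ge0// gz_ge0.
  rewrite /conv /Rintegral fineK; last by apply: integrable_fin_num => //; exact: conv_integrable.
  rewrite integral_mkcond; apply: eq_integral => v _.
  rewrite /patch /F /gz /patch !mem_setE !in_itv/= andbT.
  have [v0|v0] := leP 0 v; last by rewrite mulr0.
  rewrite -lerBrDr; have [vu|vu] := leP v (u - r); last by rewrite mulr0 mul0r.
  by rewrite mulr1 /=; congr (f _ * _)%:E; ring.
transitivity (\int[mu]_r \int[mu]_s ((F s * gz g (s - r))%:E * kz k r))%E.
  rewrite [LHS]integral_mkcond; apply: eq_integral => r _.
  have mFg : measurable_fun (setT : set R) (fun s => (F s * gz g (s - r))%:E).
    apply/measurable_EFinP; apply: measurable_funM => //.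
    by apply: measurableT_comp; [exact: mgz|exact: measurable_funB].
  have Fg0 s : setT s -> (0 <= (F s * gz g (s - r))%:E)%E.
    by move=> _; rewrite lee_fin mulr_ge0// gz_ge0.
  rewrite (@ge0_integralZr _ _ _ mu setT measurableT _ mFg _ Fg0 (kz_ge0 r k0)).
  rewrite -convE /patch /kz /patch !mem_setE !in_itv/= andbT.
  have [r0|r0] := leP 0 r; last by rewrite mule0.
  have [//|ru/=] := leP r u.
  by rewrite conv_le0 ?mul0e// subr_le0 ltW.
rewrite -(@fubini_tonelli _ _ _ _ R mu mu
  (fun z : R * R => ((F z.1 * gz g (z.1 - z.2))%:E * kz k z.2)%E)); last 2 first.
- exact: body_measurable.
- by move=> z /=; rewrite mule_ge0 ?kz_ge0// lee_fin mulr_ge0// gz_ge0.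
rewrite [RHS]integral_mkcond; apply: eq_integral => s _ /=.
rewrite /patch mem_setE in_itv/=.
have [s0|s0] := leP 0 s => /=; last first.
  apply: integral0_eq => r _; rewrite /gz /kz /patch !mem_setE !in_itv/= !andbT subr_ge0.
  have [r0|r0] := leP 0 r; last by rewrite mule0.
  by rewrite leNgt (lt_le_trans s0 r0)/= mulr0 mul0e.
under eq_integral do rewrite EFinM -muleA.
rewrite ge0_integralZl_EFin//; last 2 first.
- by move=> r _; rewrite mule_ge0 ?kz_ge0// lee_fin gz_ge0.
- apply: emeasurable_funM; last exact: mkz.
  by apply/measurable_EFinP; apply: measurableT_comp; [exact: mgz|exact: measurable_funB].
rewrite -econvE// /F; have [su|su] := leP s u; first by rewrite mulr1.
by rewrite mulr0 mul0e.
Qed.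

End convolution.

(** * Taylor bounds and weighted sums *)

(** Telescoping, from 1 / k! <= 1 / (k (k - 1)) = 1 / (k - 1) - 1 / k. *)
Lemma sum_inv_fact_le (R : realType) (n : nat) :
  \sum_(3 <= k < n.+3) (k`!%:R^-1 : R) <= 1 - n.+2%:R^-1.
Proof.
elim: n => [|n ih]; first by rewrite big_geq// subr_ge0 invf_le1// ler1n.
rewrite big_nat_recr//=; apply: (le_trans (lerD ih (lexx _))).
have h : (n.+3`!%:R)^-1 <= (n.+3%:R * n.+2%:R)^-1 :> R.
  rewrite lef_pV2 ?posrE ?ltr0n ?fact_gt0// ?mulr_gt0//.
  by rewrite -natrM ler_nat factS leq_pmul2l// factS leq_pmulr// fact_gt0.
apply: (le_trans (lerD (lexx _) h)).
have -> : (n.+3%:R * n.+2%:R)^-1 = n.+2%:R^-1 - n.+3%:R^-1 :> R.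
  have e : n.+3%:R = n.+2%:R + 1 :> R by rewrite -[in LHS]addn1 natrD.
  have p : n.+2%:R != 0 :> R by rewrite pnatr_eq0.
  have p' : n.+3%:R != 0 :> R by rewrite pnatr_eq0.
  have H (y : R) : y != 0 -> y + 1 != 0 -> ((y + 1) * y)^-1 = y^-1 - (y + 1)^-1.
    by move=> y0 y1; field; rewrite y0 y1.
  by rewrite e; apply: H => //; rewrite -e.
by rewrite addrA subrK.
Qed.

Lemma sum3_exp_coeff (R : realType) (x : R) :
  \sum_(0 <= i < 3) exp_coeff x i = 1 + x + x ^+ 2 / 2.
Proof.
rewrite !big_nat_recr//= big_geq// add0r /exp_coeff /= expr0 expr1.
by rewrite (_ : (1`! = 1)%N)// (_ : (0`! = 1)%N)// (_ : (2`! = 2)%N)// !divr1.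
Qed.

Lemma expR_taylor2 (R : realType) (x : R) : `|x| <= 1 ->
  `|expR x - (1 + x + x ^+ 2 / 2)| <= `|x| ^+ 3.
Proof.
move=> x1.
have cvgs : `|series (exp_coeff x) n - (1 + x + x ^+ 2 / 2)| @[n --> \oo] -->
    `|expR x - (1 + x + x ^+ 2 / 2)|.
  apply: cvg_norm; apply: cvgB; last exact: cvg_cst.
  exact: is_cvg_series_exp_coeff.
rewrite -(cvg_lim _ cvgs)//; apply: limr_le; first by apply/cvg_ex; eexists; exact: cvgs.
near=> n.
have [m ->] : exists m, n = m.+3.
  have n3 : (3 <= n)%N by near: n; exists 3%N.
  by exists (n - 3)%N; rewrite -addn3 subnK.
rewrite /series /= (@big_cat_nat _ _ _ 3)//=.
rewrite sum3_exp_coeff addrAC subrr add0r.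
apply: (le_trans (ler_norm_sum _ _ _)).
apply: (@le_trans _ _ (`|x| ^+ 3 * \sum_(3 <= i < m.+3) (i`!%:R^-1))).
  rewrite mulr_sumr; apply: ler_sum_nat => i /andP[i3 _].
  rewrite normrM normrX [X in _ * X]ger0_norm// ler_wpM2r//.
  by rewrite -(subnK i3) addnC exprD ler_piMr// ?exprn_ge0// exprn_ile1.
apply: ler_piMr; first exact: exprn_ge0.
by apply: (le_trans (sum_inv_fact_le R m)); rewrite gerBl invr_ge0.
Unshelve. all: by end_near. Qed.

Lemma expR_ge_taylor2 (R : realType) (x : R) : 0 <= x -> 1 + x + x ^+ 2 / 2 <= expR x.
Proof.
move=> x0.
rewrite -sum3_exp_coeff.
apply: (@nondecreasing_cvgn_le _ (series (exp_coeff x)) _ _ 3).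
- by apply: nondecreasing_series => n _ _; exact: exp_coeff_ge0.
- exact: is_cvg_series_exp_coeff.
Qed.

(** Follows from the bound at [- x] and (1 + x + x^2 / 2) (1 - x + x^2 / 2) = 1 + x^4 / 4 >= 1. *)
Lemma expR_le_taylor2 (R : realType) (x : R) : x <= 0 -> expR x <= 1 + x + x ^+ 2 / 2.
Proof.
move=> x0; have y0 : 0 <= - x by rewrite oppr_ge0.
have := expR_ge_taylor2 y0; rewrite sqrrN => h.
have e1 : expR x * expR (- x) = 1 by rewrite expRxMexpNx_1.
have ex0 := expR_gt0 x.
have {}h := ler_wpM2l (ltW ex0) h; rewrite e1 in h.
have p : 0 < 1 - x + x ^+ 2 / 2 by have := sqr_ge0 x; lra.
rewrite -(ler_pM2r p); apply: (le_trans h).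
have -> : (1 + x + x ^+ 2 / 2) * (1 - x + x ^+ 2 / 2) = 1 + x ^+ 4 / 4 by field.
by rewrite lerDl divr_ge0// -[4%N]/(2 * 2)%N exprM sqr_ge0.
Qed.

Section weighted_sums.
Context {R : realType}.
Variables (g : nat -> R) (rho : R).
Hypothesis g_ge0 : forall n, 0 <= g n.+1.
Hypothesis g_le : forall n, g n.+1 <= rho.
Hypothesis rho1 : rho < 1.

(** The recursion runs along the generations, as do those of the cluster moments; [wsumE] recovers
    the sums of products in [mtot] and [sigma2]. *)
Fixpoint wsum (c : nat -> R) (n j : nat) : R :=
  match n with
  | 0%N => 0
  | n'.+1 => c j + g j.+1 * wsum c n' j.+1
  end.

Definition wlim c j : R := limn (fun n => wsum c n j).

Let rho0 : 0 <= rho. Proof. exact: le_trans (g_ge0 0) (g_le 0). Qed.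

Lemma wsumE c n j :
  wsum c n j = \sum_(0 <= p < n) c (p + j)%N * \prod_(j.+1 <= i < (p + j).+1) g i.
Proof.
elim: n j => [|n ih] j; first by rewrite big_geq.
rewrite big_nat_recl//= big_geq ?add0n// mulr1 ih mulr_sumr; congr (_ + _).
apply: eq_big_nat => p _; rewrite addSnnS mulrCA; congr (_ * _).
rewrite [RHS]big_ltn//; last by rewrite ltnS addnS ltnS leq_addl.
Qed.

Section bounded_weights.
Variables (c : nat -> R) (C : R).
Hypothesis c_ge0 : forall j, 0 <= c j.
Hypothesis c_le : forall j, c j <= C.

Let K0 : 0 < (1 - rho)^-1. Proof. by rewrite invr_gt0 subr_gt0. Qed.

Lemma wsum_ge0 n j : 0 <= wsum c n j.
Proof. by elim: n j => [|n ih] j //=; rewrite addr_ge0// mulr_ge0. Qed.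

Lemma wsum_nd j : nondecreasing_seq (fun n => wsum c n j).
Proof.
apply/nondecreasing_seqP => n; elim: n j => [|n ih] j /=.
  by rewrite mulr0 addr0.
by rewrite lerD2l ler_wpM2l.
Qed.

(** The bound is the fixed point of x = C + rho x. *)
Lemma wsum_le n j : wsum c n j <= C * (1 - rho)^-1.
Proof.
have C0 : 0 <= C by exact: le_trans (c_ge0 0) (c_le 0).
elim: n j => [|n ih] j /=; first by rewrite mulr_ge0// ltW.
apply: (@le_trans _ _ (C + rho * (C * (1 - rho)^-1))).
  by apply: lerD => //; apply: ler_pM => //; exact: wsum_ge0.
rewrite le_eqVlt; apply/orP; left; apply/eqP; field.
by rewrite subr_eq0 gt_eqF.
Qed.

Lemma wsum_cvg j : wsum c n j @[n --> \oo] --> wlim c j.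
Proof.
apply: nondecreasing_is_cvgn; first exact: wsum_nd.
by exists (C * (1 - rho)^-1) => _ [n _ <-]; exact: wsum_le.
Qed.

Lemma wsum_le_wlim n j : wsum c n j <= wlim c j.
Proof.
apply: (nondecreasing_cvgn_le (wsum_nd j)).
by apply/cvg_ex; exists (wlim c j); exact: wsum_cvg.
Qed.

Lemma wlim_ge0 j : 0 <= wlim c j.
Proof. exact: le_trans (wsum_ge0 0 j) (wsum_le_wlim 0 j). Qed.

Lemma wlim_le j : wlim c j <= C * (1 - rho)^-1.
Proof.
apply: limr_le; first by apply/cvg_ex; exists (wlim c j); exact: wsum_cvg.
by apply: nearW => n; exact: wsum_le.
Qed.

Lemma wlimE j : wlim c j = c j + g j.+1 * wlim c j.+1.
Proof.
have h1 : [sequence wsum c n.+1 j]_n @ \oo --> wlim c j.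
  by rewrite (cvg_shiftS (fun n => wsum c n j)); exact: wsum_cvg.
have h2 : wsum c n.+1 j @[n --> \oo] --> c j + g j.+1 * wlim c j.+1.
  rewrite /=; apply: cvgD; first exact: cvg_cst.
  by apply: cvgM; [exact: cvg_cst|exact: wsum_cvg].
exact: (cvg_unique _ h1 h2).
Qed.

End bounded_weights.
End weighted_sums.

(** * Laplace functional of a conditionally Poisson process *)

Lemma cnt_sum (R : realType) (S : set R) (t a b : R) :
  finite_set (S `&` `]0, t]) -> 0 <= a -> b <= t ->
  (cnt S a b)%:R = \sum_(tau <- fset_set (S `&` `]0, t])) (a < tau <= b)%R%:R :> R.
Proof.
move=> fS a0 bt; rewrite /cnt card_fset_sum1 natr_sum.
rewrite [RHS](bigID (fun tau => a < tau <= b)) /= [X in _ = _ + X]big1 ?addr0; last first.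
  by move=> i /negbTE ->.
rewrite [RHS](eq_bigr (fun=> 1)); last by move=> i ->.
rewrite [RHS]big_fset_condE /=; congr (\sum_(i <- enum_fset _) _).
have sub : (S `&` `]a, b]) `<=` (S `&` `]0, t]).
  move=> x /= [Sx]; rewrite !in_itv/= => /andP[ax xb]; split=> //.
  by rewrite (le_lt_trans a0 ax) (le_trans xb bt).
have fS' : finite_set (S `&` `]a, b]) by exact: sub_finite_set fS.
apply/fsetP => x; rewrite in_fset_set// !inE/= in_fset_set//.
apply/idP/idP.
  rewrite inE /= in_itv/= => -[Sx axb]; rewrite axb andbT inE /=; apply: sub.
  by split=> //=; rewrite in_itv.
by move=> /andP[]; rewrite !inE /= => -[Sx _] axb; split=> //; rewrite in_itv.
Qed.

Lemma measurable_cnt_eq d (T : measurableType d) (R : realType) (S : T -> set R) a b k :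
  measurable_fun setT (fun w => (cnt (S w) a b)%:R : R) ->
  measurable [set w | cnt (S w) a b = k].
Proof.
move=> mS; rewrite (_ : mkset _ = (fun w => (cnt (S w) a b)%:R : R) @^-1` [set k%:R]).
  by rewrite -[X in measurable X]setTI; exact: mS.
apply/seteqP; split=> w /=; first by move=> ->.
by move/eqP; rewrite eqr_nat => /eqP.
Qed.

Lemma integral_split_nat d (T : measurableType d) (R : realType)
  (P : {measure set T -> \bar R}) (D : set T) (X : T -> nat) (F : T -> \bar R) :
  measurable D -> (forall k, measurable [set w | X w = k]) ->
  measurable_fun D F -> (forall w, D w -> (0 <= F w)%E) ->
  (\int[P]_(w in D) F w = \sum_(k <oo) \int[P]_(w in D `&` [set w | X w = k]) F w)%E.
Proof.
move=> mD mX mF F0.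
have DE : D = \bigcup_k (D `&` [set w | X w = k]).
  apply/seteqP; split=> w; last by move=> [k _ []].
  by move=> Dw; exists (X w).
rewrite [in LHS]DE ge0_integral_bigcup//.
- by move=> k; exact: measurableI.
- by rewrite -DE.
- by move=> w; rewrite -DE; exact: F0.
- move=> i j _ _ [w [[_ /= <-] [_ /= <-]]]; exact: erefl.
Qed.

(** Laplace transform of a Poisson variable, from the exponential series of [expR w * r]; [G] is a
    factor carried along. *)
Lemma poisson_laplace_series (R : realType) (r w G : R) : 0 <= r -> 0 <= G ->
  (\sum_(k <oo) (expR (w * k%:R) * (Defs.poisson_prob r k * G))%:E =
   (expR ((expR w - 1) * r) * G)%:E)%E.
Proof.
move=> r0 G0.
have E k : expR (w * k%:R) * (Defs.poisson_prob r k * G) =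
    exp_coeff (expR w * r) k * (expR (- r) * G).
  rewrite /Defs.poisson_prob exp_coeffE expRM_natr exprMn; ring.
rewrite (_ : (fun n => _) = EFin \o (fun n => series (exp_coeff (expR w * r)) n * (expR (- r) * G))).
  apply/cvg_lim => //; apply: cvg_EFin; first exact: nearW.
  rewrite (_ : expR ((expR w - 1) * r) * G = expR (expR w * r) * (expR (- r) * G)); last first.
    by rewrite mulrA -expRD; congr (expR _ * _); ring.
  apply: cvgM; last exact: cvg_cst.
  exact: is_cvg_series_exp_coeff.
apply/funext => n /=; rewrite sumEFin /series /= mulr_suml.
by congr EFin; apply: eq_bigr => k _; exact: E.
Qed.

Lemma poisson_weight_ge0 (R : realType) (r : R) k : 0 <= r -> 0 <= Defs.poisson_prob r k.
Proof. by move=> r0; rewrite /Defs.poisson_prob mulr_ge0 ?expR_ge0// divr_ge0 ?exprn_ge0. Qed.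

Section intervals.
Context {R : realType}.

Definition disj_intervals (l : seq (R * R)) : bool :=
  all (fun i => 0 <= i.1) l &&
  pairwise (fun i j => (i.2 <= j.1) || (j.2 <= i.1)) l.

(** Admissibility concerns the intervals only, so the counts are free to be summed out. *)
Lemma intervals_okE (cs : seq (R * R * nat)) :
  intervals_ok cs = disj_intervals (map fst cs).
Proof. by rewrite /intervals_ok /disj_intervals all_map pairwise_map. Qed.

End intervals.

(** * Approximation of test functions on a grid *)

Section step_functions.
Context {R : realType}.
Variable t : R.
Hypothesis t0 : 0 < t.

Definition grid n k : R := t * k%:R / n.+1%:R.

(** Left-open cells match [cnt], so the sum of [step] over the points is a weighted sum of
    counts. *)
Definition step (f : R -> R) n (s : R) : R :=
  \sum_(0 <= k < n.+1) f (grid n k.+1) * (grid n k < s <= grid n k.+1)%R%:R.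

Lemma grid0 n : grid n 0 = 0. Proof. by rewrite /grid mulr0 mul0r. Qed.

Lemma gridN n : grid n n.+1 = t.
Proof. by rewrite /grid mulfK// pnatr_eq0. Qed.

Lemma grid_le n i j : (i <= j)%N -> grid n i <= grid n j.
Proof. by move=> ij; rewrite ler_pM2r ?invr_gt0// ler_pM2l// ler_nat. Qed.

Lemma grid_ge0 n k : 0 <= grid n k.
Proof. by rewrite /grid divr_ge0// mulr_ge0// ltW. Qed.

Lemma grid_gap n k : grid n k.+1 = grid n k + t / n.+1%:R.
Proof. by rewrite /grid -addn1 natrD mulrDr mulr1 mulrDl. Qed.

Lemma grid_locate n (s : R) m : 0 < s -> s <= grid n m ->
  exists2 k, (k < m)%N & grid n k < s <= grid n k.+1.
Proof.
move=> s0; elim: m => [|m ih sm]; first by rewrite grid0 leNgt s0.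
have [/ih[k km ks]|ms] := leP s (grid n m); first by exists k => //; exact: ltnW.
by exists m => //; rewrite ms.
Qed.

Lemma stepP f n (s : R) : 0 < s <= t ->
  exists s', step f n s = f s' /\ s <= s' <= s + t / n.+1%:R.
Proof.
move=> /andP[s0 st].
have [k kn /andP[ks sk]] : exists2 k, (k < n.+1)%N & grid n k < s <= grid n k.+1.
  by apply: grid_locate => //; rewrite gridN.
exists (grid n k.+1); split; last first.
  by rewrite sk /= grid_gap lerD2r ltW.
rewrite /step (bigD1_seq k) ?iota_uniq ?mem_index_iota//=.
rewrite ks sk mulr1 big1 ?addr0// => j jk.
case: (ltngtP j k) jk => // [jk|kj] _.
  by rewrite [s <= _]leNgt (le_lt_trans (grid_le n jk) ks)/= andbF mulr0.
by rewrite [_ < s]ltNge (le_trans sk (grid_le n kj))/= mulr0.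
Qed.

Lemma step_le f n (s C : R) : 0 < s <= t -> (forall u, `|f u| <= C) ->
  `|step f n s| <= C.
Proof. by move=> st fC; have [s' [-> _]] := stepP f n st. Qed.

Lemma step_cvg f (s : R) : continuous f -> 0 < s <= t ->
  step f n s @[n --> \oo] --> f s.
Proof.
move=> cf st.
have [u hu] : exists u : nat -> R, forall n,
    step f n s = f (u n) /\ s <= u n <= s + t / n.+1%:R.
  by have [u hu] := choice (fun n => stepP f n st); exists u.
rewrite (_ : (fun n => _) = f \o u); last by apply/funext => n /=; have [] := hu n.
have us : u n @[n --> \oo] --> s.
  apply: (@squeeze_cvgr _ _ _ _ (cst s) (fun n => s + t / n.+1%:R)).
  - by apply: nearW => n; have [_] := hu n.
  - exact: cvg_cst.
  - rewrite -[X in _ --> X]addr0 -[X in _ --> _ + X](mulr0 t).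
    apply: cvgD; first exact: cvg_cst.
    by apply: cvgM; [exact: cvg_cst|exact: cvg_harmonic].
by apply: continuous_cvg; [exact: cf|].
Qed.

Lemma measurable_step f n : measurable_fun setT (step f n).
Proof.
apply: measurable_sum => k; apply: measurable_funM => //.
rewrite (_ : (fun s => _) = \1_(`](grid n k), (grid n k.+1)]%classic : set R)); last first.
  by apply/funext => s; rewrite indicE mem_setE in_itv.
exact: measurable_indic.
Qed.

Lemma sum_step_cnt f n (S : set R) : finite_set (S `&` `]0, t]) ->
  \sum_(0 <= k < n.+1) f (grid n k.+1) * (cnt S (grid n k) (grid n k.+1))%:R =
  \sum_(tau <- fset_set (S `&` `]0, t])) step f n tau.
Proof.
move=> fS; rewrite [RHS]exchange_big /=; apply: eq_big_nat => k /= kn.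
rewrite (@cnt_sum _ S t)// ?grid_ge0//; first by rewrite mulr_sumr.
by rewrite -[leRHS](gridN n) grid_le.
Qed.

Lemma sum_step_compens f n (lam : R -> R) :
  lebesgue_measure.-integrable `]0, t] (EFin \o lam) ->
  \sum_(0 <= k < n.+1) f (grid n k.+1) * compens lam (grid n k) (grid n k.+1) =
  \int[lebesgue_measure]_(s in `]0, t]) (step f n s * lam s).
Proof.
move=> il.
have sub k : (k < n.+1)%N -> `](grid n k), (grid n k.+1)]%classic `<=` (`]0, t] : set R).
  move=> kn s /=; rewrite !in_itv/= => /andP[ks sk].
  rewrite (le_lt_trans (grid_ge0 _ _) ks) (le_trans sk)//.
  by rewrite -[leRHS](gridN n) grid_le.
have ilk k : lebesgue_measure.-integrable `]0, t]
   (EFin \o (lam \_ `](grid n k), (grid n k.+1)])).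
  rewrite -restrict_EFin; apply/integrable_restrict => //.
  by apply: integrableS il => //; exact: measurableI.
have ilfk k : lebesgue_measure.-integrable `]0, t]
   (EFin \o (fun s => f (grid n k.+1) * (lam \_ `](grid n k), (grid n k.+1)] s))).
  by have := integrableZl _ (f (grid n k.+1)) (ilk k); exact.
transitivity (\int[lebesgue_measure]_(s in `]0, t]) (\sum_(0 <= k < n.+1)
  f (grid n k.+1) * (lam \_ `](grid n k), (grid n k.+1)] s))); last first.
  apply: eq_Rintegral.
  move=> s _; rewrite /step mulr_suml; apply: eq_bigr => k _.
  rewrite -mulrA /patch mem_setE in_itv/=; congr (_ * _).
  by case: ifPn; rewrite ?mul1r ?mul0r.
rewrite /Rintegral.
under [in RHS]eq_integral do rewrite -sumEFin.
rewrite integral_sum// -sum_fine; last first.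
  by move=> k _; apply: integrable_fin_num => //; exact: ilfk.
apply: eq_big_nat => k /= kn.
rewrite -[RHS]/(Rintegral _ _ _) RintegralZl//; congr (_ * _).
by rewrite -Rintegral_mkcondr setIidr//; exact: sub.
Qed.

End step_functions.

Lemma cvg_sum_seq (R : realType) (I : eqType) (s : seq I) (F : nat -> I -> R) (l : I -> R) :
  {in s, forall i, F n i @[n --> \oo] --> l i} ->
  \sum_(i <- s) F n i @[n --> \oo] --> \sum_(i <- s) l i.
Proof.
elim: s => [_|i s ih h].
  rewrite big_nil; under eq_fun do rewrite big_nil; exact: cvg_cst.
rewrite big_cons; under eq_fun do rewrite big_cons.
apply: cvgD; first by apply: h; rewrite mem_head.
by apply: ih => j js; apply: h; rewrite in_cons js orbT.
Qed.

Section poisson_laplace.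
Context {d : measure_display} {T : measurableType d} {R : realType}.
Local Notation mu := (@lebesgue_measure R).
Variables (P : probability T R) (S : T -> set R) (lam : T -> R -> R) (B : set T).
Hypothesis mB : measurable B.
Hypothesis mS : forall a b, measurable_fun setT (fun w => (cnt (S w) a b)%:R : R).
Hypothesis mL : forall a b, 0 <= a -> measurable_fun setT (fun w => compens (lam w) a b).
Hypothesis lam0 : forall w s, 0 < s -> 0 <= lam w s.
(** One form covers generation 0, with [B] the whole space and a deterministic [lam], and the later
    generations, with [B] a past event. *)
Hypothesis poissonS : forall cs, intervals_ok cs ->
  (P (B `&` count_event S cs) =
   \int[P]_(w in B) (\prod_(c <- cs) Defs.poisson_prob (compens (lam w) c.1.1 c.1.2) c.2)%:E)%E.

Let L0 w a b : 0 <= a -> 0 <= compens (lam w) a b.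
Proof.
move=> a0; apply: fine_ge0; apply: integral_ge0 => s /=.
by rewrite in_itv/= => /andP[/(le_lt_trans a0) s0 _]; rewrite lee_fin lam0.
Qed.

Let G (cs : seq (R * R * nat)) w : R :=
  \prod_(c <- cs) Defs.poisson_prob (compens (lam w) c.1.1 c.1.2) c.2.

Let G0 cs w : all (fun i : R * R => 0 <= i.1) (map fst cs) -> 0 <= G cs w.
Proof.
rewrite /G; elim: cs => [|c cs ih]; first by rewrite big_nil.
by rewrite big_cons /= => /andP[c0 /ih h]; rewrite mulr_ge0// poisson_weight_ge0// L0.
Qed.

Let mpoisson a b k : 0 <= a ->
  measurable_fun setT (fun w => Defs.poisson_prob (compens (lam w) a b) k).
Proof.
move=> a0; apply: measurable_funM.
  by apply: measurable_funM => //; apply: measurable_funX; exact: mL.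
by apply: measurableT_comp => //; apply: measurableT_comp => //; exact: mL.
Qed.

Let mG cs : all (fun i : R * R => 0 <= i.1) (map fst cs) -> measurable_fun setT (G cs).
Proof.
elim: cs => [_|c cs ih /= /andP[c0 /ih h]].
  by rewrite (_ : G [::] = cst 1)//; apply/funext => w; rewrite /G big_nil.
rewrite (_ : G _ = fun w => Defs.poisson_prob (compens (lam w) c.1.1 c.1.2) c.2 * G cs w).
  by apply: measurable_funM => //; exact: mpoisson.
by apply/funext => w; rewrite /G big_cons.
Qed.

Let mcount_event cs : measurable (count_event S cs).
Proof.
elim: cs => [|c cs ih]; first by rewrite (_ : count_event _ _ = setT)//; apply/seteqP.
rewrite (_ : count_event _ _ =
  [set w | cnt (S w) c.1.1 c.1.2 = c.2] `&` count_event S cs).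
  by apply: measurableI => //; exact: measurable_cnt_eq.
apply/seteqP; split=> w; rewrite /count_event /=.
  by move=> /andP[/eqP -> ->].
by move=> [-> ->]; rewrite eqxx.
Qed.

Let mexpcnt (ws : seq (R * R * R)) :
  measurable_fun setT (fun w => expR (\sum_(i <- ws) i.2 * (cnt (S w) i.1.1 i.1.2)%:R)).
Proof.
apply: measurableT_comp => //; apply: measurable_sum => i.
by apply: measurable_funM.
Qed.

(* Summing out the count of one interval against its Poisson weights moves that
   interval from [ws] to [cs]. *)
Lemma step_laplace_count (ws : seq (R * R * R)) (cs : seq (R * R * nat)) :
  disj_intervals (catrev (map fst ws) (map fst cs)) ->
  (\int[P]_(w in B `&` count_event S cs)
     (expR (\sum_(i <- ws) i.2 * (cnt (S w) i.1.1 i.1.2)%:R))%:E =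
   \int[P]_(w in B)
     (G cs w * expR (\sum_(i <- ws) (expR i.2 - 1) * compens (lam w) i.1.1 i.1.2))%:E)%E.
Proof.
(* [catrev] does not change when the head of [ws] is moved onto [cs], so disjointness passes as it
   is to the induction hypothesis. *)
elim: ws cs => [|i ws ih] cs /= ok.
  under eq_integral do rewrite big_nil expR0.
  rewrite integral_cst ?mul1e; last exact: measurableI.
  apply: (etrans (poissonS _)); first by rewrite intervals_okE.
  by apply: eq_integral => w _; rewrite big_nil expR0 mulr1.
have := ok; rewrite /disj_intervals => /andP[okall _].
rewrite catrevE all_cat all_rev /= in okall.
case/andP: okall => wspos /andP[i0 cspos].
rewrite (@integral_split_nat _ _ _ P _ (fun w => cnt (S w) i.1.1 i.1.2)); last 4 first.
- exact: measurableI.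
- by move=> k; exact: measurable_cnt_eq.
- by apply/measurable_EFinP; apply: measurable_funTS; exact: mexpcnt.
- by move=> w _; rewrite lee_fin expR_ge0.
pose H w := expR (\sum_(i <- ws) (expR i.2 - 1) * compens (lam w) i.1.1 i.1.2).
have mH : measurable_fun setT H.
  rewrite /H {H ih ok}; elim: ws wspos => [_|j ws ihw /= /andP[j0 /ihw h]].
    by under eq_fun do rewrite big_nil; exact: measurable_cst.
  under eq_fun do rewrite big_cons expRD.
  apply: measurable_funM => //; apply: measurableT_comp => //.
  by apply: measurable_funM => //; exact: mL.
transitivity (\sum_(k <oo) \int[P]_(w in B)
    (expR (i.2 * k%:R) * (Defs.poisson_prob (compens (lam w) i.1.1 i.1.2) k * (G cs w * H w)))%:E)%E.
  apply: eq_eseriesr => k _.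
  have -> : B `&` count_event S cs `&` [set w | cnt (S w) i.1.1 i.1.2 = k] =
      B `&` count_event S ((i.1, k) :: cs).
    apply/seteqP; split=> w; rewrite /count_event /=.
      by move=> [[Bw ->] ->]; rewrite eqxx.
    by move=> [Bw /andP[/eqP -> ->]].
  transitivity (\int[P]_(w in B `&` count_event S ((i.1, k) :: cs))
    ((expR (i.2 * k%:R))%:E *
     (expR (\sum_(j <- ws) j.2 * (cnt (S w) j.1.1 j.1.2)%:R))%:E))%E.
    apply: eq_integral => w; rewrite inE /count_event /= => -[_ /andP[/eqP <- _]].
    by rewrite big_cons expRD EFinM.
  have mBC : measurable (B `&` count_event S ((i.1, k) :: cs)) by exact: measurableI.
  rewrite ge0_integralZl_EFin ?expR_ge0//; last first.
    by apply/measurable_EFinP; apply: measurable_funTS; exact: mexpcnt.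
  rewrite ih// -ge0_integralZl_EFin ?expR_ge0//; last 2 first.
  - by move=> w _; rewrite lee_fin mulr_ge0 ?expR_ge0// G0//= i0.
  - apply/measurable_EFinP; apply: measurable_funTS; apply: measurable_funM => //.
    by apply: mG; rewrite /= i0.
  by apply: eq_integral => w _; rewrite -EFinM /G big_cons /= -!mulrA.
rewrite -integral_nneseries//; last 2 first.
- move=> k; apply/measurable_EFinP; apply: measurable_funTS.
  apply: measurable_funM => //; apply: measurable_funM; first exact: mpoisson.
  by apply: measurable_funM => //; exact: mG.
- move=> k w _; rewrite lee_fin; apply: mulr_ge0; first exact: expR_ge0.
  apply: mulr_ge0; first by apply: poisson_weight_ge0; exact: L0.
  by apply: mulr_ge0; [exact: G0|exact: expR_ge0].
apply: eq_integral => w _; rewrite poisson_laplace_series ?L0//; last first.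
  by rewrite mulr_ge0 ?expR_ge0// G0.
by rewrite big_cons expRD /H; congr EFin; ring.
Qed.

Lemma step_laplace (ws : seq (R * R * R)) : disj_intervals (map fst (rev ws)) ->
  (\int[P]_(w in B)
     (expR (\sum_(i <- ws) i.2 * (cnt (S w) i.1.1 i.1.2)%:R))%:E =
   \int[P]_(w in B)
     (expR (\sum_(i <- ws) (expR i.2 - 1) * compens (lam w) i.1.1 i.1.2))%:E)%E.
Proof.
move=> ok; have := @step_laplace_count ws [::].
rewrite /= catrevE cats0 -map_rev => /(_ ok).
rewrite (_ : count_event S [::] = setT) ?setIT; last by apply/seteqP.
by move=> ->; apply: eq_integral => w _; rewrite /G big_nil mul1r.
Qed.

Section laplace_functional.
Variable t : R.
Hypothesis t0 : 0 < t.
Hypothesis finS : forall w, finite_set (S w `&` `]0, t]).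
Hypothesis ilam : forall w, mu.-integrable `]0, t] (EFin \o lam w).
Hypothesis exp_moment : forall C : R, 0 <= C ->
  (\int[P]_(w in B) (expR (C * compens (lam w) 0 t))%:E < +oo)%E.

Let cntE w : (cnt (S w) 0 t)%:R = \sum_(tau <- fset_set (S w `&` `]0, t])) 1 :> R.
Proof. by rewrite /cnt card_fset_sum1 natr_sum. Qed.

Let in_window w tau : tau \in fset_set (S w `&` `]0, t]) -> 0 < tau <= t.
Proof. by rewrite in_fset_set// inE /= in_itv/= => -[]. Qed.

Let sum_window_le w (f : R -> R) (C : R) : (forall tau, 0 < tau <= t -> f tau <= C) ->
  \sum_(tau <- fset_set (S w `&` `]0, t])) f tau <= C * (cnt (S w) 0 t)%:R.
Proof.
move=> fC; rewrite cntE mulr_sumr big_seq [leRHS]big_seq.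
by apply: ler_sum => tau /in_window ht; rewrite mulr1 fC.
Qed.

(** The step formula for the single interval (0, t] turns this into the exponential moment of the
    compensator with constant [expR C - 1]. *)
Lemma exp_cnt_integrable (C : R) : 0 <= C ->
  P.-integrable B (fun w => (expR (C * (cnt (S w) 0 t)%:R))%:E).
Proof.
move=> C0; apply/integrableP; split.
  apply/measurable_EFinP; apply: measurable_funTS; apply: measurableT_comp => //.
  by apply: measurable_funM.
under eq_integral do rewrite gee0_abs ?lee_fin ?expR_ge0//.
have := @step_laplace [:: ((0, t), C)].
rewrite /disj_intervals /= lexx => /(_ isT).
under eq_integral do rewrite big_seq1/=.
move=> ->; under eq_integral do rewrite big_seq1/=.
by apply: exp_moment; rewrite subr_ge0 -expR0 ler_expR.
Qed.

Let exp_compens_integrable (C : R) : 0 <= C ->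
  P.-integrable B (fun w => (expR (C * compens (lam w) 0 t))%:E).
Proof.
move=> C0; apply/integrableP; split.
  apply/measurable_EFinP; apply: measurable_funTS; apply: measurableT_comp => //.
  by apply: measurable_funM => //; exact: mL.
under eq_integral do rewrite gee0_abs ?lee_fin ?expR_ge0//.
exact: exp_moment.
Qed.

Let step_eq (h : R -> R) n :
  (\int[P]_(w in B)
     (expR (\sum_(tau <- fset_set (S w `&` `]0, t])) step t h n tau))%:E =
   \int[P]_(w in B)
     (expR (\int[mu]_(s in `]0, t]) (step t (fun u => expR (h u) - 1) n s * lam w s)))%:E)%E.
Proof.
(* [step_laplace] asks for disjointness of the reversed list; starting from the reversed grid makes
   that list increasing. *)
pose ws := [seq ((grid t n k, grid t n k.+1), h (grid t n k.+1)) | k <- rev (iota 0 n.+1)].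
have wsE (F : R * R * R -> R) : \sum_(i <- ws) F i =
    \sum_(0 <= k < n.+1) F ((grid t n k, grid t n k.+1), h (grid t n k.+1)).
  by rewrite /ws big_map big_rev /= /index_iota subn0.
have okws : disj_intervals (map fst (rev ws)).
  rewrite /ws -map_rev revK -map_comp /disj_intervals; apply/andP; split.
    by apply/allP => _ /mapP[k _ ->] /=; exact: grid_ge0.
  rewrite pairwise_map; apply: (@sub_pairwise _ ltn) => [i j /= ij|].
    by rewrite (grid_le t0 n ij).
  by rewrite -sorted_pairwise; [exact: iota_ltn_sorted|exact: ltn_trans].
have := step_laplace okws.
under eq_integral do rewrite wsE /= (sum_step_cnt t0)//.
move=> ->.
by under eq_integral do rewrite wsE /= (sum_step_compens t0 (fun u => expR (h u) - 1))//.
Qed.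

Let measurable_sum_step h n : measurable_fun setT (fun w =>
  \sum_(tau <- fset_set (S w `&` `]0, t])) step t h n tau).
Proof.
under eq_fun do rewrite -sum_step_cnt//.
by apply: measurable_sum => k; apply: measurable_funM.
Qed.

Let measurable_int_step h n : measurable_fun setT (fun w =>
  \int[mu]_(s in `]0, t]) (step t h n s * lam w s)).
Proof.
under eq_fun do rewrite -sum_step_compens//.
by apply: measurable_sum => k; apply: measurable_funM => //; apply: mL; exact: grid_ge0.
Qed.

Let sum_step_cvg h w : continuous h ->
  \sum_(tau <- fset_set (S w `&` `]0, t])) step t h n tau @[n --> \oo] -->
  \sum_(tau <- fset_set (S w `&` `]0, t])) h tau.
Proof.
move=> ch; apply: cvg_sum_seq => tau ht.
exact: (step_cvg t0 ch (in_window ht)).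
Qed.

Let normr_step_body_le h (C : R) n w s : (forall u, `|h u| <= C) -> 0 < s <= t ->
  `|step t h n s * lam w s| <= C * lam w s.
Proof.
move=> hC st; rewrite normrM [X in _ * X]ger0_norm; last by apply: lam0; case/andP : st.
by apply: ler_wpM2r; [apply: lam0; case/andP : st|exact: step_le].
Qed.

Let measurable_step_body h n w : measurable_fun (`]0, t] : set R)
  (fun s => step t h n s * lam w s).
Proof.
apply: measurable_funM; first by apply: measurable_funTS; exact: measurable_step.
by apply/measurable_EFinP; exact: measurable_int (ilam w).
Qed.

Let ilamZ (C : R) w : mu.-integrable `]0, t] (EFin \o (fun s => C * lam w s)).
Proof. by have := integrableZl _ C (ilam w); exact. Qed.

Let int_step_cvg h w : cbnd h ->
  \int[mu]_(s in `]0, t]) (step t h n s * lam w s) @[n --> \oo] -->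
  \int[mu]_(s in `]0, t]) (h s * lam w s).
Proof.
move=> ch; have [conth [C hC]] := ch.
apply: (@dominated_cvg_Rintegral _ _ _ mu _ _ _ (fun s => C * lam w s)) => //.
- by move=> n; exact: measurable_step_body.
- apply: measurable_funM; first by apply: measurable_funTS; exact: cbnd_measurable.
  by apply/measurable_EFinP; exact: measurable_int (ilam w).
- apply: aeW => s /=; rewrite in_itv/= => st.
  by apply: cvgM; [exact: step_cvg|exact: cvg_cst].
- by move=> n s /=; rewrite in_itv/= => st; exact: normr_step_body_le.
Qed.

Lemma measurable_sum_window (h : R -> R) : continuous h -> measurable_fun setT (fun w =>
  \sum_(tau <- fset_set (S w `&` `]0, t])) h tau).
Proof.
move=> ch; apply: (@measurable_fun_cvg _ _ _ _ (fun n w =>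
  \sum_(tau <- fset_set (S w `&` `]0, t])) step t h n tau)) => //.
by move=> w _; exact: sum_step_cvg.
Qed.

(** Dominated convergence on both sides of the step identity, under exponentials of multiples of the
    count and of the compensator. *)
Lemma laplace_functional h : cbnd h ->
  (\int[P]_(w in B) (expR (\sum_(tau <- fset_set (S w `&` `]0, t])) h tau))%:E =
   \int[P]_(w in B) (expR (\int[mu]_(s in `]0, t]) ((expR (h s) - 1) * lam w s)))%:E)%E.
Proof.
move=> ch; have [conth [C hC]] := ch.
have C0 : 0 <= C by exact: le_trans (normr_ge0 _) (hC 0).
have ce := cbnd_expR1 ch; have [conte [C' eC]] := ce.
have C'0 : 0 <= C' by exact: le_trans (normr_ge0 _) (eC 0).
pose e u := expR (h u) - 1.
have cv1 : (\int[P]_(w in B)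
   (expR (\sum_(tau <- fset_set (S w `&` `]0, t])) step t h n tau))%:E @[n --> \oo] -->
   \int[P]_(w in B) (expR (\sum_(tau <- fset_set (S w `&` `]0, t])) h tau))%:E)%E.
  apply: (@dominated_cvg_EFin _ _ _ P B
    (fun n w => expR (\sum_(tau <- fset_set (S w `&` `]0, t])) step t h n tau))
    _ (fun w => expR (C * (cnt (S w) 0 t)%:R))) => //.
  - by move=> n; apply: measurable_funTS; apply: measurableT_comp.
  - apply: measurable_funTS.
    by apply: measurableT_comp => //; exact: measurable_sum_window.
  - apply: aeW => w _; apply: continuous_cvg; first exact: continuous_expR.
    exact: sum_step_cvg.
  - exact: exp_cnt_integrable.
  - move=> n w _; rewrite ger0_norm ?expR_ge0// ler_expR.
    apply: sum_window_le => tau ht; apply: le_trans (ler_norm _) _.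
    exact: step_le.
have cv2 : (\int[P]_(w in B)
   (expR (\int[mu]_(s in `]0, t]) (step t e n s * lam w s)))%:E @[n --> \oo] -->
   \int[P]_(w in B) (expR (\int[mu]_(s in `]0, t]) (e s * lam w s)))%:E)%E.
  apply: (@dominated_cvg_EFin _ _ _ P B
    (fun n w => expR (\int[mu]_(s in `]0, t]) (step t e n s * lam w s)))
    _ (fun w => expR (C' * compens (lam w) 0 t))) => //.
  - by move=> n; apply: measurable_funTS; apply: measurableT_comp.
  - apply: measurable_funTS; apply: measurableT_comp => //.
    apply: (@measurable_fun_cvg _ _ _ _ (fun n w =>
      \int[mu]_(s in `]0, t]) (step t e n s * lam w s))) => //.
    by move=> w _; exact: int_step_cvg.
  - apply: aeW => w _; apply: continuous_cvg; first exact: continuous_expR.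
    exact: int_step_cvg.
  - exact: exp_compens_integrable.
  - move=> n w _; rewrite ger0_norm ?expR_ge0// ler_expR.
    rewrite /compens -[fine _]/(Rintegral _ _ _) -RintegralZl//.
    apply: le_Rintegral => //.
    + apply: le_integrable (ilamZ C' w) => //.
        by apply/measurable_EFinP; exact: measurable_step_body.
      move=> s /=; rewrite in_itv/= => st; rewrite lee_fin.
      by apply: le_trans (ler_norm _); exact: normr_step_body_le.
    + move=> s /=; rewrite in_itv/= => st.
      by apply: le_trans (ler_norm _) _; exact: normr_step_body_le.
have := cvg_unique _ cv1; apply => //.
by rewrite (_ : (fun n => _) = fun n => (\int[P]_(w in B)
   (expR (\int[mu]_(s in `]0, t]) (step t e n s * lam w s)))%:E)%E)//;
  apply/funext => n; exact: step_eq.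
Qed.

End laplace_functional.
End poisson_laplace.

(** * Intensity generated by the points of one generation *)

Section hawkes_intensity.
Context {R : realType}.
Local Notation mu := (@lebesgue_measure R).
Implicit Types (S : set R) (g : R -> R).

Lemma finite_window S (t : R) : finite_set (S `&` `]-oo, t]) ->
  finite_set (S `&` `]0, t]).
Proof.
by apply: sub_finite_set => x /= [Sx]; rewrite !in_itv/= => /andP[_ ->].
Qed.

(** [posker] vanishes on nonpositive arguments, so one window (0, t] serves all s <= t and the
    intensity is a fixed finite sum of translates. *)
Lemma hintensityE g S (t s : R) : finite_set (S `&` `]0, t]) -> s <= t ->
  hintensity g S s = \sum_(tau <- fset_set (S `&` `]0, t])) posker g (s - tau).
Proof.
move=> fS st; rewrite /hintensity.
rewrite [RHS](bigID (fun tau => tau < s)) /= [X in _ = _ + X]big1 ?addr0; last first.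
  by move=> i /negbTE si; rewrite poskerE subr_gt0 si.
rewrite [RHS](eq_bigr (fun tau => g (s - tau))); last first.
  by move=> i si; rewrite poskerE subr_gt0 si.
rewrite [RHS]big_fset_condE /=; congr (\sum_(i <- enum_fset _) _).
have sub : (S `&` `]0, s[) `<=` (S `&` `]0, t]).
  move=> x /= [Sx]; rewrite !in_itv/= => /andP[-> xs]; split=> //.
  by rewrite (le_trans (ltW xs) st).
have fS' : finite_set (S `&` `]0, s[) by exact: sub_finite_set fS.
apply/fsetP => x; rewrite in_fset_set// !inE/= in_fset_set//.
apply/idP/idP.
  rewrite inE /= => -[Sx xs]; apply/andP; split.
    by rewrite inE; apply: sub.
  by move: xs; rewrite in_itv/= => /andP[].
move=> /andP[]; rewrite !inE /= in_itv/= => -[Sx /andP[x0 _]] xs; split=> //.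
by rewrite in_itv/= x0.
Qed.

Lemma hintensity_ge0 g S (s : R) : (forall b, finite_set (S `&` `]-oo, b])) ->
  kernel_on g -> 0 <= hintensity g S s.
Proof.
move=> fS kg; rewrite (@hintensityE _ _ s)//; last exact: finite_window.
by apply: sumr_ge0 => tau _; exact: posker_ge0.
Qed.

Lemma posker_translate_integrable g (t tau : R) : kernel_on g -> 0 < tau ->
  mu.-integrable `]0, t] (fun s => (posker g (s - tau))%:E).
Proof.
move=> kg tau0; apply/integrableP; split.
  apply/measurable_EFinP; apply: measurable_funTS.
  by apply: measurableT_comp; [exact: measurable_posker|exact: measurable_funB].
under eq_integral do rewrite gee0_abs ?lee_fin ?posker_ge0//.
pose h (v : R) : \bar R := ((posker g v) * (v <= t)%R%:R)%:E.
have mh : measurable_fun setT h.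
  apply/measurable_EFinP; apply: measurable_funM; first exact: measurable_posker.
  exact: measurable_le_indic.
have h0 v : (0 <= h v)%E by rewrite lee_fin mulr_ge0// posker_ge0.
apply: (@le_lt_trans _ _ (\int[mu]_s h (s - tau)%R)%E).
  rewrite integral_mkcond; apply: ge0_le_integral => //.
  - move=> s _; rewrite /patch; case: ifPn => // _.
    by rewrite lee_fin posker_ge0.
  - apply/(measurable_restrictT _ _).1 => //; apply/measurable_EFinP.
    apply: measurable_funTS.
    by apply: measurableT_comp; [exact: measurable_posker|exact: measurable_funB].
  - by apply: measurableT_comp => //; exact: measurable_funB.
  - move=> s _; rewrite /patch mem_setE in_itv/=; case: ifPn => // /andP[_ st].
    by rewrite lee_fin lerBlDr ler_wpDr ?mulr1// ltW.
rewrite ge0_integral_translate//.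
have [_ g0 ig] := kg.
have mg0t : measurable_fun (`[0, t] : set R) g.
  exact: (kernel_measurable kg (measurable_itv _) (@itv0c_sub R t)).
have ig' : (\int[mu]_(v in `[0%R, t]) (g v)%:E < +oo)%E.
  have /integrableP[_] := ig t; apply: le_lt_trans; apply: ge0_le_integral => //.
  - by move=> s /=; rewrite in_itv/= lee_fin => /andP[/g0].
  - exact/measurable_EFinP.
  - by apply: measurableT_comp => //; exact/measurable_EFinP.
  - by move=> s _; rewrite lee_fin ler_norm.
apply: le_lt_trans ig'; rewrite [leRHS]integral_mkcond; apply: ge0_le_integral => //.
- by apply/(measurable_restrictT _ _).1 => //; exact/measurable_EFinP.
- move=> v _; rewrite /h /patch mem_setE in_itv/= poskerE.
  have [v0|v0] := ltP 0 v; last first.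
    rewrite mul0r; case: ifPn => // /andP[v0' _]; rewrite lee_fin; exact: g0.
  by rewrite (ltW v0) /=; have [_|_] := leP v t; rewrite ?mulr1// mulr0.
Qed.

Lemma hintensity_integrable g S (t : R) : finite_set (S `&` `]0, t]) -> kernel_on g ->
  mu.-integrable `]0, t] (EFin \o hintensity g S).
Proof.
move=> fS kg.
pose W := fset_set (S `&` `]0, t]).
have H : mu.-integrable `]0, t] (fun s : R => \sum_(tau <- W) (posker g (s - tau))%:E)%E.
  rewrite (_ : (fun s : R => _) = (fun s : R =>
    \sum_(tau <- W | tau \in W) (posker g (s - tau))%:E)%E); last first.
    by apply/funext => s; rewrite big_seq_cond; apply: eq_bigl => tau; rewrite andbT.
  apply: integrable_sum => // tau.
  rewrite in_fset_set// inE /= in_itv/= => -[_ /andP[tau0 _]].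
  exact: posker_translate_integrable.
move: H; apply: eq_integrable => // s; rewrite inE /= in_itv/= => /andP[_ st].
by rewrite (hintensityE _ fS)// -sumEFin.
Qed.

Lemma Rintegral_sum_seq (D : set R) (I : eqType) (s : seq I) (F : I -> R -> R) :
  measurable D -> {in s, forall i, mu.-integrable D (EFin \o F i)} ->
  mu.-integrable D (EFin \o (fun x => \sum_(i <- s) F i x)) /\
  \int[mu]_(x in D) (\sum_(i <- s) F i x) = \sum_(i <- s) \int[mu]_(x in D) F i x.
Proof.
move=> mD; elim: s => [_|i s ih h].
  rewrite big_nil; under [X in _.-integrable _ (_ \o X)]eq_fun do rewrite big_nil.
  under eq_Rintegral do rewrite big_nil.
  by rewrite Rintegral_cst// mul0r; split => //; exact: integrable0.
have [|ihi ihs] := ih; first by move=> j js; apply: h; rewrite in_cons js orbT.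
have hi : mu.-integrable D (EFin \o F i) by apply: h; rewrite mem_head.
under [X in _.-integrable _ (_ \o X)]eq_fun do rewrite big_cons.
under eq_Rintegral do rewrite big_cons.
rewrite big_cons RintegralD// ihs; split => //.
by have := integrableD _ hi ihi; exact.
Qed.

(** Turns an integral against the intensity of a generation into a sum over its parents, each
    entering through its age. *)
Lemma integral_hintensity f g S (t : R) : cbnd f -> finite_set (S `&` `]0, t]) -> kernel_on g ->
  \int[mu]_(s in `]0, t]) (f (t - s) * hintensity g S s) =
  \sum_(tau <- fset_set (S `&` `]0, t])) conv f g (t - tau).
Proof.
move=> cf fS kg.
transitivity (\int[mu]_(s in `]0, t]) (\sum_(tau <- fset_set (S `&` `]0, t]))
    f (t - s) * posker g (s - tau))).
  apply: eq_Rintegral => s; rewrite inE /= in_itv/= => /andP[_ st].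
  by rewrite (hintensityE _ fS)// mulr_sumr.
have [] := @Rintegral_sum_seq `]0, t] R (fset_set (S `&` `]0, t]))
  (fun tau s => f (t - s) * posker g (s - tau)) (measurable_itv _).
  move=> tau; rewrite in_fset_set// inE /= in_itv/= => -[_ /andP[tau0 _]].
  have [_ [C hC]] := cf.
  have ip := integrableZl _ C (posker_translate_integrable t kg tau0).
  apply: le_integrable (ip _) => //.
    apply/measurable_EFinP; apply: measurable_funTS; apply: measurable_funM.
      by apply: measurableT_comp; [exact: cbnd_measurable|exact: measurable_funB].
    by apply: measurableT_comp; [exact: measurable_posker|exact: measurable_funB].
  move=> s _ /=; rewrite lee_fin !normrM; apply: ler_wpM2r => //.
  exact: le_trans (hC _) (ler_norm _).
move=> _ ->; rewrite big_seq [RHS]big_seq; apply: eq_bigr => tau.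
rewrite in_fset_set// inE /= in_itv/= => -[_ /andP[tau0 _]].
exact: conv_translate.
Qed.

Lemma compens_hintensity g S (t : R) : finite_set (S `&` `]0, t]) -> kernel_on g ->
  compens (hintensity g S) 0 t =
  \sum_(tau <- fset_set (S `&` `]0, t])) conv (cst 1) g (t - tau).
Proof.
move=> fS kg; rewrite -(integral_hintensity (cbnd_cst 1) fS kg).
by apply: eq_Rintegral => s _; rewrite mul1r.
Qed.

Lemma compensB (lam : R -> R) (a b : R) : 0 <= a -> a <= b ->
  mu.-integrable `]0, b] (EFin \o lam) ->
  compens lam a b = compens lam 0 b - compens lam 0 a.
Proof.
by move=> a0 ab il; have := Rintegral_itvB il; move=> /(_ a); rewrite !bnd_simp => /(_ a0 ab) /esym.
Qed.

End hawkes_intensity.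

(** * Laplace transform of the Hawkes process *)

Section hawkes_laplace.
Context {d : measure_display} {T : measurableType d} {R : realType}.
Local Notation mu := (@lebesgue_measure R).
Variables (P : probability T R) (gam : nat -> R -> R) (N : nat -> T -> set R).
Hypothesis hawkesN : is_hawkes P gam N.
Hypothesis kgam : forall n, kernel_on (gam n).
Hypothesis igam : forall n, mu.-integrable `[0, +oo[ (EFin \o gam n.+1).

(* Log-Laplace transform of the size of the cluster, over [m] further generations and at
   age [u], of a point of generation [j], that point included. *)
Fixpoint progeny_exp (theta : R) (m j : nat) (u : R) : R :=
  match m with
  | 0%N => theta
  | m'.+1 => theta + conv (fun v => expR (progeny_exp theta m' j.+1 v) - 1) (gam j.+1) u
  end.

Lemma cbnd_progeny_exp theta m j : cbnd (progeny_exp theta m j).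
Proof.
elim: m j => [|m ih] j /=; first exact: cbnd_cst.
apply: cbndD; first exact: cbnd_cst.
by apply: cbnd_conv => //; exact: cbnd_expR1.
Qed.

Lemma cbnd_reflect (h : R -> R) (t : R) : cbnd h -> cbnd (fun s => h (t - s)).
Proof.
move=> [ch [C hC]]; split; last by exists C.
move=> x; apply: (@continuous_comp _ _ _ (fun s => t - s) h); last exact: ch.
by apply: cvgB; [exact: cvg_cst|exact: cvg_id].
Qed.

Let finN n w b : finite_set (N n w `&` `]-oo, b]).
Proof. by case: hawkesN => _ h _ _ _; exact: h. Qed.

Let finW n w t : finite_set (N n w `&` `]0, t]).
Proof. exact: finite_window. Qed.

Let mN n a b : measurable_fun setT (fun w => (cnt (N n w) a b)%:R : R).
Proof. by case: hawkesN => _ _ [_ h] _ _; exact: h. Qed.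

Lemma measurable_sum_points n (t : R) (h : R -> R) : 0 < t -> continuous h ->
  measurable_fun setT (fun w => \sum_(tau <- fset_set (N n w `&` `]0, t])) h tau).
Proof. by move=> t0 ch; apply: measurable_sum_window. Qed.

(** The compensator is a sum over the points of a continuous function, hence a limit of combinations
    of counts, whose measurability is given. *)
Let measurable_compens0 n t : 0 <= t ->
  measurable_fun setT (fun w => compens (hintensity (gam n.+1) (N n w)) 0 t).
Proof.
rewrite le_eqVlt => /predU1P[<-|t0].
  rewrite (_ : (fun _ => _) = cst 0)//; apply/funext => w.
  by rewrite /compens set_itv_ge ?bnd_simp ?ltxx// integral_set0.
rewrite (_ : (fun _ => _) = fun w =>
  \sum_(tau <- fset_set (N n w `&` `]0, t])) conv (cst 1) (gam n.+1) (t - tau)); last first.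
  by apply/funext => w; rewrite compens_hintensity.
apply: measurable_sum_points => //.
by have [] := cbnd_reflect t (cbnd_conv (cbnd_cst 1) (kgam n.+1) (igam n)).
Qed.

Let measurable_compensN n a b : 0 <= a ->
  measurable_fun setT (fun w => compens (hintensity (gam n.+1) (N n w)) a b).
Proof.
move=> a0; have [ba|ab] := leP b a.
  rewrite (_ : (fun _ => _) = cst 0)//; apply/funext => w.
  by rewrite /compens set_itv_ge ?bnd_simp -?leNgt// integral_set0.
rewrite (_ : (fun _ => _) = fun w => compens (hintensity (gam n.+1) (N n w)) 0 b -
  compens (hintensity (gam n.+1) (N n w)) 0 a); last first.
  apply/funext => w; rewrite compensB ?(ltW ab)//.
  exact: hintensity_integrable.
apply: measurable_funB; apply: measurable_compens0 => //.
by rewrite ltW// (le_lt_trans a0 ab).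
Qed.

Lemma measurable_past_event es : measurable (past_event N es).
Proof.
elim: es => [|e es ih]; first by rewrite (_ : past_event _ _ = setT)//; apply/seteqP.
rewrite (_ : past_event _ _ =
  [set w | cnt (N e.1.1.1 w) e.1.1.2 e.1.2 = e.2] `&` past_event N es).
  by apply: measurableI => //; exact: measurable_cnt_eq.
apply/seteqP; split=> w; rewrite /past_event /=.
  by move=> /andP[/eqP -> ->].
by move=> [-> ->]; rewrite eqxx.
Qed.

Let past_nil : past_event N [::] = setT.
Proof. by apply/seteqP. Qed.

Section fixed_time.
Variable t : R.
Hypothesis t0 : 0 < t.

Let C0N n w : R := (cnt (N n w) 0 t)%:R.

(** Each parent contributes at most the total mass of its kernel; this drives the induction on
    exponential moments. *)
Let compens_le n w :
  compens (hintensity (gam n.+1) (N n w)) 0 t <= intg gam n.+1 * C0N n w.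
Proof.
rewrite compens_hintensity// /C0N /cnt card_fset_sum1 natr_sum mulr_sumr.
apply: ler_sum => tau _; rewrite mulr1.
have := @conv_le_mass _ (cst 1) (gam n.+1) 1 (t - tau) (cbnd_cst 1) (kgam n.+1) (igam n) ler01.
by rewrite mul1r; apply => v; exact: lexx.
Qed.

Lemma poisson0 cs : intervals_ok cs ->
  (P (setT `&` count_event (N 0%N) cs) =
   \int[P]_(w in setT) (\prod_(c <- cs)
     Defs.poisson_prob (compens (gam 0%N) c.1.1 c.1.2) c.2)%:E)%E.
Proof.
move=> ok; rewrite setTI; case: hawkesN => _ _ _ h _; rewrite h//.
by rewrite integral_cst//= probability_setT mule1.
Qed.

Let igam0 : mu.-integrable `]0, t] (EFin \o gam 0%N).
Proof.
have [_ _ /(_ t)] := kgam 0; apply: integrableS => //.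
by move=> s /=; rewrite !in_itv/= => /andP[/ltW -> ->].
Qed.

Let gam0_ge0 (w : T) (s : R) : 0 < s -> 0 <= gam 0%N s.
Proof. by move=> /ltW; have [_ + _] := kgam 0; exact. Qed.

Let lam_ge0 n w s : 0 < s -> 0 <= hintensity (gam n.+1) (N n w) s.
Proof. by move=> _; exact: hintensity_ge0. Qed.

Let poissonN n es cs : all (fun e : nat * R * R * nat => (e.1.1.1 <= n)%N) es ->
  intervals_ok cs ->
  (P (past_event N es `&` count_event (N n.+1) cs) =
   \int[P]_(w in past_event N es) (\prod_(c <- cs) Defs.poisson_prob
      (compens (hintensity (gam n.+1) (N n w)) c.1.1 c.1.2) c.2)%:E)%E.
Proof. by case: hawkesN => _ _ _ _ h; exact: h. Qed.

Let intg_ge0 n : 0 <= intg gam n.+1.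
Proof.
rewrite /intg fine_ge0//; apply: integral_ge0 => s /=.
by rewrite in_itv/= andbT lee_fin; have [_ + _] := kgam n.+1; exact.
Qed.

Let compens_moment n : (forall C, 0 <= C -> (\int[P]_w (expR (C * C0N n w))%:E < +oo)%E) ->
  forall es (C : R), 0 <= C ->
  (\int[P]_(w in past_event N es)
    (expR (C * compens (hintensity (gam n.+1) (N n w)) 0 t))%:E < +oo)%E.
Proof.
move=> hn es C C0; apply: le_lt_trans (hn (C * intg gam n.+1) _); last exact: mulr_ge0.
have m1 : measurable_fun setT (fun w =>
    (expR (C * compens (hintensity (gam n.+1) (N n w)) 0 t))%:E).
  apply/measurable_EFinP; apply: measurableT_comp => //.
  by apply: measurable_funM => //; exact: measurable_compensN.
apply: (@le_trans _ _ (\int[P]_w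
    (expR (C * compens (hintensity (gam n.+1) (N n w)) 0 t))%:E)%E).
  by apply: ge0_subset_integral => //; exact: measurable_past_event.
apply: ge0_le_integral => //.
- apply/measurable_EFinP; apply: measurableT_comp => //.
  by apply: measurable_funM => //; exact: mN.
- by move=> w _; rewrite lee_fin ler_expR -mulrA ler_wpM2l.
Qed.

(** Induction on the generation for all [C] at once, because conditioning replaces [C] by
    [expR C - 1] times the mass of the kernel. *)
Lemma exp_moment_cnt n C : 0 <= C -> (\int[P]_w (expR (C * C0N n w))%:E < +oo)%E.
Proof.
elim: n C => [|n ih] C C0.
  have := @exp_cnt_integrable _ _ _ P (N 0%N) (fun=> gam 0%N) setT measurableT (mN 0%N)
    (fun a b _ => measurable_cst _) gam0_ge0 poisson0 t _ C C0.
  move=> h; have /integrableP[_] := h ltac:(move=> D _; rewrite integral_cst//= probability_setT mule1; exact: ltry).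
  by under eq_integral do rewrite gee0_abs ?lee_fin ?expR_ge0//.
have /integrableP[_] := @exp_cnt_integrable _ _ _ P (N n.+1)
  (fun w => hintensity (gam n.+1) (N n w))
  (past_event N [::]) (measurable_past_event _) (mN n.+1)
  (@measurable_compensN n) (@lam_ge0 n) (fun cs ok => @poissonN n [::] cs isT ok) t
  (compens_moment ih [::]) C C0.
by rewrite past_nil; under eq_integral do rewrite gee0_abs ?lee_fin ?expR_ge0//.
Qed.

Let exp_compens_finite n es (C : R) : 0 <= C ->
  (\int[P]_(w in past_event N es)
    (expR (C * compens (hintensity (gam n.+1) (N n w)) 0 t))%:E < +oo)%E.
Proof. by move=> C0; apply: compens_moment => // D; exact: exp_moment_cnt. Qed.

(** A functional of the ages in generation n + 1 becomes one of the ages in generation n,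
    [integral_hintensity] evaluating the exponent of the Laplace functional. *)
Let laplace_step n es (h : R -> R) :
  all (fun e : nat * R * R * nat => (e.1.1.1 <= n)%N) es -> cbnd h ->
  (\int[P]_(w in past_event N es)
     (expR (\sum_(tau <- fset_set (N n.+1 w `&` `]0, t])) h (t - tau)))%:E =
   \int[P]_(w in past_event N es)
     (expR (\sum_(tau <- fset_set (N n w `&` `]0, t]))
        conv (fun v => expR (h v) - 1) (gam n.+1) (t - tau)))%:E)%E.
Proof.
move=> okes ch.
rewrite (@laplace_functional _ _ _ P (N n.+1) (fun w => hintensity (gam n.+1) (N n w))
  (past_event N es) (measurable_past_event _) (mN n.+1)
  (@measurable_compensN n) (@lam_ge0 n) (fun cs ok => @poissonN n es cs okes ok) t t0
  (fun w => finW n.+1 w t) _ _ (fun s => h (t - s)))//.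
- apply: eq_integral => w _; rewrite -integral_hintensity//.
  exact: cbnd_expR1.
- by move=> w; exact: hintensity_integrable.
- by move=> C C0; exact: exp_compens_finite.
- exact: cbnd_reflect.
Qed.

Let laplace_step0 (h : R -> R) : cbnd h ->
  (\int[P]_w (expR (\sum_(tau <- fset_set (N 0%N w `&` `]0, t])) h (t - tau)))%:E =
   (expR (conv (fun v => expR (h v) - 1) (gam 0%N) t))%:E)%E.
Proof.
move=> ch.
rewrite (@laplace_functional _ _ _ P (N 0%N) (fun=> gam 0%N) setT measurableT (mN 0%N)
  (fun a b _ => measurable_cst _) gam0_ge0 poisson0 t t0
  (fun w => finW 0 w t) _ _ (fun s => h (t - s)))//.
- rewrite integral_cst//= probability_setT mule1; congr (expR _)%:E.
  rewrite (@Rintegral_itv_obnd_cbnd _ 0 (BRight t))//.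
  have := conv_integrable t (cbnd_expR1 ch) (kgam 0); apply: integrableS => //.
  by move=> s /=; rewrite !in_itv/= => /andP[/ltW -> ->].
- by move=> C C0; rewrite integral_cst//= probability_setT mule1; exact: ltry.
- exact: cbnd_reflect.
Qed.

(* The factors [expR (theta * C0N j w)] are resolved into the events [C0N j = k], because
   [is_hawkes] only gives information on the events [past_event N es]. *)
Let prefactor n (theta : R) (F F' : T -> R) :
  measurable_fun setT F -> measurable_fun setT F' ->
  (forall w, 0 <= F w) -> (forall w, 0 <= F' w) ->
  (forall es : seq (nat * R * R * nat), all (fun e => (e.1.1.1 <= n)%N) es ->
    (\int[P]_(w in past_event N es) (F w)%:E =
     \int[P]_(w in past_event N es) (F' w)%:E)%E) ->
  forall (js : seq nat) es, all (fun j => (j <= n)%N) js ->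
  all (fun e : nat * R * R * nat => (e.1.1.1 <= n)%N) es ->
  (\int[P]_(w in past_event N es) (expR (\sum_(j <- js) theta * C0N j w) * F w)%:E =
   \int[P]_(w in past_event N es) (expR (\sum_(j <- js) theta * C0N j w) * F' w)%:E)%E.
Proof.
move=> mF mF' F0 F'0 FF'; elim=> [|j js ih] es /=.
  move=> _ okes; under eq_integral do rewrite big_nil expR0 mul1r.
  by under [RHS]eq_integral do rewrite big_nil expR0 mul1r; exact: FF'.
move=> /andP[jn okjs] okes.
have mE (js' : seq nat) : measurable_fun setT (fun w => expR (\sum_(j <- js') theta * C0N j w)).
  apply: measurableT_comp => //; apply: measurable_sum => i.
  by apply: measurable_funM => //; exact: mN.
have mX k : measurable [set w | cnt (N j w) 0 t = k] by apply: measurable_cnt_eq; exact: mN.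
have split_eq (G : T -> R) : measurable_fun setT G -> (forall w, 0 <= G w) ->
  (\int[P]_(w in past_event N es) (expR (\sum_(i <- j :: js) theta * C0N i w) * G w)%:E =
   \sum_(k <oo) ((expR (theta * k%:R))%:E *
     \int[P]_(w in past_event N ((j, 0%R, t, k) :: es))
        (expR (\sum_(i <- js) theta * C0N i w) * G w)%:E))%E.
  move=> mG G0.
  rewrite (@integral_split_nat _ _ _ P _ (fun w => cnt (N j w) 0 t))//; last 3 first.
  - exact: measurable_past_event.
  - by apply/measurable_EFinP; apply: measurable_funTS; exact: measurable_funM.
  - by move=> w _; rewrite lee_fin mulr_ge0 ?expR_ge0.
  apply: eq_eseriesr => k _.
  have -> : past_event N es `&` [set w | cnt (N j w) 0 t = k] =
      past_event N ((j, 0%R, t, k) :: es).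
    apply/seteqP; split=> w; rewrite /past_event /=.
      by move=> [-> ->]; rewrite eqxx.
    by move=> /andP[/eqP -> ->].
  have mp : measurable (past_event N ((j, 0%R, t, k) :: es)) by exact: measurable_past_event.
  rewrite -ge0_integralZl_EFin ?expR_ge0//; last 2 first.
  - by move=> w _; rewrite lee_fin mulr_ge0 ?expR_ge0.
  - by apply/measurable_EFinP; apply: measurable_funTS; exact: measurable_funM.
  apply: eq_integral => w; rewrite inE /past_event /= => /andP[/eqP wk _].
  by rewrite big_cons expRD /C0N wk -EFinM mulrA.
rewrite !split_eq//; apply: eq_eseriesr => k _; congr (_ * _)%E.
by apply: ih => //=; rewrite jn okes.
Qed.

(** Generations are integrated out from the youngest, until only the immigrants remain. *)
Lemma hawkes_laplace (theta : R) (M : nat) :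
  (\int[P]_w (expR (theta * \sum_(0 <= j < M.+1) C0N j w))%:E =
   (expR (conv (fun v => expR (progeny_exp theta M 0 v) - 1) (gam 0%N) t))%:E)%E.
Proof.
rewrite -laplace_step0; last exact: cbnd_progeny_exp.
(* [Z n] integrates out the generations after [n], conditionally on generation [n]. *)
pose Z n w := expR (\sum_(0 <= j < n) theta * C0N j w) *
  expR (\sum_(tau <- fset_set (N n w `&` `]0, t])) progeny_exp theta (M - n) n (t - tau)).
have cntE n w : \sum_(tau <- fset_set (N n w `&` `]0, t])) theta = theta * C0N n w.
  by rewrite /C0N /cnt card_fset_sum1 natr_sum mulr_sumr; apply: eq_bigr => ? _; rewrite mulr1.
have ZM w : Z M w = expR (theta * \sum_(0 <= j < M.+1) C0N j w).
  by rewrite /Z subnn /= cntE -expRD mulr_sumr [in RHS]big_nat_recr.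
have Z0 w : Z 0%N w = expR (\sum_(tau <- fset_set (N 0%N w `&` `]0, t]))
    progeny_exp theta M 0 (t - tau)).
  by rewrite /Z big_nil expR0 mul1r subn0.
under eq_integral do rewrite -ZM; under [RHS]eq_integral do rewrite -Z0.
suff H n : (n <= M)%N -> (\int[P]_w (Z n w)%:E = \int[P]_w (Z 0%N w)%:E)%E by exact: H.
elim: n => [//|n ih nM]; rewrite -ih; last exact: ltnW.
have mS k (h : R -> R) : cbnd h -> measurable_fun setT (fun w =>
    expR (\sum_(tau <- fset_set (N k w `&` `]0, t])) h (t - tau))).
  move=> ch; apply: measurableT_comp => //.
  by apply: measurable_sum_points => //; have [] := cbnd_reflect t ch.
pose h := progeny_exp theta (M - n.+1) n.+1.
have ch : cbnd h by exact: cbnd_progeny_exp.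
have cch : cbnd (conv (fun v => expR (h v) - 1) (gam n.+1)).
  by apply: cbnd_conv => //; exact: cbnd_expR1.
have := @prefactor n theta _ _ (mS n.+1 _ ch) (mS n _ cch)
  (fun w => expR_ge0 _) (fun w => expR_ge0 _) (fun es okes => laplace_step okes ch)
  (index_iota 0 n.+1) [::] _ isT.
rewrite past_nil => ->; last first.
  by apply/allP => j; rewrite mem_index_iota /= ltnS.
(* The weight [theta] of a point of generation n merges with the convolution produced by its
   children into [progeny_exp theta (M - n) n]. *)
apply: eq_integral => w _; congr EFin; rewrite /Z big_nat_recr//= expRD -mulrA.
congr (_ * _); rewrite -expRD -cntE -big_split /=; congr expR.
have MnE : (M - n = (M - n.+1).+1)%N by rewrite subnSK.
by apply: eq_bigr => tau _; rewrite MnE.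
Qed.

End fixed_time.
End hawkes_laplace.

(** Summation by parts: in the worst case [dd] follows its affine bound, paying [e] at once with the
    largest weight and [g] at every step. The induction keeps the current slack, weighted by
    [f n]. *)
Lemma abel_sum_le (R : realType) (f dd : nat -> R) (e g : R) (n : nat) :
  nonincreasing_seq f -> (forall k, 0 <= f k) -> dd 0%N = 0 ->
  (forall k, dd k <= e + g * k%:R) ->
  \sum_(0 <= k < n) f k * (dd k.+1 - dd k) <= f 0%N * e + g * \sum_(0 <= k < n) f k.
Proof.
move=> fni f0 d0 dle.
suff H : \sum_(0 <= k < n) f k * (dd k.+1 - dd k) + f n * (e + g * n%:R - dd n) <=
    f 0%N * e + g * \sum_(0 <= k < n) f k.
  by apply: le_trans H; rewrite lerDl mulr_ge0// subr_ge0.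
elim: n => [|n ih]; first by rewrite !big_geq// d0 !mulr0 subr0 addr0 add0r addr0.
rewrite !big_nat_recr//=.
have h1 : 0 <= e + g * n.+1%:R - dd n.+1 by rewrite subr_ge0.
have h2 := ler_wpM2r h1 (fni _ _ (leqnSn n)).
have nE : n.+1%:R = n%:R + 1 :> R by rewrite -addn1 natrD.
rewrite nE in h2 *; lra.
Qed.

(** With a and b consecutive square roots, 1 / b <= 2 (b - a), because b^2 = a^2 + 1 and (b - a)^2
    >= 0. *)
Lemma sum_inv_sqrt_le (R : realType) (n : nat) :
  \sum_(0 <= k < n) (Num.sqrt k.+1%:R)^-1 <= 2 * Num.sqrt n%:R :> R.
Proof.
elim: n => [|n ih]; first by rewrite big_geq// mulr_ge0// sqrtr_ge0.
rewrite big_nat_recr//=; apply: (le_trans (lerD ih (lexx _))).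
have b0 : 0 < Num.sqrt n.+1%:R :> R by rewrite sqrtr_gt0.
have a0 : 0 <= Num.sqrt n%:R :> R by exact: sqrtr_ge0.
have b2 : Num.sqrt n.+1%:R ^+ 2 = Num.sqrt n%:R ^+ 2 + 1 :> R.
  by rewrite !sqr_sqrtr// -addn1 natrD.
set a := Num.sqrt n%:R in a0 b2 *; set b := Num.sqrt n.+1%:R in b0 b2 *.
rewrite -(ler_pM2r b0) mulrDl mulVf ?gt_eqF//.
have := sqr_ge0 (b - a); lra.
Qed.

(** * Bounds on the cumulant recursion *)

Section progeny_bounds.
Context {R : realType}.
Local Notation mu := (@lebesgue_measure R).
Variables (gam : nat -> R -> R) (rho : R).
Hypothesis kgam : forall n, kernel_on (gam n).
Hypothesis igam : forall n, mu.-integrable `[0, +oo[ (EFin \o gam n.+1).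
Hypothesis gam_rho : forall n, intg gam n.+1 <= rho.
Hypothesis rho1 : rho < 1.

Let g := intg gam.

Let g_ge0 n : 0 <= g n.+1.
Proof.
rewrite /g /intg fine_ge0//; apply: integral_ge0 => s /=.
by rewrite in_itv/= andbT lee_fin; have [_ + _] := kgam n.+1; exact.
Qed.

Let rho0 : 0 <= rho. Proof. exact: le_trans (g_ge0 0) (gam_rho 0). Qed.

(* [alpha j] is the mean size of the full cluster of a point of generation [j], and
   [qsum j] its second moment. *)
Definition alpha (j : nat) : R := wlim (intg gam) (fun=> 1) j.
Definition qsum (j : nat) : R := wlim (intg gam) (fun i => alpha i ^+ 2) j.

Let K : R := (1 - rho)^-1.
(** Variance of the size of the full cluster, its second cumulant: [qsum j] is
    [alpha j ^+ 2 + be j]. *)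
Let be j : R := g j.+1 * qsum j.+1.

Let K_gt0 : 0 < K. Proof. by rewrite invr_gt0 subr_gt0. Qed.

Let K_ge1 : 1 <= K.
Proof. by rewrite /K invf_ge1 ?subr_gt0// gerBl. Qed.

Let rhoK : rho * K + 1 = K.
Proof. by rewrite /K; field; rewrite subr_eq0 gt_eqF. Qed.

Lemma alphaE j : alpha j = 1 + intg gam j.+1 * alpha j.+1.
Proof. exact: (wlimE g_ge0 gam_rho rho1 (fun=> ler01) (fun=> lexx 1)). Qed.

Lemma alpha_le j : alpha j <= K.
Proof.
have := wlim_le g_ge0 gam_rho rho1 (fun=> ler01) (fun=> lexx 1) j.
by rewrite mul1r.
Qed.

Lemma alpha_ge1 j : 1 <= alpha j.
Proof.
rewrite alphaE lerDl mulr_ge0//.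
exact: (wlim_ge0 g_ge0 gam_rho rho1 (fun=> ler01) (fun=> lexx 1)).
Qed.

Let alpha2_ge0 j : 0 <= alpha j ^+ 2. Proof. exact: sqr_ge0. Qed.

Let alpha2_le j : alpha j ^+ 2 <= K ^+ 2.
Proof.
apply: lerXn2r; rewrite ?nnegrE ?alpha_le//; last exact: ltW.
exact: le_trans ler01 (alpha_ge1 j).
Qed.

Lemma qsumE j : qsum j = alpha j ^+ 2 + intg gam j.+1 * qsum j.+1.
Proof. exact: (wlimE g_ge0 gam_rho rho1 alpha2_ge0 alpha2_le). Qed.

Lemma qsum_ge0 j : 0 <= qsum j.
Proof. exact: (wlim_ge0 g_ge0 gam_rho rho1 alpha2_ge0 alpha2_le). Qed.

Let qsum_le j : qsum j <= K ^+ 3.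
Proof.
have := wlim_le g_ge0 gam_rho rho1 alpha2_ge0 alpha2_le j.
by rewrite (exprSr K 2).
Qed.

Let be_ge0 j : 0 <= be j. Proof. by rewrite mulr_ge0// qsum_ge0. Qed.

Let be_le j : be j <= K ^+ 3.
Proof.
apply: (le_trans _ (qsum_le j)); rewrite qsumE lerDr; exact: sqr_ge0.
Qed.

(** [D] bounds the factor of [theta] in the barrier, [K] for the mean and [K ^+ 3 + 1] for the
    correction. [C2] bounds the cubic remainder of its exponential: [D ^+ 3] from Taylor, [D ^+ 2]
    from the cross terms of the square. *)
Let D : R := K + (K ^+ 3 + 1).
Let C2 : R := D ^+ 2 + D ^+ 3.
Let kap : R := C2 * K.

(** The first bound keeps the barrier within [-1, 1], the second keeps [kap * theta] there. *)
Definition theta_max : R := Num.min D^-1 kap^-1.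

Definition laplace_const : R := kap + C2.

Let D_ge1 : 1 <= D.
Proof. by have := K_ge1; have := exprn_ge0 3 (ltW K_gt0); rewrite /D; lra. Qed.

Let D_gt0 : 0 < D. Proof. exact: lt_le_trans D_ge1. Qed.

Let C2_gt0 : 0 < C2. Proof. by rewrite addr_gt0// exprn_gt0. Qed.

Let kap_gt0 : 0 < kap. Proof. exact: mulr_gt0. Qed.

Lemma theta_max_gt0 : 0 < theta_max.
Proof. by rewrite /theta_max lt_min !invr_gt0 D_gt0 kap_gt0. Qed.

Lemma laplace_const_ge0 : 0 <= laplace_const.
Proof. by rewrite addr_ge0// ltW. Qed.

(* [kap] absorbs the Taylor remainder, so that [X] below is a supersolution (for
   [0 <= theta]) or a subsolution (for [theta <= 0]) of the recursion of [progeny_exp]. *)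
Let kapE : rho * (kap + C2) <= kap.
Proof.
rewrite /kap; have -> : rho * (C2 * K + C2) = C2 * (rho * K + rho) by ring.
by rewrite ler_wpM2l ?(ltW C2_gt0)// -[leRHS]rhoK lerD2l ltW.
Qed.

(** * Barriers for small theta *)

Section small_theta.
Variable theta : R.
Hypothesis theta_small : `|theta| <= theta_max.

Let thD : `|theta| * D <= 1.
Proof.
rewrite -ler_pdivlMr// mul1r; apply: (le_trans theta_small).
by rewrite ge_min lexx.
Qed.

Let thkap : `|kap * theta| <= 1.
Proof.
rewrite normrM gtr0_norm// mulrC -ler_pdivlMr// mul1r; apply: (le_trans theta_small).
by rewrite ge_min lexx orbT.
Qed.

Let th1 : `|theta| <= 1.
Proof. by apply: le_trans thD; rewrite ler_peMr. Qed.

(** Second-order cumulant expansion plus a cubic term with the sign of [theta]: it raises the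
    barrier for positive [theta] and lowers it for negative [theta]. *)
Let X j : R := theta * alpha j + theta ^+ 2 / 2 * be j + kap * theta ^+ 3.
Let z j : R := be j / 2 + kap * theta.

Let XE j : X j = theta * (alpha j + theta * z j).
Proof. by rewrite /X /z; field. Qed.

Let z_le j : `|z j| <= K ^+ 3 + 1.
Proof.
apply: (le_trans (ler_normD _ _)); apply: lerD => //.
rewrite ger0_norm ?divr_ge0//; have := be_le j; have := be_ge0 j; lra.
Qed.

Let Bz0 : 0 <= K ^+ 3 + 1.
Proof. by have := exprn_ge0 3 (ltW K_gt0); lra. Qed.

Let thz j : `|theta * z j| <= `|theta| * (K ^+ 3 + 1).
Proof. by rewrite normrM ler_wpM2l. Qed.

Let thBz : `|theta| * (K ^+ 3 + 1) <= 1.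
Proof.
by apply: le_trans thD; rewrite ler_wpM2l// /D lerDr ltW.
Qed.

Let factor_le j : `|alpha j + theta * z j| <= D.
Proof.
apply: (le_trans (ler_normD _ _)); apply: lerD.
  by rewrite ger0_norm ?alpha_le// (le_trans ler01 (alpha_ge1 j)).
by apply: (le_trans (thz j)); rewrite ler_piMl.
Qed.

Let X_le j : `|X j| <= `|theta| * D.
Proof. by rewrite XE normrM ler_wpM2l. Qed.

Let theta_le_X j : 0 <= theta -> theta <= X j.
Proof.
move=> t0; rewrite XE -[leLHS]mulr1 ler_wpM2l//.
have z0 : 0 <= z j by rewrite addr_ge0 ?divr_ge0// mulr_ge0// ltW.
by have := mulr_ge0 t0 z0; have := alpha_ge1 j; lra.
Qed.

(** Initial value of the downward comparison. By the recursion of [alpha], the first two terms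
    exceed [theta] by [g j.+1 * theta] times a factor that is nonnegative because |theta| qsum / 2
    <= 1 <= alpha. *)
Let X_le_theta j : theta <= 0 -> X j <= theta.
Proof.
move=> t0; rewrite /X alphaE /be.
have h1 : 0 <= alpha j.+1 + theta * (qsum j.+1 / 2).
  have h : `|theta * (qsum j.+1 / 2)| <= 1.
    rewrite normrM; apply: le_trans thBz; rewrite ler_wpM2l//.
    rewrite ger0_norm ?divr_ge0 ?qsum_ge0//.
    have := qsum_le j.+1; have := qsum_ge0 j.+1; lra.
  move: h; rewrite ler_norml => /andP[h _].
  by have := alpha_ge1 j.+1; lra.
have h2 : theta * (alpha j.+1 + theta * (qsum j.+1 / 2)) <= 0 by rewrite mulr_le0_ge0.
have h3 : g j.+1 * (theta * (alpha j.+1 + theta * (qsum j.+1 / 2))) <= 0.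
  by rewrite mulr_ge0_le0.
have h4 : kap * theta ^+ 3 <= 0.
  apply: mulr_ge0_le0; first exact: ltW.
  by rewrite exprS mulr_le0_ge0// sqr_ge0.
move: h3 h4; rewrite /g; lra.
Qed.

(** Exponentiation adds the square of the first-order term, so the variance [be j] becomes the
    second moment [qsum j]. *)
Let expX j : `|expR (X j) - 1 - (theta * alpha j + theta ^+ 2 / 2 * qsum j + kap * theta ^+ 3)|
  <= C2 * `|theta| ^+ 3.
Proof.
have X1 : `|X j| <= 1 by exact: le_trans (X_le j) thD.
have -> : expR (X j) - 1 - (theta * alpha j + theta ^+ 2 / 2 * qsum j + kap * theta ^+ 3) =
  (expR (X j) - (1 + X j + X j ^+ 2 / 2)) +
  theta ^+ 3 / 2 * (z j * (2 * alpha j + theta * z j)).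
  by rewrite qsumE -/(g j.+1) -/(be j) XE /z; field.
have hA : `|expR (X j) - (1 + X j + X j ^+ 2 / 2)| <= D ^+ 3 * `|theta| ^+ 3.
  apply: (le_trans (expR_taylor2 X1)); rewrite -exprMn mulrC.
  by apply: lerXn2r; rewrite ?nnegrE ?mulr_ge0 ?X_le// ltW.
have hB : `|theta ^+ 3 / 2 * (z j * (2 * alpha j + theta * z j))| <= D ^+ 2 * `|theta| ^+ 3.
  rewrite (normrM (theta ^+ 3 / 2)) (normrM (theta ^+ 3)) (normrM (z j)).
  rewrite (normrX 3 theta) normfV (ger0_norm (ler0n _ 2)).
  have h : `|2 * alpha j + theta * z j| <= 2 * K + (K ^+ 3 + 1).
    apply: (le_trans (ler_normD _ _)); apply: lerD.
      rewrite ger0_norm ?ler_wpM2l ?alpha_le// mulr_ge0//.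
      exact: (le_trans ler01 (alpha_ge1 j)).
    by apply: (le_trans (thz j)); rewrite ler_piMl.
  have h2 : `|z j| * `|2 * alpha j + theta * z j| <=
      (K ^+ 3 + 1) * (2 * K + (K ^+ 3 + 1)) by apply: ler_pM.
  have h3 : (K ^+ 3 + 1) * (2 * K + (K ^+ 3 + 1)) <= D ^+ 2.
    rewrite /D; have := sqr_ge0 K; lra.
  rewrite [leRHS]mulrC -mulrA; apply: ler_wpM2l; first exact: exprn_ge0.
  have h4 := mulr_ge0 (normr_ge0 (z j)) (normr_ge0 (2 * alpha j + theta * z j)).
  rewrite mulrC ler_pdivrMr//; apply: (le_trans (le_trans h2 h3)).
  by rewrite ler_peMr ?sqr_ge0// ler1n.
apply: (le_trans (ler_normD _ _)); rewrite (mulrDl (D ^+ 2)).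
by rewrite [leRHS]addrC; apply: lerD.
Qed.

Let expX_bounds j :
  theta * alpha j + theta ^+ 2 / 2 * qsum j + kap * theta ^+ 3 - C2 * `|theta| ^+ 3
    <= expR (X j) - 1 <=
  theta * alpha j + theta ^+ 2 / 2 * qsum j + kap * theta ^+ 3 + C2 * `|theta| ^+ 3.
Proof. by move: (expX j); rewrite ler_distl. Qed.

Let XS j : X j = theta + g j.+1 * (theta * alpha j.+1 + theta ^+ 2 / 2 * qsum j.+1)
  + kap * theta ^+ 3.
Proof. by rewrite /X alphaE /be /g; ring. Qed.

(** Comparison by induction on [m]; [expR (X j.+1) - 1] is nonnegative, as [conv_le_mass]
    requires. *)
Lemma progeny_exp_le m j u : 0 <= theta -> progeny_exp gam theta m j u <= X j.
Proof.
move=> t0; elim: m j u => [|m ih] j u /=; first exact: theta_le_X.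
have e0 : 0 <= expR (X j.+1) - 1.
  by rewrite subr_ge0 -expR0 ler_expR; exact: le_trans t0 (theta_le_X _ t0).
have := @conv_le_mass _ (fun v => expR (progeny_exp gam theta m j.+1 v) - 1) (gam j.+1)
  (expR (X j.+1) - 1) u (cbnd_expR1 (cbnd_progeny_exp kgam igam _ _ _)) (kgam _) (igam _) e0.
move=> h; have {}h := h (fun v => lerB (eq_ind_r is_true (ih j.+1 v) (ler_expR _ _)) (lexx 1)).
rewrite XS -addrA lerD2l; apply: (le_trans h).
have -> : \int[mu]_(s in `[0, +oo[) gam j.+1 s = g j.+1 by [].
rewrite mulrC.
have /andP[_ hX] := expX_bounds j.+1.
have h1 := ler_wpM2l (g_ge0 j) hX.
have t3 : 0 <= theta ^+ 3 by exact: exprn_ge0.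
have h2 : g j.+1 * (kap + C2) <= kap.
  by apply: le_trans kapE; rewrite ler_wpM2r ?gam_rho// ltW// addr_gt0.
have := ler_wpM2r t3 h2; rewrite (ger0_norm t0) in h1; lra.
Qed.

Lemma progeny_exp_ge m j u : theta <= 0 -> X j <= progeny_exp gam theta m j u.
Proof.
move=> t0; elim: m j u => [|m ih] j u /=; first exact: X_le_theta.
have e0 : expR (X j.+1) - 1 <= 0.
  by rewrite subr_le0 -[leRHS]expR0 ler_expR; exact: le_trans (X_le_theta _ t0) t0.
have := @conv_ge_mass _ (fun v => expR (progeny_exp gam theta m j.+1 v) - 1) (gam j.+1)
  (expR (X j.+1) - 1) u (cbnd_expR1 (cbnd_progeny_exp kgam igam _ _ _)) (kgam _) (igam _) e0.
move=> h; have {}h := h (fun v => lerB (eq_ind_r is_true (ih j.+1 v) (ler_expR _ _)) (lexx 1)).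
rewrite XS -addrA lerD2l; apply: (le_trans _ h).
have -> : \int[mu]_(s in `[0, +oo[) gam j.+1 s = g j.+1 by [].
rewrite [leRHS]mulrC.
have /andP[hX _] := expX_bounds j.+1.
have h1 := ler_wpM2l (g_ge0 j) hX.
have t3 : 0 <= (- theta) ^+ 3 by rewrite exprn_ge0// oppr_ge0.
have h2 : g j.+1 * (kap + C2) <= kap.
  by apply: le_trans kapE; rewrite ler_wpM2r ?gam_rho// ltW// addr_gt0.
have := ler_wpM2r t3 h2; rewrite (ler0_norm t0) in h1.
have e : (- theta) ^+ 3 = - theta ^+ 3 by ring.
rewrite e in h1 *; lra.
Qed.

Lemma log_laplace_le m t : 0 <= theta ->
  conv (fun v => expR (progeny_exp gam theta m 0 v) - 1) (gam 0%N) t <=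
  (theta * alpha 0 + theta ^+ 2 / 2 * qsum 0 + laplace_const * `|theta| ^+ 3) *
    \int[mu]_(s in `[0, t]) gam 0%N s.
Proof.
move=> t0; rewrite -conv_cst// /laplace_const; apply: le_conv => //.
- by apply: cbnd_expR1; exact: cbnd_progeny_exp.
- exact: cbnd_cst.
move=> v; have /andP[_] := expX_bounds 0.
have : expR (progeny_exp gam theta m 0 v) <= expR (X 0) by rewrite ler_expR progeny_exp_le.
rewrite (ger0_norm t0); lra.
Qed.

Lemma log_laplace_ge m t : theta <= 0 ->
  (theta * alpha 0 + theta ^+ 2 / 2 * qsum 0 - laplace_const * `|theta| ^+ 3) *
    \int[mu]_(s in `[0, t]) gam 0%N s <=
  conv (fun v => expR (progeny_exp gam theta m 0 v) - 1) (gam 0%N) t.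
Proof.
move=> t0; rewrite -conv_cst// /laplace_const; apply: le_conv => //.
- exact: cbnd_cst.
- by apply: cbnd_expR1; exact: cbnd_progeny_exp.
move=> v; have /andP[+ _] := expX_bounds 0.
have : expR (X 0) <= expR (progeny_exp gam theta m 0 v) by rewrite ler_expR progeny_exp_ge.
have e : (- theta) ^+ 3 = - theta ^+ 3 by ring.
rewrite (ler0_norm t0) e; lra.
Qed.

End small_theta.

(* [progeny_mean] is the [theta]-derivative of [progeny_exp] at 0, and [progeny_square] the
   second derivative of [expR progeny_exp] there. *)
Fixpoint progeny_mean (m j : nat) (u : R) : R :=
  match m with
  | 0%N => 1
  | m'.+1 => 1 + conv (progeny_mean m' j.+1) (gam j.+1) u
  end.

Fixpoint progeny_square (m j : nat) (u : R) : R :=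
  match m with
  | 0%N => 1
  | m'.+1 => progeny_mean m j u ^+ 2 + conv (progeny_square m' j.+1) (gam j.+1) u
  end.

Lemma cbnd_progeny_mean m j : cbnd (progeny_mean m j).
Proof.
elim: m j => [|m ih] j /=; first exact: cbnd_cst.
by apply: cbndD; [exact: cbnd_cst|exact: cbnd_conv].
Qed.

Lemma cbnd_progeny_square m j : cbnd (progeny_square m j).
Proof.
elim: m j => [|m ih] j; first exact: cbnd_cst.
rewrite [progeny_square _ _]/=.
apply: cbndD; last exact: cbnd_conv.
by apply: cbndM; exact: (cbnd_progeny_mean m.+1).
Qed.

Let conv_ge0 f n u : cbnd f -> (forall v, 0 <= f v) -> 0 <= conv f (gam n) u.
Proof.
move=> cf f0; have := le_conv u (cbnd_cst 0) cf (kgam n) f0.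
by rewrite conv_cst// mul0r.
Qed.

Lemma progeny_mean_ge1 m j u : 1 <= progeny_mean m j u.
Proof.
elim: m j u => [|m ih] j u //=; rewrite lerDl conv_ge0//.
  exact: cbnd_progeny_mean.
by move=> v; exact: le_trans ler01 (ih _ _).
Qed.

Lemma progeny_mean_le m j u : progeny_mean m j u <= alpha j.
Proof.
elim: m j u => [|m ih] j u /=; first exact: alpha_ge1.
rewrite alphaE lerD2l mulrC; apply: conv_le_mass => //.
- exact: cbnd_progeny_mean.
- exact: le_trans ler01 (alpha_ge1 _).
Qed.

Lemma progeny_square_ge0 m j u : 0 <= progeny_square m j u.
Proof.
elim: m j u => [|m ih] j u; first exact: ler01.
rewrite [progeny_square _ _ _]/= addr_ge0 ?sqr_ge0// conv_ge0//.
exact: cbnd_progeny_square.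
Qed.

Lemma progeny_mean_nd m j u : progeny_mean m j u <= progeny_mean m.+1 j u.
Proof.
elim: m j u => [|m ih] j u.
  by rewrite [leLHS]/=; exact: progeny_mean_ge1.
rewrite [leLHS]/= [leRHS]/= lerD2l; apply: le_conv => //.
  exact: cbnd_progeny_mean.
exact: (cbnd_progeny_mean m.+1).
Qed.

Lemma progeny_square_nd m j u : progeny_square m j u <= progeny_square m.+1 j u.
Proof.
elim: m j u => [|m ih] j u.
  rewrite [leLHS]/= [leRHS]/= ler_wpDr//.
    by apply: conv_ge0 => //; exact: cbnd_cst.
  by have := progeny_mean_ge1 1 j u => /= h; rewrite exprn_ege1.
have h : progeny_mean m.+1 j u ^+ 2 <= progeny_mean m.+2 j u ^+ 2.
  apply: lerXn2r; rewrite ?nnegrE ?progeny_mean_nd//.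
    exact: le_trans ler01 (progeny_mean_ge1 _ _ _).
  exact: le_trans ler01 (progeny_mean_ge1 _ _ _).
apply: lerD; first exact: h.
apply: le_conv => //; first exact: cbnd_progeny_square.
exact: (cbnd_progeny_square m.+1).
Qed.

Lemma progeny_square_le_depth p m j u : (p <= m)%N ->
  progeny_square p j u <= progeny_square m j u.
Proof.
move=> /subnK <-; elim: (m - p)%N => [|k ih]; first by rewrite add0n.
by apply: (le_trans ih); rewrite addSn; exact: progeny_square_nd.
Qed.

Let cbndZ (c : R) f : cbnd f -> cbnd (fun v => c * f v).
Proof. by move=> cf; apply: cbndM => //; exact: cbnd_cst. Qed.

(** Iterates 1 + x <= expR x, for either sign of [theta]. *)
Lemma progeny_exp_ge_mean theta m j u :
  theta * progeny_mean m j u <= progeny_exp gam theta m j u.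
Proof.
elim: m j u => [|m ih] j u /=; first by rewrite mulr1.
rewrite mulrDr mulr1 lerD2l -convZ//; last exact: cbnd_progeny_mean.
apply: le_conv => //; first by apply: cbndZ; exact: cbnd_progeny_mean.
  by apply: cbnd_expR1; exact: cbnd_progeny_exp.
by move=> v; rewrite lerBrDl; apply: (le_trans _ (expR_ge1Dx _)); rewrite lerD2l.
Qed.

Lemma progeny_exp_le0 theta m j u : theta <= 0 -> progeny_exp gam theta m j u <= 0.
Proof.
move=> t0; elim: m j u => [|m ih] j u //=.
rewrite -[leRHS]addr0; apply: lerD => //.
rewrite -(mul0r (\int[mu]_(s in `[0, +oo[) gam j.+1 s)).
apply: conv_le_mass => //; first by apply: cbnd_expR1; exact: cbnd_progeny_exp.
by move=> v; rewrite subr_le0 expR_le1.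
Qed.

(** At nonpositive arguments the second-order Taylor polynomial is an upper bound, and its square is
    controlled by theta alpha <= [progeny_exp] <= 0. *)
Let exp_le_mean_body theta m j v : theta <= 0 ->
  progeny_exp gam theta m j v <=
    theta * progeny_mean m j v + theta ^+ 2 / 2 * be j ->
  expR (progeny_exp gam theta m j v) - 1 <=
    theta * progeny_mean m j v + theta ^+ 2 / 2 * qsum j.
Proof.
move=> t0 h; have H0 := progeny_exp_le0 m j v t0.
have h1 := expR_le_taylor2 H0.
have h2 : progeny_exp gam theta m j v ^+ 2 <= theta ^+ 2 * alpha j ^+ 2.
  rewrite -exprMn -(sqrrN (progeny_exp _ _ _ _ _)) -(sqrrN (theta * _)).
  apply: lerXn2r; rewrite ?nnegrE ?oppr_ge0//.
    by rewrite mulr_le0_ge0// (le_trans ler01 (alpha_ge1 j)).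
  rewrite lerN2; apply: (le_trans _ (progeny_exp_ge_mean theta m j v)).
  by rewrite ler_wnM2l// progeny_mean_le.
move: h; rewrite qsumE -/(g j.+1) -/(be j); lra.
Qed.

(** The linear term keeps its finite horizon; the quadratic one, being nonnegative, is enlarged to
    full mass. *)
Lemma progeny_exp_le_mean theta m j u : theta <= 0 ->
  progeny_exp gam theta m j u <=
    theta * progeny_mean m j u + theta ^+ 2 / 2 * be j.
Proof.
move=> t0; have t2 : 0 <= theta ^+ 2 / 2 by rewrite divr_ge0// sqr_ge0.
elim: m j u => [|m ih] j u /=; first by rewrite mulr1 lerDl mulr_ge0.
rewrite mulrDr mulr1 -addrA lerD2l -convZ//; last exact: cbnd_progeny_mean.
have cm : cbnd (fun v => theta * progeny_mean m j.+1 v).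
  by apply: cbndZ; exact: cbnd_progeny_mean.
have := @le_conv _ (fun v => expR (progeny_exp gam theta m j.+1 v) - 1)
  (fun v => theta * progeny_mean m j.+1 v + theta ^+ 2 / 2 * qsum j.+1) (gam j.+1) u
  (cbnd_expR1 (cbnd_progeny_exp kgam igam _ _ _)) (cbndD cm (cbnd_cst _)) (kgam _)
  (fun v => exp_le_mean_body t0 (ih j.+1 v)).
move=> /le_trans; apply; rewrite convD//; last exact: cbnd_cst.
rewrite lerD2l; apply: (le_trans (conv_le_mass u (cbnd_cst _) (kgam _) (igam _) _ (fun=> lexx _))).
  by rewrite mulr_ge0// qsum_ge0.
by rewrite -(mulrA (theta ^+ 2 / 2)) ler_wpM2l// mulrC.
Qed.

Lemma log_laplace_le_mean theta m t : theta <= 0 ->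
  conv (fun v => expR (progeny_exp gam theta m 0 v) - 1) (gam 0%N) t <=
  theta * conv (progeny_mean m 0) (gam 0%N) t +
  theta ^+ 2 / 2 * qsum 0 * \int[mu]_(s in `[0, t]) gam 0%N s.
Proof.
move=> t0.
have cm : cbnd (fun v => theta * progeny_mean m 0 v).
  by apply: cbndZ; exact: cbnd_progeny_mean.
have := @le_conv _ (fun v => expR (progeny_exp gam theta m 0 v) - 1)
  (fun v => theta * progeny_mean m 0 v + theta ^+ 2 / 2 * qsum 0) (gam 0%N) t
  (cbnd_expR1 (cbnd_progeny_exp kgam igam _ _ _)) (cbndD cm (cbnd_cst _)) (kgam _)
  (fun v => exp_le_mean_body t0 (progeny_exp_le_mean _ _ _ t0)).
move=> /le_trans; apply; rewrite convD//; last exact: cbnd_cst.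
by rewrite convZ ?conv_cst//; exact: cbnd_progeny_mean.
Qed.

(** At nonnegative arguments the second-order Taylor polynomial is a lower bound; its square
    restores the [progeny_mean m j v ^+ 2] subtracted in the hypothesis. *)
Let exp_ge_square_body theta m j v : 0 <= theta ->
  theta * progeny_mean m j v + theta ^+ 2 / 2 * (progeny_square m j v - progeny_mean m j v ^+ 2)
    <= progeny_exp gam theta m j v ->
  theta * progeny_mean m j v + theta ^+ 2 / 2 * progeny_square m j v <=
  expR (progeny_exp gam theta m j v) - 1.
Proof.
move=> t0 h; have h3 := progeny_exp_ge_mean theta m j v.
have A0 : 0 <= theta * progeny_mean m j v.
  by rewrite mulr_ge0// (le_trans ler01 (progeny_mean_ge1 m j v)).
have h1 := expR_ge_taylor2 (le_trans A0 h3).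
have h2 : (theta * progeny_mean m j v) ^+ 2 <= progeny_exp gam theta m j v ^+ 2.
  by apply: lerXn2r; rewrite ?nnegrE// (le_trans A0 h3).
rewrite exprMn in h2; lra.
Qed.

Lemma progeny_exp_ge_square theta m j u : 0 <= theta ->
  theta * progeny_mean m j u + theta ^+ 2 / 2 * (progeny_square m j u - progeny_mean m j u ^+ 2)
    <= progeny_exp gam theta m j u.
Proof.
move=> t0; elim: m j u => [|m ih] j u.
  by rewrite /= expr1n subrr mulr0 addr0 mulr1.
rewrite [progeny_square _ _ _]/= addrAC subrr add0r /= mulrDr mulr1 -addrA lerD2l.
have cm : cbnd (fun v => theta * progeny_mean m j.+1 v).
  by apply: cbndZ; exact: cbnd_progeny_mean.
have cs : cbnd (fun v => theta ^+ 2 / 2 * progeny_square m j.+1 v).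
  by apply: cbndZ; exact: cbnd_progeny_square.
have := @le_conv _ (fun v => theta * progeny_mean m j.+1 v + theta ^+ 2 / 2 * progeny_square m j.+1 v)
  (fun v => expR (progeny_exp gam theta m j.+1 v) - 1) (gam j.+1) u
  (cbndD cm cs) (cbnd_expR1 (cbnd_progeny_exp kgam igam _ _ _)) (kgam _)
  (fun v => exp_ge_square_body t0 (ih j.+1 v)).
apply: le_trans; rewrite convD// !convZ//; first exact: cbnd_progeny_square.
exact: cbnd_progeny_mean.
Qed.

(** The depth [p] of the quadratic term is separate from [m], so it stays fixed when [m] tends to
    infinity. *)
Lemma log_laplace_ge_square theta p m t : 0 <= theta -> (p <= m)%N ->
  theta * conv (progeny_mean m 0) (gam 0%N) t +
  theta ^+ 2 / 2 * conv (progeny_square p 0) (gam 0%N) t <=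
  conv (fun v => expR (progeny_exp gam theta m 0 v) - 1) (gam 0%N) t.
Proof.
move=> t0 pm.
have cm : cbnd (fun v => theta * progeny_mean m 0 v).
  by apply: cbndZ; exact: cbnd_progeny_mean.
have cs : cbnd (fun v => theta ^+ 2 / 2 * progeny_square p 0 v).
  by apply: cbndZ; exact: cbnd_progeny_square.
rewrite -convZ//; last exact: cbnd_progeny_mean.
rewrite -convZ//; last exact: cbnd_progeny_square.
rewrite -convD//; apply: le_conv => //; first exact: cbndD.
  by apply: cbnd_expR1; exact: cbnd_progeny_exp.
move=> v; apply: (le_trans _ (exp_ge_square_body t0 (progeny_exp_ge_square _ _ _ t0))).
rewrite lerD2l ler_wpM2l ?divr_ge0 ?sqr_ge0//.
exact: progeny_square_le_depth.
Qed.

(** At infinite age each convolution becomes multiplication by a total mass; depth [m] counts m + 1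
    generations, the root included. *)
Lemma progeny_mean_cvg m j :
  progeny_mean m j u @[u --> +oo] --> wsum (intg gam) (fun=> 1) m.+1 j.
Proof.
elim: m j => [|m ih] j /=; first by rewrite mulr0 addr0; exact: cvg_cst.
apply: cvgD; first exact: cvg_cst.
by rewrite mulrC; apply: conv_cvg_pinfty => //; exact: cbnd_progeny_mean.
Qed.

(** Limit of [progeny_square m j] at infinite age. *)
Let square_lim := fix square_lim (m j : nat) : R :=
  match m with
  | 0%N => 1
  | m'.+1 => wsum (intg gam) (fun=> 1) m.+1 j ^+ 2 + intg gam j.+1 * square_lim m' j.+1
  end.

Let progeny_square_cvg m j : progeny_square m j u @[u --> +oo] --> square_lim m j.
Proof.
elim: m j => [|m ih] j; first exact: cvg_cst.
apply: cvgD.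
  have c := @progeny_mean_cvg m.+1 j.
  rewrite expr2; under eq_fun do rewrite expr2.
  exact: (cvgM c c).
by rewrite mulrC; apply: conv_cvg_pinfty => //; exact: cbnd_progeny_square.
Qed.

Let square_lim_ge0 m j : 0 <= square_lim m j.
Proof.
elim: m j => [|m ih] j; first exact: ler01.
by rewrite [square_lim _ _]/= addr_ge0 ?sqr_ge0// mulr_ge0.
Qed.

Let square_lim_ge n j (e : R) : 0 < e ->
  exists m, wsum (intg gam) (fun i => alpha i ^+ 2) n j - e <= square_lim m j.
Proof.
(* Strengthened to all large m, so that the two conditions of the inductive step can be met
   together; since g <= 1 the error of the tail is not amplified. *)
suff H e' : 0 < e' -> \forall m \near \oo, wsum (intg gam) (fun i => alpha i ^+ 2) n j - e' <= square_lim m j.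
  by move=> e0; have := H _ e0 => -[m _ /(_ m (leqnn m)) h]; exists m.
elim: n j e' => [|n ih] j e' e0.
  apply: nearW => m; rewrite /= sub0r (le_trans _ (square_lim_ge0 m j))//.
  by rewrite oppr_le0 ltW.
have ca : wsum (intg gam) (fun=> 1) m j ^+ 2 @[m --> \oo] --> alpha j ^+ 2.
  have c1 : wsum (intg gam) (fun=> 1) m j @[m --> \oo] --> alpha j.
    exact: (wsum_cvg g_ge0 gam_rho rho1 (fun=> ler01) (fun=> lexx 1)).
  by rewrite expr2; under eq_fun do rewrite expr2; exact: (cvgM c1 c1).
have e2 : 0 < e' / 2 by rewrite divr_gt0.
have h1 : \forall m \near \oo, alpha j ^+ 2 - e' / 2 <= wsum (intg gam) (fun=> 1) m j ^+ 2.
  by have /cvgr_ge := ca; apply; rewrite ltrBlDr ltrDl.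
have [N1 _ h2] := h1; have [N2 _ h3] := ih j.+1 _ e2.
exists (N1 + N2).+1 => // m /= mN.
case: m mN => // m mN.
have mN1 : (N1 <= m)%N by rewrite (leq_trans (leq_addr _ _) mN).
have mN2 : (N2 <= m)%N by rewrite (leq_trans (leq_addl _ _) mN).
have {}h2 := h2 m.+2 (leqW (leqW mN1)).
have {}h3 := h3 m mN2.
move: h2 h3 => /= h2 h3.
have h4 := ler_wpM2l (g_ge0 j) h3.
have h5 : g j.+1 * (e' / 2) <= e' / 2.
  by apply: ler_piMl; [exact: ltW|exact: le_trans (gam_rho j) (ltW rho1)].
rewrite /g in h4 h5; lra.
Qed.

Lemma progeny_square_near (l : R) : l < qsum 0 ->
  exists p U, 0 <= U /\ forall v, U <= v -> l <= progeny_square p 0 v.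
Proof.
(* Three approximations cost [e] each: the partial sum of [qsum], the depth [p] and the age [U]. *)
move=> lq; pose e := (qsum 0 - l) / 4.
have e0 : 0 < e by rewrite divr_gt0// subr_gt0.
have cq : wsum (intg gam) (fun i => alpha i ^+ 2) n 0 @[n --> \oo] --> qsum 0.
  exact: (wsum_cvg g_ge0 gam_rho rho1 alpha2_ge0 alpha2_le).
have [n _ hn] : \forall n \near \oo, qsum 0 - e <= wsum (intg gam) (fun i => alpha i ^+ 2) n 0.
  by have /cvgr_ge := cq; apply; rewrite ltrBlDr ltrDl.
have [p hp] := square_lim_ge n 0 e0.
have cp := @progeny_square_cvg p 0.
have [U [_ hU]] : \forall v \near +oo, square_lim p 0 - e <= progeny_square p 0 v.
  by have /cvgr_ge := cp; apply; rewrite ltrBlDr ltrDl.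
exists p, (`|U| + 1); split; first by rewrite addr_ge0.
move=> v Uv; have := hU v (lt_le_trans _ Uv).
rewrite (le_lt_trans (ler_norm U)) ?ltrDl// => /(_ isT) h.
have := hn n (leqnn n); rewrite /= /e in h hp *; lra.
Qed.

(** * Mean cluster size through iterated convolutions *)

Lemma iconv_ge0 p s : 0 <= s -> (0 <= iconv gam p s)%E.
Proof.
case: p => [|p] s0; first by rewrite lee_fin; have [_ + _] := kgam 1; exact.
elim: p s s0 => [|p ih] s s0.
  by apply: econv_ge0 => // r r0; rewrite lee_fin; have [_ + _] := kgam 1; exact.
by apply: econv_ge0 => // r r0; exact: ih.
Qed.

Lemma measurable_iconv p : measurable_fun (`[0, +oo[ : set R) (iconv gam p).
Proof.
elim: p => [|p ih]; first by apply/measurable_EFinP; have [] := kgam 1.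
by apply: measurable_econv => // s s0; exact: iconv_ge0.
Qed.

Let measurable_iconvS p (D' : set R) : measurable D' -> D' `<=` `[0, +oo[ ->
  measurable_fun D' (iconv gam p).
Proof. by move=> mD' sub; exact: measurable_funS (measurable_iconv p). Qed.

Let Iq q u : \bar R := (\int[mu]_(s in `[0%R, u]) iconv gam q s)%E.

Let Iq_ge0 q u : (0 <= Iq q u)%E.
Proof. by apply: integral_ge0 => s /=; rewrite in_itv/= => /andP[s0 _]; exact: iconv_ge0. Qed.

(** [iconv gam q] is the density of the birth ages of generation q + 1 in a cluster. Induction on
    [p] peels generations off the mean, with one use of [conv_econv] each. *)
Let mean_expand p r u :
  ((progeny_mean (p + r).+1 0 u)%:E = 1 + \sum_(0 <= q < p) Iq q u +
   \int[mu]_(s in `[0%R, u]) ((progeny_mean r p.+1 (u - s))%:E * iconv gam p s))%E.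
Proof.
elim: p r => [|p ih] r.
  rewrite big_geq// adde0 add0n [progeny_mean _ _ _]/= EFinD; congr (_ + _)%E.
  rewrite /conv /Rintegral fineK//; last first.
    by apply: integrable_fin_num => //; apply: conv_integrable => //; exact: cbnd_progeny_mean.
have assoc (x y z w : \bar R) : (x + (y + z) + w = (x + y) + (z + w))%E by rewrite !addeA.
rewrite addSnnS ih big_nat_recr//= assoc; congr (_ + _)%E.
have mm f : cbnd f -> measurable_fun (`[0, u] : set R) (fun s => (f (u - s))%:E * iconv gam p s)%E.
  move=> cf; apply: emeasurable_funM; last by apply: measurable_iconvS => //; exact: itv0c_sub.
  apply/measurable_EFinP; apply: measurable_funTS; apply: measurableT_comp.
    exact: cbnd_measurable.
  exact: measurable_funB.
have cc : cbnd (conv (progeny_mean r p.+2) (gam p.+2)).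
  by apply: cbnd_conv => //; exact: cbnd_progeny_mean.
transitivity (\int[mu]_(s in `[0%R, u]) (iconv gam p s +
    (conv (progeny_mean r p.+2) (gam p.+2) (u - s))%:E * iconv gam p s))%E.
  apply: eq_integral => s; rewrite inE /= in_itv/= => /andP[s0 _].
  rewrite EFinD ge0_muleDl ?mul1e// lee_fin.
  apply: conv_ge0; first exact: cbnd_progeny_mean.
  by move=> v; exact: le_trans ler01 (progeny_mean_ge1 _ _ _).
rewrite ge0_integralD//; last 4 first.
- by move=> s /=; rewrite in_itv/= => /andP[s0 _]; exact: iconv_ge0.
- by apply: measurable_iconvS => //; exact: itv0c_sub.
- move=> s /=; rewrite in_itv/= => /andP[s0 _]; rewrite mule_ge0 ?iconv_ge0// lee_fin.
  apply: conv_ge0; first exact: cbnd_progeny_mean.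
  by move=> v; exact: le_trans ler01 (progeny_mean_ge1 _ _ _).
- exact: mm.
congr (_ + _)%E; apply: conv_econv => //.
- exact: cbnd_progeny_mean.
- by move=> v; exact: le_trans ler01 (progeny_mean_ge1 _ _ _).
- exact: measurable_iconv.
- by move=> s s0; exact: iconv_ge0.
Qed.

Lemma progeny_mean_iconv m u :
  ((progeny_mean m 0 u)%:E =
   1 + \sum_(0 <= q < m) \int[mu]_(s in `[0%R, u]) iconv gam q s)%E.
Proof.
case: m => [|p]; first by rewrite big_geq// adde0.
have := mean_expand p 0 u; rewrite addn0 => ->; rewrite big_nat_recr//=.
by under eq_integral do rewrite mul1e; rewrite -(addeA 1%E).
Qed.

(** Expected number of descendants of an immigrant born at age [u] or later, possibly infinite; the
    tail in hypothesis (iii). *)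
Let Psi u : \bar R := (\int[mu]_(s in `[u, +oo[) (\sum_(0 <= p <oo) iconv gam p s))%E.

(** [0, v] is covered by [0, u] and [u, +oo); the correction [Psi u] involves neither [v] nor
    [m]. *)
Let mean_increment m (u v : R) : 0 <= u ->
  ((progeny_mean m 0 v)%:E <= (progeny_mean m 0 u)%:E + Psi u)%E.
Proof.
move=> u0.
have sub : `[u, +oo[%classic `<=` (`[0, +oo[ : set R).
  by move=> s /=; rewrite !in_itv/= !andbT; exact: le_trans.
have ge0u s : `[u, +oo[%classic s -> forall q, (0 <= iconv gam q s)%E.
  by move=> /sub /=; rewrite in_itv/= andbT => s0 q; exact: iconv_ge0.
rewrite !progeny_mean_iconv -(addeA 1%E) leeD2l//.
apply: (@le_trans _ _ (\sum_(0 <= q < m) Iq q u +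
    \sum_(0 <= q < m) \int[mu]_(s in `[u, +oo[) iconv gam q s)%E).
  rewrite -big_split /=; apply: lee_sum => q _.
  apply: (@le_trans _ _ (\int[mu]_(s in `[0%R, u] `|` `[u, +oo[) iconv gam q s)%E).
    apply: ge0_subset_integral => //; first exact: measurableU.
    - apply: measurable_iconvS; first exact: measurableU.
      by move=> s [/itv0c_sub//|/sub].
    - move=> s [|/ge0u//]; rewrite /= in_itv/= => /andP[s0 _]; exact: iconv_ge0.
    - move=> s /=; rewrite !in_itv/= => /andP[s0 sv]; rewrite s0 andbT.
      by have [su|us] := leP s u; [left|right; rewrite ltW].
  rewrite (_ : `[0%R, u] `|` `[u, +oo[ = `[0%R, u] `|` `]u, +oo[)%classic; last first.
    apply/seteqP; split=> s /=; rewrite !in_itv/= !andbT.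
      move=> [h|]; first by left.
      by rewrite le_eqVlt => /predU1P[<-|us]; [left; rewrite u0 lexx|right].
    by move=> [h|/ltW us]; [left|right].
  rewrite ge0_integral_setU//.
  - rewrite leeD2l// ; apply: ge0_subset_integral => //.
    + exact: measurable_iconvS.
    + by move=> s /ge0u.
    + by move=> s /=; rewrite !in_itv/= !andbT; exact: ltW.
  - apply: measurable_iconvS; first exact: measurableU.
    move=> s [/itv0c_sub//|/=]; rewrite !in_itv/= !andbT => us.
    by rewrite ltW// (le_lt_trans u0 us).
  - move=> s [|]; rewrite /= in_itv/= ?andbT.
      by move=> /andP[s0 _]; exact: iconv_ge0.
    by move=> us; apply: iconv_ge0; rewrite ltW// (le_lt_trans u0 us).
  - rewrite disj_set2E; apply/eqP/seteqP; split=> // s /=; rewrite !in_itv/= andbT.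
    by move=> [/andP[_ su]]; rewrite ltNge su.
rewrite leeD2l// -ge0_integral_sum//; last 2 first.
- by move=> q; exact: measurable_iconvS.
- by move=> q s /ge0u.
apply: ge0_le_integral => //.
- by move=> s su; apply: sume_ge0 => q _; exact: ge0u.
- by apply: emeasurable_sum => q; exact: measurable_iconvS.
- by apply: ge0_emeasurable_sum => [q s su _|q _]; [exact: ge0u|exact: measurable_iconvS].
- move=> s su; rewrite big_mkord; apply: (le_trans _ (nneseries_lim_ge m _)).
    by rewrite big_mkord.
  by move=> q _ _; exact: ge0u.
Qed.

(** The limit of [mean_increment] as v tends to infinity. *)
Let wsum_le_mean m (u : R) : 0 <= u ->
  ((wsum (intg gam) (fun=> 1) m.+1 0)%:E <= (progeny_mean m 0 u)%:E + Psi u)%E.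
Proof.
move=> u0; have h := fun v => mean_increment m v u0.
rewrite leNgt; apply/negP; case E : (_ + _)%E h => [r| |] // h.
  rewrite lte_fin => rw.
  have c := @progeny_mean_cvg m 0.
  have hr : \forall v \near +oo, r < progeny_mean m 0 v by have /cvgr_gt := c; apply.
  have [v rv] := filter_ex hr.
  by have := h v; rewrite lee_fin leNgt rv.
by have := h 0; rewrite leeNy_eq.
Qed.

(** Past some [T] the tail is below 1 / sqrt u and k + 1 <= 4 u; before [T] the defect is at most
    [K] and sqrt (k + 1) <= T + 1. The constant adds the two cases. *)
Lemma mean_defect_le : ((Num.sqrt t)%:E * Psi t)%E @[t --> +oo] --> 0%E ->
  exists2 C : R, 0 <= C & forall m k u, k%:R <= u ->
    wsum (intg gam) (fun=> 1) m.+1 0 - progeny_mean m 0 u <= C / Num.sqrt k.+1%:R.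
Proof.
move=> psi0.
have [T0 [_ hT]] : \forall t \near +oo, ((Num.sqrt t)%:E * Psi t < 1%:E)%E.
  have /fine_cvgP[fin cvf] := psi0.
  have lt1 : \forall t \near +oo, (fine \o (fun t => (Num.sqrt t)%:E * Psi t)%E) t < 1.
    by have /cvgr_lt := cvf; apply.
  by apply: filterS2 fin lt1 => t fint /= h; rewrite -(fineK fint) lte_fin.
pose T := `|T0| + 1.
have T_ge1 : 1 <= T by rewrite /T lerDr.
have C0 : 0 <= 2 + K * (T + 1).
  by rewrite addr_ge0// mulr_ge0 ?(ltW K_gt0)// addr_ge0// (le_trans ler01).
exists (2 + K * (T + 1)) => // m k u ku.
have u0 : 0 <= u by exact: le_trans ku.
have sk0 : 0 < Num.sqrt k.+1%:R :> R by rewrite sqrtr_gt0.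
rewrite ler_pdivlMr//.
have [Tu|uT] := leP T u.
  have Tu0 : T0 < u by rewrite (lt_le_trans _ Tu)// (le_lt_trans (ler_norm _))// ltrDl.
  have u1 : 1 <= u by exact: le_trans Tu.
  have su0 : 0 < Num.sqrt u by rewrite sqrtr_gt0 (lt_le_trans ltr01).
  have P0 : (0 <= Psi u)%E.
    apply: integral_ge0 => s /=; rewrite in_itv/= andbT => us.
    by apply: nneseries_ge0 => q _ _; apply: iconv_ge0; exact: le_trans us.
  have := wsum_le_mean m u0; have := hT u Tu0.
  move: P0; case: (Psi u) => [r| |] //; last first.
    by move=> _; rewrite gt0_muley// lte_fin.
  rewrite lee_fin => r0; rewrite -EFinM lte_fin => sr; rewrite -EFinD lee_fin => wr.
  apply: (@le_trans _ _ (r * Num.sqrt k.+1%:R)).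
    by apply: ler_wpM2r; [exact: ltW|lra].
  apply: (@le_trans _ _ (r * (2 * Num.sqrt u))).
    apply: ler_wpM2l => //.
    have -> : 2 * Num.sqrt u = Num.sqrt (4 * u).
      rewrite sqrtrM//; congr (_ * _).
      by rewrite (_ : 4 = 2 ^+ 2) ?sqrtr_sqr ?ger0_norm//; ring.
    by rewrite ler_wsqrtr// -addn1 natrD; lra.
  have KT : 0 <= K * (T + 1).
    by rewrite mulr_ge0 ?(ltW K_gt0)// addr_ge0// (le_trans ler01).
  have -> : r * (2 * Num.sqrt u) = 2 * (Num.sqrt u * r) by ring.
  lra.
apply: (@le_trans _ _ (K * (T + 1))); last by rewrite lerDr.
apply: (@le_trans _ _ (K * Num.sqrt k.+1%:R)).
  apply: ler_wpM2r; first exact: ltW.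
  have h1 := le_trans (wsum_le_wlim g_ge0 gam_rho rho1 (fun=> ler01) (fun=> lexx 1) m.+1 0) (alpha_le 0).
  have := progeny_mean_ge1 m 0 u; lra.
rewrite ler_wpM2l ?(ltW K_gt0)//.
have k1 : 1 <= k.+1%:R :> R by rewrite ler1n.
apply: (@le_trans _ _ k.+1%:R).
  rewrite -[leRHS]ger0_norm// -sqrtr_sqr ler_wsqrtr// expr2 ler_peMr//.
by rewrite -addn1 natrD lerD2r (le_trans ku)// ltW.
Qed.

(** * Mean count with immigration *)

Section immigration.
Variable g0 : R.
Hypothesis g0_ge0 : 0 <= g0.
Let Gam t : R := \int[mu]_(s in `[0, t]) gam 0%N s.
Hypothesis Gam_near : \forall t \near +oo, `|Gam t - g0 * t| <= Num.sqrt t.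
Variable C : R.
Hypothesis C_ge0 : 0 <= C.
Hypothesis defect_le : forall m k u, k%:R <= u ->
  wsum (intg gam) (fun=> 1) m.+1 0 - progeny_mean m 0 u <= C / Num.sqrt k.+1%:R.

Let Gam_ge0 t : 0 <= Gam t. Proof. exact: Rintegral_kernel_ge0. Qed.

(** Mean lost by stopping at age [v], written as a sum so that the linearity lemmas of [conv]
    apply. *)
Let defect m v : R := wsum (intg gam) (fun=> 1) m.+1 0 + (-1) * progeny_mean m 0 v.

Let cbnd_defect m : cbnd (defect m).
Proof.
apply: cbndD; first exact: cbnd_cst.
by apply: cbndM; [exact: cbnd_cst|exact: cbnd_progeny_mean].
Qed.

Let J m t x : R := \int[mu]_(s in `[0, x]) (defect m (t - s) * gam 0%N s).

Let defect_integrable m t x :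
  mu.-integrable `[0, x] (EFin \o (fun s => defect m (t - s) * gam 0%N s)).
Proof.
have [_ [B hB]] := cbnd_defect m; have [_ ge0 _] := kgam 0.
apply: le_integrable (kernel_integrableZ B x (kgam 0)) => //.
  by apply/measurable_EFinP; apply: measurable_conv_body => //; exact: itv0c_sub.
move=> s /=; rewrite in_itv/= => /andP[s0 _].
rewrite lee_fin normrM normrM; apply: ler_wpM2r => //.
exact: le_trans (hB _) (ler_norm _).
Qed.

(** [c - defect m (t - s)] is nonnegative on all of [0, x], so its integral against [gam 0] is
    monotone in the upper limit. *)
Let block m (t c x y : R) : y <= x ->
  (forall s, 0 <= s -> s <= x -> defect m (t - s) <= c) ->
  J m t x - J m t y <= c * (Gam x - Gam y).
Proof.
move=> yx dc; have [_ ge0 ig0] := kgam 0.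
have ic z' : mu.-integrable `[0, z'] (EFin \o (fun s => c * gam 0%N s)).
  exact: kernel_integrableZ.
have E z' : c * Gam z' - J m t z' =
    \int[mu]_(s in `[0, z']) (c * gam 0%N s - defect m (t - s) * gam 0%N s).
  by rewrite RintegralB// RintegralZl//; exact: ig0.
suff : c * Gam y - J m t y <= c * Gam x - J m t x by lra.
have ib z' : mu.-integrable `[0, z']
    (EFin \o (fun s => c * gam 0%N s - defect m (t - s) * gam 0%N s)).
  by have := integrableB _ (ic z') (defect_integrable m t z'); exact.
rewrite !E /Rintegral; apply: fine_le; try by apply: integrable_fin_num.
apply: ge0_subset_integral => //.
- exact: measurable_int (ib x).
- move=> s /=; rewrite in_itv/= => /andP[s0 sx].
  by rewrite lee_fin -mulrBl mulr_ge0 ?ge0// subr_ge0 dc.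
- move=> s /=; rewrite !in_itv/= => /andP[-> sy]; exact: le_trans yx.
Qed.

(* Cut [0, t] into unit blocks counted backwards from [t]: on the [k]-th one the defect is
   at most [C / sqrt (k + 1)], and a summation by parts replaces the mass of [gam 0] on the
   blocks by its linear growth rate. *)
Lemma mean_count_ge : exists C' T, forall m t, T <= t ->
  wsum (intg gam) (fun=> 1) m.+1 0 * Gam t - C' * Num.sqrt t <=
  conv (progeny_mean m 0) (gam 0%N) t.
Proof.
have [T0 [_ hT0]] := Gam_near.
pose T := `|T0| + 1.
have T1 : 1 <= T by rewrite lerDr.
have hT t : T <= t -> `|Gam t - g0 * t| <= Num.sqrt t.
  move=> Tt; apply: hT0; apply: (lt_le_trans _ Tt).
  by rewrite (le_lt_trans (ler_norm _))// ltrDl.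
pose C3 := 2 + g0 * T.
have C30 : 0 <= C3 by rewrite addr_ge0// mulr_ge0// (le_trans ler01).
exists (C * C3 + 4 * g0 * C), T => m t Tt.
have t1 : 1 <= t by exact: le_trans Tt.
have t0 : 0 <= t by exact: le_trans t1.
have st1 : 1 <= Num.sqrt t by rewrite -sqrtr1 ler_wsqrtr.
pose f k : R := C / Num.sqrt k.+1%:R.
have f0 k : 0 <= f k by rewrite divr_ge0// sqrtr_ge0.
have fni : nonincreasing_seq f.
  move=> i j ij; rewrite /f ler_wpM2l// lef_pV2 ?posrE ?sqrtr_gt0//.
  by rewrite ler_wsqrtr// ler_nat.
pose dd k : R := Gam t - Gam (t - k%:R).
have dd_le k : dd k <= C3 * Num.sqrt t + g0 * k%:R.
  have := hT t Tt; rewrite ler_distl => /andP[_ h1].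
  have h2 : g0 * (t - k%:R) - (g0 * T + 1) * Num.sqrt t <= Gam (t - k%:R).
    have gT : 0 <= g0 * T by rewrite mulr_ge0// (le_trans ler01).
    have [Tk|kT] := leP T (t - k%:R).
      have := hT _ Tk; rewrite ler_distl => /andP[h3 _].
      have h4 : Num.sqrt (t - k%:R) <= Num.sqrt t by rewrite ler_wsqrtr// gerBl.
      have h5 : 0 <= g0 * T * Num.sqrt t by rewrite mulr_ge0// sqrtr_ge0.
      lra.
    apply: (le_trans _ (Gam_ge0 _)).
    have h5 : g0 * (t - k%:R) <= g0 * T by rewrite ler_wpM2l// ltW.
    have h6 : g0 * T <= g0 * T * Num.sqrt t by rewrite ler_peMr.
    lra.
  rewrite /dd /C3; lra.
have step_sum n : J m t t <= J m t (t - n%:R) + \sum_(0 <= k < n) f k * (dd k.+1 - dd k).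
  elim: n => [|n ih]; first by rewrite big_geq// subr0 addr0.
  rewrite big_nat_recr//=; apply: (le_trans ih).
  rewrite [_ + f n * _]addrC addrA lerD2r.
  have nE : n.+1%:R = n%:R + 1 :> R by rewrite -addn1 natrD.
  have h : t - n.+1%:R <= t - n%:R by rewrite nE; lra.
  have : J m t (t - n%:R) - J m t (t - n.+1%:R) <= f n * (Gam (t - n%:R) - Gam (t - n.+1%:R)).
    apply: block => // s s0 sn; rewrite /defect mulN1r; apply: defect_le.
    by rewrite lerBrDr addrC -lerBrDr.
  by rewrite /dd; lra.
(* As [t < n], the blocks exhaust [0, t] and the remaining integral is over an empty interval;
   [n <= t + 1] keeps the sum of the weights of order sqrt t. *)
pose n := (Num.truncn t).+1.
have tn : t < n%:R by exact: truncnS_gt.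
have nt : n%:R <= t + 1.
  by rewrite /n -addn1 natrD lerD2r; have /andP[] := truncn_itv t0.
have := step_sum n.
have -> : J m t (t - n%:R) = 0.
  by rewrite /J set_itv_ge ?Rintegral_set0// bnd_simp -ltNge subr_lt0.
have dd0 : dd 0%N = 0 by rewrite /dd subr0 subrr.
have := @abel_sum_le R f dd (C3 * Num.sqrt t) g0 n fni f0 dd0 dd_le.
have -> : J m t t = wsum (intg gam) (fun=> 1) m.+1 0 * Gam t -
    conv (progeny_mean m 0) (gam 0%N) t.
  rewrite -[J m t t]/(conv (defect m) (gam 0%N) t) /defect convD//; last 2 first.
  - exact: cbnd_cst.
  - by apply: cbndM; [exact: cbnd_cst|exact: cbnd_progeny_mean].
  rewrite conv_cst// convZ//; last exact: cbnd_progeny_mean.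
  by rewrite mulN1r.
have fs : \sum_(0 <= k < n) f k <= C * (4 * Num.sqrt t).
  rewrite /f -mulr_sumr ler_wpM2l//; apply: (le_trans (sum_inv_sqrt_le R n)).
  have -> : 4 * Num.sqrt t = 2 * Num.sqrt (4 * t).
    rewrite sqrtrM// (_ : 4 = 2 ^+ 2 :> R) ?sqrtr_sqr ?ger0_norm//; ring.
  by rewrite ler_wpM2l// ler_wsqrtr//; lra.
have f00 : f 0%N = C by rewrite /f sqrtr1 divr1.
have := ler_wpM2l g0_ge0 fs; rewrite f00; lra.
Qed.

End immigration.

End progeny_bounds.

(** * Passage to the limit and scaling *)

Section series_laplace.
Context {d : measure_display} {T : measurableType d} {R : realType}.
Variables (P : probability T R) (u : nat -> T -> R).
Hypothesis u_ge0 : forall n w, 0 <= u n w.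
Hypothesis mu_ : forall n, measurable_fun setT (u n).

Let X w := (\sum_(0 <= n <oo) (u n w)%:E)%E.
Let S M w : R := \sum_(0 <= j < M.+1) u j w.

Let X_ge0 w : (0 <= X w)%E.
Proof. by apply: nneseries_ge0 => n _ _; rewrite lee_fin. Qed.

Let S_ge0 M w : 0 <= S M w. Proof. exact: sumr_ge0. Qed.

Let S_nd w : {homo S^~ w : n m / (n <= m)%N >-> n <= m}.
Proof. by apply/nondecreasing_seqP => n; rewrite /S [leRHS]big_nat_recr//= lerDl. Qed.

Let mS M : measurable_fun setT (S M).
Proof. exact: measurable_sum. Qed.

Let S_cvgX w : (S M w)%:E @[M --> \oo] --> X w.
Proof.
have := @is_cvg_nneseries R (fun n => (u n w)%:E) xpredT 0.
move=> h; have {}h : cvgn (fun n => \sum_(0 <= i < n) (u i w)%:E)%E.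
  by apply: h => n _ _; rewrite lee_fin.
by move: h; rewrite -cvg_shiftS /=; under eq_fun do rewrite sumEFin.
Qed.

Lemma measurable_series : measurable_fun setT X.
Proof.
apply: ge0_emeasurable_sum => [k x _ _|k _]; first by rewrite lee_fin.
exact/measurable_EFinP.
Qed.

Let Y w := fine (X w).

Let mY : measurable_fun setT Y.
Proof. by apply: measurableT_comp => //; exact: measurable_series. Qed.

Let S_cvgY w : X w \is a fin_num -> S M w @[M --> \oo] --> Y w.
Proof. move=> /fineK Xw; have := S_cvgX (w := w); rewrite -Xw => /fine_cvg; exact. Qed.

Variables (th0 B : R).
Hypothesis th0_gt0 : 0 < th0.
Hypothesis S_laplace : forall M, (\int[P]_w (expR (th0 * S M w))%:E <= B%:E)%E.

Let f (th : R) M w : \bar R := (expR (th * S M w))%:E.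

Let mf th M : measurable_fun setT (f th M).
Proof.
by apply/measurable_EFinP; apply: measurableT_comp => //; exact: measurable_funM.
Qed.

Let f_nd th w : 0 <= th -> {homo (f th)^~ w : n m / (n <= m)%N >-> (n <= m)%E}.
Proof. by move=> th_ge0 n m nm; rewrite lee_fin ler_expR ler_wpM2l// S_nd. Qed.

(** By monotone convergence the limit of expR (th0 S M) has expectation at most [B], hence is almost
    surely finite, and it dominates every [th0 * S M w]. *)
Lemma series_ae_fin_num : {ae P, forall w, X w \is a fin_num}.
Proof.
have f0 n w : setT w -> (0 <= f th0 n w)%E by rewrite lee_fin expR_ge0.
have mcv := @cvg_monotone_convergence _ _ _ P _ measurableT _ (mf th0) f0
  (fun w _ => @f_nd th0 w (ltW th0_gt0)).
set g := fun w => limn ((f th0)^~ w).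
have cf w : cvgn ((f th0)^~ w) by apply: ereal_nondecreasing_is_cvgn; apply: f_nd; exact: ltW.
have mg : measurable_fun setT g.
  exact: (emeasurable_fun_cvg (f th0)).
have g0 w : (0 <= g w)%E by apply: lime_ge => //; apply: nearW => n; exact: f0.
have ig : P.-integrable setT g.
  apply/integrableP; split => //; rewrite (eq_integral g); last first.
    by move=> w _; rewrite gee0_abs.
  apply: (@le_lt_trans _ _ B%:E); last exact: ltry.
  rewrite -(cvg_lim _ mcv)//; apply: lime_le; last exact: nearW.
  exact: cvgP mcv.
have := integrable_ae measurableT ig; apply: filterS => w /(_ I) gw.
rewrite ge0_fin_numE//.
have le_g M : (S M w <= fine (g w) / th0)%R.
  rewrite ler_pdivlMr// mulrC.
  apply: (@le_trans _ _ (expR (th0 * S M w))).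
    by have := expR_ge1Dx (th0 * S M w); lra.
  rewrite -lee_fin fineK//; apply: lime_ge => //.
  by exists M => // n /= Mn; apply: f_nd => //; exact: ltW.
apply: (@le_lt_trans _ _ (fine (g w) / th0)%:E); last exact: ltry.
rewrite -(cvg_lim _ (S_cvgX (w := w)))//.
apply: lime_le; first exact: cvgP (S_cvgX (w := w)).
by apply: nearW => M; rewrite lee_fin.
Qed.

(** Monotone convergence for [0 <= th], where the limit may be infinite; domination by 1 for
    [th <= 0]. *)
Lemma series_laplace_cvg (th : R) :
  (\int[P]_w (expR (th * S M w))%:E)%E @[M --> \oo] -->
  (\int[P]_w (expR (th * fine (X w)))%:E)%E.
Proof.
have mg : measurable_fun setT (fun w => (expR (th * Y w))%:E).
  by apply/measurable_EFinP; apply: measurableT_comp => //; exact: measurable_funM.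
have cvg_f w : X w \is a fin_num -> f th M w @[M --> \oo] --> (expR (th * Y w))%:E.
  move=> Xw; apply: cvg_EFin; first exact: nearW.
  apply: continuous_cvg; first exact: continuous_expR.
  by apply: cvgMr; exact: S_cvgY.
have [th_ge0|/ltW th_le0] := leP 0 th.
  have f0 n w : setT w -> (0 <= f th n w)%E by rewrite lee_fin expR_ge0.
  have cf w : cvgn ((f th)^~ w) by apply: ereal_nondecreasing_is_cvgn; exact: f_nd.
  rewrite (_ : integral _ _ _ = \int[P]_w limn ((f th)^~ w))%E.
    exact: (@cvg_monotone_convergence _ _ _ P _ measurableT _ (mf th) f0 (fun w _ => @f_nd th w th_ge0)).
  apply: ae_eq_integral => //; first exact: (emeasurable_fun_cvg (f th)).
  by have := series_ae_fin_num; apply: filterS => w Xw _; apply/esym/cvg_lim => //; exact: cvg_f.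
have [] := @dominated_convergence _ _ _ P setT measurableT (f th)
  (fun w => (expR (th * Y w))%:E) (cst 1%E) => //.
- by have := series_ae_fin_num; apply: filterS => w Xw _; exact: cvg_f.
- exact: finite_measure_integrable_cst.
- apply: aeW => w n _; rewrite /= ger0_norm ?expR_ge0// lee_fin.
  by rewrite -expR0 ler_expR mulr_le0_ge0.
Qed.

End series_laplace.

(** * Laplace transform of the total count *)

Section total_laplace.
Context {d : measure_display} {T : measurableType d} {R : realType}.
Local Notation mu := (@lebesgue_measure R).
Variables (P : probability T R) (gam : nat -> R -> R) (N : nat -> T -> set R) (rho g0 : R).
Hypothesis hawkesN : is_hawkes P gam N.
Hypothesis kgam : forall n, kernel_on (gam n).
Hypothesis igam : forall n, mu.-integrable `[0, +oo[ (EFin \o gam n.+1).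
Hypothesis gam_rho : forall n, intg gam n.+1 <= rho.
Hypothesis rho1 : rho < 1.

Let g_ge0 n : 0 <= intg gam n.+1.
Proof.
rewrite /intg fine_ge0//; apply: integral_ge0 => s /=.
by rewrite in_itv/= andbT lee_fin; have [_ + _] := kgam n.+1; exact.
Qed.

Let wsum1_cvg j : wsum (intg gam) (fun=> 1) n j @[n --> \oo] --> alpha gam j.
Proof. exact: (wsum_cvg g_ge0 gam_rho rho1 (fun=> ler01) (fun=> lexx 1)). Qed.

Lemma mtotE : mtot g0 gam = g0 * alpha gam 0.
Proof.
apply/cvg_lim => //.
rewrite (_ : (fun n => _) = fun n => g0 * wsum (intg gam) (fun=> 1) n 0); last first.
  apply/funext => n; rewrite wsumE mulr_sumr; apply: eq_bigr => p _.
  by rewrite mul1r addn0.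
by apply: cvgMr; exact: wsum1_cvg.
Qed.

Let alpha2_ge0 j : 0 <= alpha gam j ^+ 2. Proof. exact: sqr_ge0. Qed.

Let alpha2_le j : alpha gam j ^+ 2 <= (1 - rho)^-1 ^+ 2.
Proof.
apply: lerXn2r; rewrite ?nnegrE ?invr_ge0 ?subr_ge0 ?(ltW rho1)//.
  exact: le_trans ler01 (alpha_ge1 kgam gam_rho rho1 j).
exact: (alpha_le kgam gam_rho rho1).
Qed.

(** The inner factor of [sigma2] is [alpha gam j], its leading 1 being the empty product. *)
Lemma sigma2E : sigma2 g0 gam = g0 * qsum gam 0.
Proof.
apply/cvg_lim => //.
rewrite (_ : (fun n => _) =
    fun n => g0 * wsum (intg gam) (fun i => alpha gam i ^+ 2) n 0); last first.
  apply/funext => n; rewrite wsumE mulr_sumr; apply: eq_bigr => j _.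
  rewrite addn0 /mn mulrCA; congr (_ * (_ ^+ 2 * _)).
  suff h : \sum_(1 <= p < Q) \prod_(j.+1 <= i < (p + j).+1) intg gam i
      @[Q --> \oo] --> alpha gam j - 1 by rewrite (cvg_lim _ h)// addrC subrK.
  rewrite -cvg_shiftS /=.
  rewrite (_ : (fun _ => _) = fun n => wsum (intg gam) (fun=> 1) n.+1 j - 1).
    apply: cvgB; last exact: cvg_cst.
    by rewrite (cvg_shiftS (fun n => wsum (intg gam) (fun=> 1) n j)); exact: wsum1_cvg.
  apply/funext => Q; rewrite wsumE [in RHS]big_ltn// add0n [in X in 1 * X]big_geq//.
  rewrite mulr1 [RHS]addrAC subrr add0r.
  by apply: eq_bigr => p _; rewrite mul1r.
by apply: cvgMr; exact: (wsum_cvg g_ge0 gam_rho rho1 alpha2_ge0 alpha2_le).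
Qed.

Let Y t w : R := fine (Ntot N w t).
Let L t th := (\int[P]_w (expR (th * Y t w))%:E)%E.
Let Gam t : R := \int[mu]_(s in `[0, t]) gam 0%N s.
Let Lam m t th := conv (fun v => expR (progeny_exp gam th m 0 v) - 1) (gam 0%N) t.

Let mcnt n a b : measurable_fun setT (fun w => (cnt (N n w) a b)%:R : R).
Proof. by case: hawkesN => _ _ []. Qed.

Let cnt_ge0 n t w : 0 <= (cnt (N n w) 0 t)%:R :> R. Proof. exact: ler0n. Qed.

Let Gam_ge0 t : 0 <= Gam t. Proof. exact: Rintegral_kernel_ge0. Qed.

Let th_max := theta_max rho.

Let th_max_gt0 : 0 < th_max. Proof. exact: theta_max_gt0. Qed.

(** One positive exponent with a bound uniform in the number of generations: it makes the total
    count almost surely finite and justifies the limit in [M]. *)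
Let bound_th_max t : 0 < t -> exists B : R, forall M,
  (\int[P]_w (expR (th_max * \sum_(0 <= j < M.+1) (cnt (N j w) 0 t)%:R))%:E <= B%:E)%E.
Proof.
have th0 : 0 <= th_max by exact: ltW.
have th1 : `|th_max| <= theta_max rho by rewrite ger0_norm.
move=> t0; exists (expR ((th_max * alpha gam 0 + th_max ^+ 2 / 2 * qsum gam 0 +
  laplace_const rho * `|th_max| ^+ 3) * Gam t)) => M.
rewrite (hawkes_laplace hawkesN kgam igam t0) lee_fin ler_expR.
exact: (log_laplace_le kgam igam gam_rho rho1 th1 M t th0).
Qed.

Lemma Ntot_ae_fin_num t : {ae P, forall w, Ntot N w t \is a fin_num}.
Proof.
have [t0|t0] := ltP 0 t.
  have [B hB] := bound_th_max t0.
  exact: (@series_ae_fin_num _ _ _ P (fun n w => (cnt (N n w) 0 t)%:R)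
    (fun n w => cnt_ge0 n t w) (fun n => mcnt n 0 t) _ _ th_max_gt0 hB).
apply: aeW => w; rewrite /Ntot eseries0// => n _ _.
by rewrite /cnt set_itv_ge ?setI0 ?fset_set0 ?cardfs0// bnd_simp -leNgt.
Qed.

Lemma measurable_Ntot t : measurable_fun setT (fun w => Ntot N w t).
Proof. by apply: measurable_series => // n; exact: mcnt. Qed.

Let cvgL t th : 0 < t -> (expR (Lam M t th))%:E @[M --> \oo] --> L t th.
Proof.
move=> t0; have [B hB] := bound_th_max t0.
have := @series_laplace_cvg _ _ _ P (fun n w => (cnt (N n w) 0 t)%:R)
  (fun n w => cnt_ge0 n t w) (fun n => mcnt n 0 t) _ _ th_max_gt0 hB th.
by under eq_fun do rewrite (hawkes_laplace hawkesN kgam igam t0).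
Qed.

Let L_le t th (c : nat -> R) l : 0 < t -> c M @[M --> \oo] --> l ->
  (forall M, Lam M t th <= c M) -> (L t th <= (expR l)%:E)%E.
Proof.
move=> t0 cl Lc.
have cv : (expR (c M))%:E @[M --> \oo] --> (expR l)%:E.
  apply: cvg_EFin; first exact: nearW.
  by apply: continuous_cvg => //; exact: continuous_expR.
rewrite -(cvg_lim _ (@cvgL t th t0))// -(cvg_lim _ cv)//; apply: lee_lim.
- exact: cvgP (@cvgL t th t0).
- exact: cvgP cv.
- by apply: nearW => M; rewrite lee_fin ler_expR.
Qed.

Let L_ge t th (c : nat -> R) l : 0 < t -> c M @[M --> \oo] --> l ->
  (\forall M \near \oo, c M <= Lam M t th) -> ((expR l)%:E <= L t th)%E.
Proof.
move=> t0 cl Lc.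
have cv : (expR (c M))%:E @[M --> \oo] --> (expR l)%:E.
  apply: cvg_EFin; first exact: nearW.
  by apply: continuous_cvg => //; exact: continuous_expR.
rewrite -(cvg_lim _ (@cvgL t th t0))// -(cvg_lim _ cv)//; apply: lee_lim.
- exact: cvgP cv.
- exact: cvgP (@cvgL t th t0).
- by apply: filterS Lc => M; rewrite lee_fin ler_expR.
Qed.

Lemma total_laplace_small t th : 0 < t -> `|th| <= th_max ->
  (0 <= th -> (L t th <= (expR ((th * alpha gam 0 + th ^+ 2 / 2 * qsum gam 0 +
    laplace_const rho * `|th| ^+ 3) * Gam t))%:E)%E) /\
  (th <= 0 -> ((expR ((th * alpha gam 0 + th ^+ 2 / 2 * qsum gam 0 -
    laplace_const rho * `|th| ^+ 3) * Gam t))%:E <= L t th)%E).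
Proof.
move=> t0 th1; split => th0.
  apply: (L_le t0 (@cvg_cst _ _ _ _ _)) => M; exact: (log_laplace_le kgam igam gam_rho rho1).
apply: (L_ge t0 (@cvg_cst _ _ _ _ _)); apply: nearW => M.
exact: (log_laplace_ge kgam igam gam_rho rho1).
Qed.

Hypothesis g0_ge0 : 0 <= g0.
Hypothesis Gam_near : \forall t \near +oo, `|Gam t - g0 * t| <= Num.sqrt t.
Hypothesis tail_cvg : ((Num.sqrt t)%:E * \int[mu]_(s in `[t, +oo[)
   (\sum_(0 <= p <oo) iconv gam p s))%E @[t --> +oo] --> 0%E.

(** [C'] and the threshold in [t] are chosen before [th], [l], [p] and [U], so [th] may later depend
    on [t]. *)
Lemma total_laplace_mean : exists C' : R, \forall t \near +oo,
  (forall th, th <= 0 -> (L t th <= (expR (th * (alpha gam 0 * Gam t - C' * Num.sqrt t) +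
     th ^+ 2 / 2 * qsum gam 0 * Gam t))%:E)%E) /\
  (forall th l p U, 0 <= th -> 0 <= l -> 0 <= U ->
     (forall v, U <= v -> l <= progeny_square gam p 0 v) ->
     ((expR (th * (alpha gam 0 * Gam t - C' * Num.sqrt t) + th ^+ 2 / 2 * (l * Gam (t - U))))%:E
      <= L t th)%E).
Proof.
have [C C0 hC] := mean_defect_le kgam igam gam_rho rho1 tail_cvg.
have [C' [T0 hT]] := mean_count_ge kgam igam g0_ge0 Gam_near C0 hC.
exists C'; near=> t.
have t0 : 0 < t by near: t; exact: nbhs_pinfty_gt.
have T0t : T0 <= t by near: t; apply: nbhs_pinfty_ge; exact: num_real.
have cw c c' : c * (wsum (intg gam) (fun=> 1) M.+1 0 * Gam t - C' * Num.sqrt t) + c'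
    @[M --> \oo] --> c * (alpha gam 0 * Gam t - C' * Num.sqrt t) + c'.
  apply: cvgD; last exact: cvg_cst.
  apply: cvgMr; apply: cvgB; last exact: cvg_cst.
  apply: cvgMl; rewrite (cvg_shiftS (fun n => wsum (intg gam) (fun=> 1) n 0)).
  exact: wsum1_cvg.
split=> [th th0|th l p U th0 l0 U0 hl].
  apply: (L_le t0 (cw _ _)) => M.
  apply: (le_trans (log_laplace_le_mean kgam igam gam_rho rho1 _ _ th0)).
  by rewrite lerD2r ler_wnM2l// hT.
apply: (L_ge t0 (cw _ _)); exists p => // M /= pM.
apply: (le_trans _ (log_laplace_ge_square kgam igam t th0 pM)).
apply: lerD; first by rewrite ler_wpM2l// hT.
rewrite ler_wpM2l ?divr_ge0 ?sqr_ge0//; apply: conv_ge_tail => //.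
- exact: cbnd_progeny_square.
- exact: progeny_square_ge0.
Unshelve. all: by end_near. Qed.

End total_laplace.

(* To be read with [u = a t / t], [v = a t / sqrt t], [s = sqrt t], and [G], [G'] the masses
   of [gam 0] on [0, t] and [0, t - U]. *)
Lemma scaled_exponent_bounds {R : realType} (A C C' g0 q c e e' U u v s t G G' : R) :
  0 <= A -> 0 <= C -> 0 <= g0 -> 0 <= q -> 0 < e -> 0 < e' -> e' <= q -> 0 <= U ->
  0 < u -> u <= 1 -> 1 <= v -> 0 < s -> s <= t -> s * s = t -> u * s = v ->
  c ^+ 2 / 2 * g0 * e' <= e / 3 ->
  `|c| * (A + `|C'|) * v <= e / 3 * v ^+ 2 ->
  (c ^+ 2 / 2 * q * (1 + g0 * U) + C * `|c| ^+ 3 * (g0 + 1)) * u <= e / 3 ->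
  `|G - g0 * t| <= s -> `|G' - g0 * (t - U)| <= s ->
  let th := c * u in
  let lo := v ^+ 2 * (g0 * q * c ^+ 2 / 2 - e) in
  let hi := v ^+ 2 * (g0 * q * c ^+ 2 / 2 + e) in
  let shift := - (th * (g0 * A * t)) in
  let r := C * `|th| ^+ 3 in
  [/\ shift + (th * A + th ^+ 2 / 2 * q + r) * G <= hi,
      lo <= shift + (th * A + th ^+ 2 / 2 * q - r) * G,
      c <= 0 -> shift + (th * (A * G - C' * s) + th ^+ 2 / 2 * q * G) <= hi &
      0 <= c -> lo <= shift + (th * (A * G - C' * s) + th ^+ 2 / 2 * ((q - e') * G'))].
Proof.
move=> A0 C0 g0_ge0 q0 e0 e'0 e'q U0 u0 u1 v1 s0 st sst us e'e K1v K2u Gt Gtu th lo hi shift r.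
have l0 : 0 <= q - e' by rewrite subr_ge0.
have lq : q - e' <= q by rewrite lerBlDr lerDl ltW.
have v0 : 0 <= v by exact: le_trans v1.
have {}K2u := ler_wpM2r (sqr_ge0 v) K2u.
(* The errors have two sizes: [|c| * v], from first-order terms, and [u * v ^+ 2], from second- and
   third-order ones. Each takes a third of [e * v ^+ 2]; the last third pays for replacing [q] by
   [q - e']. *)
have ths : `|th| * s = `|c| * v by rewrite normrM (gtr0_norm u0) -mulrA us.
have th2t : th ^+ 2 * t = c ^+ 2 * v ^+ 2 by rewrite -sst -us /th; ring.
have th2s : th ^+ 2 * s = c ^+ 2 * (u * v) by rewrite -us /th; ring.
have th3t : `|th| ^+ 3 * t = `|c| ^+ 3 * (u * v ^+ 2).
  by rewrite normrM (gtr0_norm u0) -sst -us; ring.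
have uv : u * v <= u * v ^+ 2.
  by rewrite ler_wpM2l ?(ltW u0)// expr2 ler_peMr.
have uu : u ^+ 2 <= u * v ^+ 2.
  by rewrite expr2 ler_wpM2l ?(ltW u0)// (le_trans u1)// exprn_ege1.
have uv0 : 0 <= u * v ^+ 2 by rewrite mulr_ge0 ?sqr_ge0// ltW.
pose D := G - g0 * t.
have GE : G = g0 * t + D by rewrite /D; ring.
have f1 : `|th * D| <= `|c| * v by rewrite -ths normrM ler_wpM2l.
have f2 : `|th ^+ 2 * D| <= c ^+ 2 * (u * v ^+ 2).
  apply: (@le_trans _ _ (c ^+ 2 * (u * v))); last by rewrite ler_wpM2l ?sqr_ge0.
  by rewrite -th2s normrM ger0_norm ?sqr_ge0// ler_wpM2l ?sqr_ge0.
have f3 : `|th| ^+ 3 * G <= `|c| ^+ 3 * (u * v ^+ 2) * (g0 + 1).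
  rewrite -th3t -mulrA ler_wpM2l ?exprn_ge0// GE.
  by move: Gt st; rewrite -/D ler_norml => /andP[_]; clear; lra.
move: f1 f2; rewrite !ler_norml => /andP[f1 f1'] /andP[f2 f2'].
have {f1} f1 := ler_wpM2l A0 f1; have {f1'} f1' := ler_wpM2l A0 f1'.
have {f2} f2 := ler_wpM2l q0 f2; have {f2'} f2' := ler_wpM2l q0 f2'.
have {f3} f3 := ler_wpM2l C0 f3.
have f4 : g0 * q * (th ^+ 2 * t) = g0 * q * (c ^+ 2 * v ^+ 2) by rewrite th2t.
have K2a : 0 <= c ^+ 2 / 2 * q * (g0 * U) * (u * v ^+ 2).
  have := mulr_ge0 (mulr_ge0 (sqr_ge0 c) q0) (mulr_ge0 (mulr_ge0 g0_ge0 U0) uv0).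
  by clear; lra.
have K2b : 0 <= C * `|c| ^+ 3 * (g0 + 1) * (u * v ^+ 2).
  by rewrite mulr_ge0// mulr_ge0 ?addr_ge0// mulr_ge0// exprn_ge0.
have K1a : 0 <= `|c| * v * `|C'| by rewrite !mulr_ge0.
have ev : 0 <= e * v ^+ 2 by rewrite mulr_ge0 ?sqr_ge0// ltW.
have cs : `|th * s * C'| <= `|c| * v * `|C'|.
  by rewrite 2!normrM (gtr0_norm s0) ths.
move: cs; rewrite ler_norml => /andP[cs cs'].
rewrite /shift /lo /hi /r; split => [| |_|c0].
- rewrite GE in f3 *; move: K1v K2u K2a K2b K1a f1' f2' f3 f4 ev; clear; lra.
- rewrite GE in f3 *; move: K1v K2u K2a K2b K1a f1 f2 f3 f4 ev; clear; lra.
- rewrite GE; move: K1v K2u K2a K2b K1a f1' f2' f4 cs cs' ev; clear; lra.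
pose D' := G' - g0 * (t - U).
have GE' : G' = g0 * (t - U) + D' by rewrite /D'; ring.
have g1 : th ^+ 2 * (q - e') * - D' <= c ^+ 2 * (u * v ^+ 2) * q.
  apply: (@le_trans _ _ (th ^+ 2 * (q - e') * s)).
    apply: ler_wpM2l; first by rewrite mulr_ge0 ?sqr_ge0.
    by move: Gtu; rewrite -/D' ler_norml => /andP[+ _]; clear; lra.
  rewrite mulrAC th2s; apply: ler_pM => //.
    by rewrite mulr_ge0 ?sqr_ge0// mulr_ge0// ltW.
  by rewrite ler_wpM2l ?sqr_ge0.
have g2 : th ^+ 2 * (q - e') * (g0 * U) <= c ^+ 2 * q * (g0 * U) * (u * v ^+ 2).
  have -> : th ^+ 2 * (q - e') * (g0 * U) = c ^+ 2 * (g0 * U) * ((q - e') * u ^+ 2).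
    by rewrite /th; ring.
  have -> : c ^+ 2 * q * (g0 * U) * (u * v ^+ 2) = c ^+ 2 * (g0 * U) * (q * (u * v ^+ 2)).
    by ring.
  apply: ler_wpM2l; first by rewrite mulr_ge0 ?sqr_ge0// mulr_ge0.
  by apply: ler_pM => //; exact: sqr_ge0.
have g3 := ler_wpM2r (sqr_ge0 v) e'e.
have g4 : g0 * e' * (th ^+ 2 * t) = g0 * e' * (c ^+ 2 * v ^+ 2) by rewrite th2t.
rewrite GE GE'; move: K1v K2u K2a K2b K1a f1 f2 f4 g1 g2 g3 g4 cs cs' ev; clear; lra.
Qed.

(** * Scaling theta = c a(t) / t *)

Section scaling.
Context {d : measure_display} {T : measurableType d} {R : realType}.
Local Notation mu := (@lebesgue_measure R).
Variables (P : probability T R) (gam : nat -> R -> R) (N : nat -> T -> set R) (rho g0 : R).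
Hypothesis hawkesN : is_hawkes P gam N.
Hypothesis kgam : forall n, kernel_on (gam n).
Hypothesis igam : forall n, mu.-integrable `[0, +oo[ (EFin \o gam n.+1).
Hypothesis gam_rho : forall n, intg gam n.+1 <= rho.
Hypothesis rho1 : rho < 1.

Let Gam t : R := \int[mu]_(s in `[0, t]) gam 0%N s.

Hypothesis g0_ge0 : 0 <= g0.
Hypothesis Gam_near : \forall t \near +oo, `|Gam t - g0 * t| <= Num.sqrt t.
Hypothesis tail_cvg : ((Num.sqrt t)%:E * \int[mu]_(s in `[t, +oo[)
   (\sum_(0 <= p <oo) iconv gam p s))%E @[t --> +oo] --> 0%E.

Variable a : R -> R.
Hypothesis a_gt0 : forall t, 0 < t -> 0 < a t.
Hypothesis a_sqrt : a t / Num.sqrt t @[t --> +oo] --> +oo.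
Hypothesis a_id : a t / t @[t --> +oo] --> 0.

Let m := g0 * alpha gam 0.
Let q := qsum gam 0.
Let b t := a t ^+ 2 / t.
Let Z t w := (fine (Ntot N w t) - m * t) / a t.
Let L t th := (\int[P]_w (expR (th * fine (Ntot N w t)))%:E)%E.

Lemma measurable_scaled t : measurable_fun setT (Z t).
Proof.
apply: measurable_funM => //; apply: measurable_funB => //.
by apply: measurableT_comp => //; exact: measurable_Ntot hawkesN t.
Qed.

(** Since b / a = a / t, the scaled transform is that of the count at [c * (a t / t)], up to the
    centring. *)
Let laplaceE t c : 0 < t ->
  (\int[P]_w (expR (c * b t * Z t w))%:E =
   (expR (- (c * (a t / t) * (m * t))))%:E * L t (c * (a t / t)))%E.
Proof.
move=> t0; have at0 := a_gt0 t0.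
rewrite /L -ge0_integralZl_EFin ?expR_ge0//; last first.
  apply/measurable_EFinP; apply: measurableT_comp => //; apply: measurable_funM => //.
  by apply: measurableT_comp => //; exact: measurable_Ntot hawkesN t.
apply: eq_integral => w _; rewrite -EFinM -expRD; congr (expR _)%:E.
by rewrite /b /Z; field; rewrite !gt_eqF.
Qed.

Lemma speed_pinfty : b t @[t --> +oo] --> +oo.
Proof.
apply/cvgryPge => M; near=> t.
have t0 : 0 < t by near: t; exact: nbhs_pinfty_gt.
have h1 : 1 <= a t / Num.sqrt t by near: t; move/cvgryPge: a_sqrt; exact.
have h2 : M <= a t / Num.sqrt t by near: t; move/cvgryPge: a_sqrt; exact.
have -> : b t = (a t / Num.sqrt t) ^+ 2.
  by rewrite /b expr_div_n sqr_sqrtr// ltW.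
by apply: (le_trans h2); rewrite expr2 ler_peMr// (le_trans ler01).
Unshelve. all: by end_near. Qed.

(** Keeps [q - e'] nonnegative below, where [e' <= 1]. *)
Let q_ge1 : 1 <= q.
Proof.
rewrite /q (qsumE kgam gam_rho rho1) -[1]addr0; apply: lerD.
  by apply: exprn_ege1; exact: alpha_ge1.
rewrite mulr_ge0 ?(qsum_ge0 kgam gam_rho rho1)//.
rewrite /intg fine_ge0//; apply: integral_ge0 => s /=.
by rewrite in_itv/= andbT lee_fin; have [_ + _] := kgam 1; exact.
Qed.

(** The sign of [c] decides which side comes from the barriers and which from the finite-horizon
    moments. *)
Lemma scaled_laplace_near c e : 0 < e -> \forall t \near +oo,
  ((expR (b t * (g0 * q * c ^+ 2 / 2 - e)))%:E <= \int[P]_w (expR (c * b t * Z t w))%:E)%E /\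
  (\int[P]_w (expR (c * b t * Z t w))%:E <= (expR (b t * (g0 * q * c ^+ 2 / 2 + e)))%:E)%E.
Proof.
move=> e0.
have hC := total_laplace_small hawkesN kgam igam gam_rho rho1.
have C0 := laplace_const_ge0 kgam gam_rho rho1; set C := laplace_const rho in hC C0.
have [C' hC'] := total_laplace_mean hawkesN kgam igam gam_rho rho1 g0_ge0 Gam_near tail_cvg.
set A := alpha gam 0 in hC hC' *.
have A0 : 0 <= A by exact: le_trans ler01 (alpha_ge1 kgam gam_rho rho1 0).
have q0 : 0 <= q by exact: le_trans q_ge1.
(* The loss allowed on [q]: at most 1, and worth at most a third of [e] in the exponent. *)
pose e' := e / (2 * (c ^+ 2 * g0 + e)).
have ce : 0 < c ^+ 2 * g0 + e by rewrite ltr_wpDl// mulr_ge0// sqr_ge0.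
have e'0 : 0 < e' by rewrite divr_gt0// mulr_gt0.
have cg0 : 0 <= c ^+ 2 * g0 by rewrite mulr_ge0// sqr_ge0.
have e'1 : e' <= 1 by rewrite ler_pdivrMr ?mulr_gt0// mul1r; lra.
have e'e : c ^+ 2 / 2 * g0 * e' <= e / 3.
  rewrite /e' mulrA ler_pdivrMr ?mulr_gt0//.
  by have := mulr_ge0 (ltW e0) cg0; have := mulr_ge0 (ltW e0) (ltW e0); lra.
have l0 : 0 <= q - e' by rewrite subr_ge0 (le_trans e'1).
have lq : q - e' < q by rewrite ltrBlDr ltrDl.
have [p [U [U0 hU]]] := progeny_square_near kgam igam gam_rho rho1 lq.
(* [K1] collects the errors of order v, beaten by v^2 since v = a / sqrt t tends to infinity; [K2]
   those of order u v^2, beaten since u = a / t tends to 0. *)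
pose K1 := `|c| * (A + `|C'|).
pose K2 := c ^+ 2 / 2 * q * (1 + g0 * U) + C * `|c| ^+ 3 * (g0 + 1).
have K20 : 0 <= K2.
  apply: addr_ge0; apply: mulr_ge0; rewrite ?addr_ge0//.
  - by rewrite mulr_ge0// divr_ge0// sqr_ge0.
  - by rewrite mulr_ge0.
  - by rewrite mulr_ge0// exprn_ge0.
have v_ge r : \forall t \near +oo, r <= a t / Num.sqrt t.
  by move/cvgryPge: a_sqrt; exact.
have u_small r : 0 < r -> \forall t \near +oo, a t / t <= r.
  by move=> r0; move/cvgr_le: a_id; apply.
near=> t.
have t1 : 1 <= t by near: t; apply: nbhs_pinfty_ge; exact: num_real.
have t0 : 0 < t by exact: lt_le_trans t1.
have at0 := a_gt0 t0.
pose s := Num.sqrt t; pose v := a t / s; pose u := a t / t; pose th := c * u.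
have s0 : 0 < s by rewrite sqrtr_gt0.
have sst : s * s = t by rewrite -expr2 sqr_sqrtr// ltW.
have s1 : 1 <= s by rewrite /s -[leLHS]sqrtr1 ler_wsqrtr.
have st : s <= t by rewrite -[leRHS]sst ler_peMr ?(ltW s0).
have u0 : 0 < u by rewrite divr_gt0.
have v0 : 0 < v by rewrite divr_gt0.
have us : u * s = v by rewrite /u /v -sst; field; rewrite gt_eqF.
have v1 : 1 <= a t / Num.sqrt t by near: t; exact: v_ge.
have vK : K1 * 3 / e <= a t / Num.sqrt t by near: t; exact: v_ge.
have u1 : a t / t <= 1 by near: t; exact: u_small.
have uK : a t / t <= e / (3 * (K2 + 1)).
  by near: t; apply: u_small; rewrite divr_gt0 ?mulr_gt0// ltr_wpDl.
have uth : a t / t <= theta_max rho / (`|c| + 1).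
  near: t; apply: u_small; rewrite divr_gt0 ?ltr_wpDl//.
  exact: (theta_max_gt0 kgam gam_rho rho1).
have Gt : `|Gam t - g0 * t| <= Num.sqrt t by near: t; exact: Gam_near.
have Gtu : `|Gam (t - U) - g0 * (t - U)| <= s.
  suff : `|Gam (t - U) - g0 * (t - U)| <= Num.sqrt (t - U).
    by move=> h; apply: (le_trans h); rewrite ler_wsqrtr// gerBl.
  near: t; have [T0 [_ hT0]] := Gam_near; exists (T0 + U); split; first exact: num_real.
  by move=> x /= xT; apply: hT0; rewrite ltrBrDr.
have [hC1 hC2] : (forall th, th <= 0 -> (L t th <= (expR (th * (A * Gam t - C' * Num.sqrt t) +
     th ^+ 2 / 2 * q * Gam t))%:E)%E) /\
  (forall th l p U, 0 <= th -> 0 <= l -> 0 <= U ->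
     (forall v, U <= v -> l <= progeny_square gam p 0 v) ->
     ((expR (th * (A * Gam t - C' * Num.sqrt t) + th ^+ 2 / 2 * (l * Gam (t - U))))%:E
      <= L t th)%E) by near: t; exact: hC'.
rewrite -/s in Gt hC1 hC2; rewrite -/u in u1 uK uth; rewrite -/v in v1 vK.
have thm : `|th| <= theta_max rho.
  rewrite normrM (gtr0_norm u0); move: uth; rewrite ler_pdivlMr ?ltr_wpDl//.
  by apply: le_trans; rewrite mulrDr mulr1 mulrC lerDl ltW.
have [hC3 hC4] := hC t th t0 thm.
have bE : b t = v ^+ 2 by rewrite /b /v /s expr_div_n sqr_sqrtr// ltW.
have K1v : K1 * v <= e / 3 * v ^+ 2.
  have -> : e / 3 * v ^+ 2 = v * e / 3 * v by field.
  rewrite ler_wpM2r ?(ltW v0)// ler_pdivlMr//; move: vK; rewrite ler_pdivrMr//.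
have K2u : K2 * u <= e / 3.
  move: uK; rewrite ler_pdivlMr ?mulr_gt0 ?ltr_wpDl// => h.
  by rewrite ler_pdivlMr// (le_trans _ h)// (_ : _ * (3 * _) = K2 * u * 3 + u * 3); [rewrite lerDl mulr_ge0// ltW|ring].
rewrite laplaceE// -/u -/th bE.
have e'q : e' <= q by exact: le_trans q_ge1.
have [h1 h2 h3 h4] := @scaled_exponent_bounds _ A C C' g0 q c e e' U u v s t
  (Gam t) (Gam (t - U)) A0 C0 g0_ge0 q0 e0 e'0 e'q U0 u0 u1 v1 s0 st sst us e'e K1v K2u Gt Gtu.
have lower_goal x : v ^+ 2 * (g0 * q * c ^+ 2 / 2 - e) <= - (th * (m * t)) + x ->
    ((expR x)%:E <= L t th ->
    (expR (v ^+ 2 * (g0 * q * c ^+ 2 / 2 - e)))%:E <=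
    (expR (- (th * (m * t))))%:E * L t th)%E.
  move=> hx xL; apply: (@le_trans _ _ ((expR (- (th * (m * t))))%:E * (expR x)%:E)%E).
    by rewrite -EFinM lee_fin -expRD ler_expR.
  by apply: lee_wpmul2l => //; rewrite lee_fin expR_ge0.
have upper_goal x : - (th * (m * t)) + x <= v ^+ 2 * (g0 * q * c ^+ 2 / 2 + e) ->
    (L t th <= (expR x)%:E ->
    (expR (- (th * (m * t))))%:E * L t th <=
    (expR (v ^+ 2 * (g0 * q * c ^+ 2 / 2 + e)))%:E)%E.
  move=> hx xL; apply: (@le_trans _ _ ((expR (- (th * (m * t))))%:E * (expR x)%:E)%E).
    by apply: lee_wpmul2l => //; rewrite lee_fin expR_ge0.
  by rewrite -EFinM lee_fin -expRD ler_expR.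
rewrite -/A in hC3 hC4; rewrite -/q in hC3 hC4.
have [c0|/ltW c0] := leP 0 c.
- have th0 : 0 <= th by rewrite mulr_ge0// ltW.
  split; first exact: lower_goal (h4 c0) (hC2 _ _ _ _ th0 l0 U0 hU).
  exact: upper_goal h1 (hC3 th0).
- have th0 : th <= 0 by rewrite mulr_le0_ge0// ltW.
  by split; [exact: lower_goal h2 (hC4 th0)|exact: upper_goal (h3 c0) (hC1 _ th0)].
Unshelve. all: by end_near. Qed.

End scaling.

(** * Consequences of the hypotheses on the exciting functions *)

Lemma kernel_on_locally_integrable {R : realType} (g : R -> R) :
  (forall t, 0 <= t -> 0 <= g t) -> measurable_fun (`[0%R, +oo[ : set R) g ->
  (forall t, (\int[@lebesgue_measure R]_(s in `[0%R, t]) (g s)%:E < +oo)%E) -> kernel_on g.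
Proof.
move=> g_ge0 mg gloc; split => // t; apply/integrableP; split.
  by apply/measurable_EFinP; apply: measurable_funS mg => //; exact: itv0c_sub.
rewrite [ltLHS](_ : _ = \int[@lebesgue_measure R]_(s in `[0%R, t]) (g s)%:E)%E//.
apply: eq_integral => s; rewrite inE/= in_itv/= => /andP[s0 _].
by rewrite ger0_norm ?g_ge0.
Qed.

Section masses.
Context {R : realType}.
Local Notation mu := (@lebesgue_measure R).
Variable gam : nat -> R -> R.
Hypothesis gam_ge0 : forall n t, 0 <= t -> 0 <= gam n t.
Hypothesis gam_meas : forall n, measurable_fun (`[0%R, +oo[ : set R) (gam n).
Let mass n := (\int[mu]_(s in `[0%R, +oo[) (gam n s)%:E)%E.
(** Index 0 is excluded, as [gam 0] has infinite mass whenever the immigration rate is positive. *)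
Let sup_mass := ereal_sup [set mass n | n in [set n : nat | (0 < n)%N]].
Hypothesis sup_lt1 : (sup_mass < 1)%E.

Let mass_le n : (mass n.+1 <= sup_mass)%E.
Proof. by apply: ereal_sup_ubound; exists n.+1. Qed.

Let mass_ge0 n : (0 <= mass n)%E.
Proof.
by apply: integral_ge0 => s /=; rewrite in_itv/= andbT lee_fin; exact: gam_ge0.
Qed.

Let sup_fin : sup_mass \is a fin_num.
Proof.
rewrite ge0_fin_numE; first by rewrite (lt_trans sup_lt1)// ltry.
exact: le_trans (mass_ge0 1) (mass_le 0).
Qed.

Lemma integrable_lt1 n : mu.-integrable `[0, +oo[ (EFin \o gam n.+1).
Proof.
apply/integrableP; split; first by apply/measurable_EFinP; exact: gam_meas.
rewrite [ltLHS](_ : _ = mass n.+1).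
  by rewrite (le_lt_trans (mass_le n))// (lt_trans sup_lt1)// ltry.
apply: eq_integral => s; rewrite inE/= in_itv/= andbT => s0.
by rewrite ger0_norm ?gam_ge0.
Qed.

Lemma intg_le_sup n : intg gam n.+1 <= fine sup_mass.
Proof.
apply: fine_le => //; last exact: mass_le.
rewrite -/(mass n.+1) ge0_fin_numE//.
by rewrite (le_lt_trans (mass_le n))// (lt_trans sup_lt1)// ltry.
Qed.

Lemma sup_mass_lt1 : fine sup_mass < 1.
Proof. by rewrite -lte_fin fineK. Qed.

End masses.

Section immigration_rate.
Context {R : realType}.
Local Notation mu := (@lebesgue_measure R).
Variables (g : R -> R) (g0 : R).
Hypothesis kg : kernel_on g.
Let G t : R := \int[mu]_(s in `[0, t]) g s.

Let GE t : (\int[mu]_(s in `[0%R, t]) (g s)%:E)%E = (G t)%:E.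
Proof. by rewrite fineK//; apply: integrable_fin_num => //; case: kg. Qed.

Lemma immigration_rate_ge0 :
  ((t^-1)%:E * \int[mu]_(s in `[0%R, t]) (g s)%:E)%E @[t --> +oo] --> g0%:E -> 0 <= g0.
Proof.
move=> Gg; rewrite -lee_fin; apply: (cvge_ge _ Gg).
near=> t; rewrite GE -EFinM lee_fin mulr_ge0 ?Rintegral_kernel_ge0//.
by rewrite invr_ge0; near: t; apply: nbhs_pinfty_ge; exact: num_real.
Unshelve. all: by end_near. Qed.

(** G t - g0 t is sqrt t times the quantity in (iii), which is eventually at most 1 in absolute
    value. *)
Lemma immigration_near :
  ((Num.sqrt t)%:E * ((t^-1)%:E * \int[mu]_(s in `[0%R, t]) (g s)%:E - g0%:E))%E
     @[t --> +oo] --> 0%E ->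
  \forall t \near +oo, `|G t - g0 * t| <= Num.sqrt t.
Proof.
move=> h.
have {}h : Num.sqrt t * (t^-1 * G t - g0) @[t --> +oo] --> 0.
  by move/fine_cvg : h; under eq_fun do rewrite GE.
have {}h : \forall t \near +oo, `|Num.sqrt t * (t^-1 * G t - g0)| <= 1.
  by move/cvgr0_norm_le : h; apply.
near=> t.
have t0 : 0 < t by near: t; exact: nbhs_pinfty_gt.
have h1 : `|Num.sqrt t * (t^-1 * G t - g0)| <= 1 by near: t.
have s0 : 0 < Num.sqrt t by rewrite sqrtr_gt0.
have -> : G t - g0 * t = Num.sqrt t * (Num.sqrt t * (t^-1 * G t - g0)).
  by rewrite mulrA -expr2 sqr_sqrtr ?(ltW t0)//; field; rewrite gt_eqF.
by rewrite normrM (gtr0_norm s0) ler_piMr// ltW.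
Unshelve. all: by end_near. Qed.

End immigration_rate.

Theorem theorem4p4 (R : realType) (d : measure_display) (T : measurableType d)
  (P : probability T R) (gam : nat -> R -> R) (N : nat -> T -> set R)
  (g0 : R) (a : R -> R) (A : set R) :
  (* nonnegative, locally integrable exciting functions on [0, oo) *)
  (forall n t, 0 <= t -> 0 <= gam n t) ->
  (forall n, measurable_fun (`[0%R, +oo[ : set R) (gam n)) ->
  (forall n t, (\int[@lebesgue_measure R]_(s in `[0%R, t]) (gam n s)%:E < +oo)%E) ->
  is_hawkes P gam N ->
  (* (i) *)
  ((t^-1)%:E * \int[@lebesgue_measure R]_(s in `[0%R, t]) (gam 0%N s)%:E)%E
     @[t --> +oo] --> g0%:E ->
  (* (ii) *)
  (ereal_sup [set \int[@lebesgue_measure R]_(s in `[0%R, +oo[) (gam n s)%:E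
                | n in [set n : nat | (0 < n)%N]] < 1)%E ->
  (* (iii) *)
  ((Num.sqrt t)%:E * ((t^-1)%:E * \int[@lebesgue_measure R]_(s in `[0%R, t]) (gam 0%N s)%:E
                       - g0%:E))%E
     @[t --> +oo] --> 0%E ->
  ((Num.sqrt t)%:E * \int[@lebesgue_measure R]_(s in `[t, +oo[)
                        (\sum_(0 <= p <oo) iconv gam p s))%E
     @[t --> +oo] --> 0%E ->
  (* the speed a(t) *)
  (forall t, 0 < t -> 0 < a t) ->
  a t / Num.sqrt t @[t --> +oo] --> +oo ->
  a t / t @[t --> +oo] --> 0 ->
  measurable A ->
  let m := mtot g0 gam in
  let J := Jrate (sigma2 g0 gam) in
  let f := fun t => ((t / a t ^+ 2)%:E *
             elog (P [set w | exists r : R, Ntot N w t = r%:E /\ A ((r - m * t) / a t)%R]))%E in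
  [/\ (- ereal_inf (J @` interior A) <= limf_einf f (pinfty_nbhs R))%E,
      (limf_einf f (pinfty_nbhs R) <= limf_esup f (pinfty_nbhs R))%E &
      (limf_esup f (pinfty_nbhs R) <= - ereal_inf (J @` closure A))%E].
Proof.
move=> gam_ge0 gam_meas gam_loc hawkesN rate0 sup_lt1 rate_sqrt tail_cvg a_gt0 a_sqrt a_id mA m J f.
have kgam n : kernel_on (gam n) by exact: kernel_on_locally_integrable (gam_ge0 n) (gam_meas n) (gam_loc n).
have igam := integrable_lt1 gam_ge0 gam_meas sup_lt1.
have gam_rho := intg_le_sup gam_ge0 sup_lt1.
have rho1 := sup_mass_lt1 gam_ge0 sup_lt1.
have g0_ge0 := immigration_rate_ge0 (kgam 0%N) rate0.
have Gam_near := immigration_near (kgam 0%N) rate_sqrt.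
have mE : m = g0 * alpha gam 0 by exact: mtotE kgam gam_rho rho1.
have s2E : sigma2 g0 gam = g0 * qsum gam 0 by exact: sigma2E kgam gam_rho rho1.
pose Z t w := (fine (Ntot N w t) - m * t) / a t.
pose b t := a t ^+ 2 / t.
have s2_ge0 : 0 <= sigma2 g0 gam.
  by rewrite s2E mulr_ge0//; exact: qsum_ge0 kgam gam_rho rho1 _.
have mZ t : measurable_fun setT (Z t).
  by rewrite /Z mE; exact: measurable_scaled hawkesN _ _.
have b_pinfty : b t @[t --> +oo] --> +oo by exact: speed_pinfty.
have K_near c e : 0 < e -> \forall t \near +oo,
    ((expR (b t * (sigma2 g0 gam * c ^+ 2 / 2 - e)))%:E <=
       \int[P]_w (expR (c * b t * Z t w))%:E)%E /\
    (\int[P]_w (expR (c * b t * Z t w))%:E <=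
       (expR (b t * (sigma2 g0 gam * c ^+ 2 / 2 + e)))%:E)%E.
  rewrite s2E /Z mE.
  exact: (scaled_laplace_near hawkesN kgam igam gam_rho rho1 g0_ge0 Gam_near tail_cvg
    a_gt0 a_sqrt a_id).
(* Through [fine], [Z] reads an infinite count as 0, whereas the event of the theorem asks for a
   finite count; the two events differ by a null set. *)
have fE : f = fun t => (((b t)^-1)%:E * elog (P (Z t @^-1` A)))%E.
  apply/funext => t; rewrite /f /b invf_div; congr (_ * elog _)%E.
  have mfin : measurable [set w | Ntot N w t \is a fin_num].
    have := emeasurable_fin_num measurableT (measurable_Ntot hawkesN t).
    by rewrite setTI.
  have nfin : P (~` [set w | Ntot N w t \is a fin_num]) = 0%E.
    apply: measure_negligible; first exact: measurableC.
    exact: (Ntot_ae_fin_num hawkesN kgam igam gam_rho rho1 t).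
  have mZA : measurable (Z t @^-1` A) by rewrite -[X in measurable X]setTI; exact: mZ.
  have -> : [set w | exists r : R, Ntot N w t = r%:E /\ A ((r - m * t) / a t)] =
      Z t @^-1` A `\` ~` [set w | Ntot N w t \is a fin_num].
    apply/seteqP; split=> w /=.
      by move=> [r [Nr Ar]]; rewrite /Z Nr/=; split => //; exact.
    move=> [Aw /contrapT Nfin]; exists (fine (Ntot N w t)).
    by rewrite fineK.
  rewrite measureD//; last 2 first.
  - exact: measurableC.
  - by rewrite (le_lt_trans (probability_le1 _ _))// ltry.
  rewrite -[RHS]sube0; congr (_ - _)%E; apply/eqP.
  rewrite eq_le measure_ge0 andbT -[leRHS]nfin le_measure ?inE//.
  - by apply: measurableI => //; exact: measurableC.
  - exact: measurableC.
split; rewrite ?fE.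
- exact: mdp_lower_bound s2_ge0 mZ b_pinfty K_near _ mA.
- exact: limf_einf_le_esup.
- exact: mdp_upper_bound s2_ge0 mZ b_pinfty K_near _ mA.
Qed.
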